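(* Let $A$ be a quasi-category, $X$ a simplicial set and $d\colon X\to A$ a diagram. There is an equivalence of quasi-categories $A_{/d}\xrightarrow{\ \simeq\ }c\downarrow d$ over $A$, i.e. commuting with the projections $\pi\colon A_{/d}\to A$ and $q_0\colon c\downarrow d\to A$, from Joyal's slice quasi-category of cones over $d$ to the comma quasi-category of the constant diagram functor $c\colon A\to A^X$ over $d\colon\Delta^0\to A^X$.
   Context: A quasi-category is a simplicial set with fillers for all inner horns. $A^X$ is the internal hom of simplicial sets (a quasi-category when $A$ is). Equivalences of quasi-categories are the weak equivalences of the Joyal model structure between quasi-categories, equivalently equivalences in the 2-category $\mathrm{qCat}_2$ of quasi-categories with hom-categories $h(B^A)$, where $h\colon\mathrm{sSet}\to\mathrm{Cat}$ is left adjoint to the nerve. Join: regarding simplicial sets as having exactly one $(-1)$-simplex, the $n$-simplices of $Y\star X$ are pairs $(y,x)\in Y_r\times X_s$ with $r,s\ge-1$ and $r+s+1=n$; an operator $\alpha\colon[m]\to[r+s+1]$ decomposes uniquely as an ordinal sum of $\alpha_1\colon[m_1]\to[r]$ and $\alpha_2\colon[m_2]\to[s]$ and acts by $(y\cdot\alpha_1,x\cdot\alpha_2)$. Slice: the $n$-simplices of $A_{/d}$ are the maps $\Delta^n\star X\to A$ restricting to $d$ on $X$; the projection $\pi\colon A_{/d}\to A$ restricts such a map to $\Delta^n$. The constant diagram functor $c\colon A\to A^X$ is the transpose of the projection $A\times X\to A$, and $d$ is also regarded as a vertex $\Delta^0\to A^X$. The comma quasi-category $c\downarrow d$ is the pullback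 of $(\mathrm{cod},\mathrm{dom})\colon(A^X)^{\Delta^1}\to A^X\times A^X$ along $d\times c\colon\Delta^0\times A\to A^X\times A^X$, and $q_0\colon c\downarrow d\to A$ is its projection. *)

(* Defs.v *)
From HB Require Import structures.
From mathcomp Require Import all_boot all_order.
From mathcomp Require Import boolp.

Set Implicit Arguments.
Unset Strict Implicit.
Unset Printing Implicit Defensive.

Import Order.TTheory.

(* The augmented simplex category: the ordinal [n] is 'I_n.+1 and the empty   *)
(* ordinal [-1] is 'I_0.                                                      *)
Definition op (m n : nat) := {omorphism 'I_m -> 'I_n}.

Definition mk_op m n (f : 'I_m -> 'I_n)
    (h : {homo f : i j / (i <= j)%N}) : op m n :=
  HB.pack f (Order.isOrderMorphism.Build _ _ _ _ f h).

Definition op_id n : op n n := idfun.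
Definition op_comp k m n (b : op m n) (a : op k m) : op k n := b \o a.

Lemma op_le m n (a : op m n) (i j : 'I_m) : (i <= j)%N -> (a i <= a j)%N.
Proof. exact: (@omorph_le _ _ _ _ a). Qed.

Lemma op_ext m n (a b : op m n) : a =1 b -> a = b.
Proof.
case: a b => f [[hf]] [g [[hg]]] /= e.
have {}e : f = g by apply/funext.
by case: _ / e hg => hg; rewrite (Prop_irrelevance hf hg).
Qed.

Lemma op_cast_subproof m n (e : m = n) :
  {homo cast_ord e : i j / (i <= j)%N}.
Proof. by []. Qed.
Definition op_cast m n (e : m = n) : op m n := mk_op (op_cast_subproof e).

Lemma op_vtx_subproof n (i : 'I_n) :
  {homo (fun _ : 'I_1 => i) : j k / (j <= k)%N}.
Proof. by []. Qed.
Definition op_vtx n (i : 'I_n) : op 1 n := mk_op (@op_vtx_subproof n i).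

Lemma op_edge_subproof n (i j : 'I_n) (le_ij : (i <= j)%N) :
  {homo (fun u : 'I_2 => if u == ord0 then i else j) : u v / (u <= v)%N}.
Proof.
move=> u v le_uv; case: eqVneq => [_|nu]; case: eqVneq => // ev.
by move: nu; rewrite -val_eqE /= -leqn0 (leq_trans le_uv) // ev.
Qed.
Definition op_edge n (i j : 'I_n) (le_ij : (i <= j)%N) : op 2 n :=
  mk_op (op_edge_subproof le_ij).

Lemma op_const_subproof n :
  {homo (fun _ : 'I_n => ord0 : 'I_1) : j k / (j <= k)%N}.
Proof. by []. Qed.
Definition op_const n : op n 1 := mk_op (@op_const_subproof n).

(* Simplicial sets; [act a x] is the right action x . a of the operator a.    *)
Record sset := SSet {
  simp :> nat -> Type;
  act : forall m n, op m.+1 n.+1 -> simp n -> simp m;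
  act_id : forall n (x : simp n), act (op_id n.+1) x = x;
  act_comp : forall k m n (a : op k.+1 m.+1) (b : op m.+1 n.+1) (x : simp n),
    act a (act b x) = act (op_comp b a) x }.

Record smap (X Y : sset) := SMap {
  sfun :> forall n, X n -> Y n;
  sfun_act : forall m n (a : op m.+1 n.+1) (x : X n),
    sfun (act a x) = act a (sfun x) }.

Lemma smap_ext X Y (f g : smap X Y) : (forall n (x : X n), f n x = g n x) -> f = g.
Proof.
case: f g => f hf [g hg] /= e.
have {}e : f = g by apply/functional_extensionality_dep => n; apply/funext.
by case: _ / e hg => hg; rewrite (Prop_irrelevance hf hg).
Qed.

Definition smap_id X : smap X X :=
  @SMap X X (fun _ x => x) (fun _ _ _ _ => erefl).

Lemma smap_comp_subproof X Y Z (g : smap Y Z) (f : smap X Y) m n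
    (a : op m.+1 n.+1) (x : X n) : g m (f m (act a x)) = act a (g n (f n x)).
Proof. by rewrite !sfun_act. Qed.
Definition smap_comp X Y Z (g : smap Y Z) (f : smap X Y) : smap X Z :=
  SMap (smap_comp_subproof g f).

Lemma std_act_id N n (b : op n.+1 N.+1) : op_comp b (op_id n.+1) = b.
Proof. exact: op_ext. Qed.
Lemma std_act_comp N k m n (a : op k.+1 m.+1) (b : op m.+1 n.+1)
    (c : op n.+1 N.+1) : op_comp (op_comp c b) a = op_comp c (op_comp b a).
Proof. exact: op_ext. Qed.
Definition std (N : nat) : sset :=
  @SSet (fun n => op n.+1 N.+1) (fun _ _ a b => op_comp b a)
        (@std_act_id N) (@std_act_comp N).

Lemma std_map_subproof M N (b : op M.+1 N.+1) m n (a : op m.+1 n.+1)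
    (x : std M n) : op_comp b (act a x) = act a (op_comp b x : std N n).
Proof. exact: op_ext. Qed.
Definition std_map M N (b : op M.+1 N.+1) : smap (std M) (std N) :=
  @SMap (std M) (std N) (fun n x => op_comp b x) (std_map_subproof b).

Definition in_horn N (k : 'I_N.+1) n (a : std N n) : Prop :=
  exists j : 'I_N.+1, j <> k /\ forall i, a i <> j.

Lemma horn_act_subproof N (k : 'I_N.+1) m n (a : op m.+1 n.+1) (x : std N n) :
  in_horn k x -> in_horn k (act a x).
Proof. by case=> j [jk hj]; exists j; split=> // i; apply: hj. Qed.

Definition horn_act N (k : 'I_N.+1) m n (a : op m.+1 n.+1)
    (x : {x : std N n | in_horn k x}) : {x : std N m | in_horn k x} :=
  exist _ (act a (sval x)) (horn_act_subproof a (svalP x)).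
Lemma horn_act_id N (k : 'I_N.+1) n (x : {x : std N n | in_horn k x}) :
  horn_act (op_id n.+1) x = x.
Proof. by case: x => x hx; apply: eq_exist; apply: act_id. Qed.
Lemma horn_act_comp N (k : 'I_N.+1) l m n (a : op l.+1 m.+1)
    (b : op m.+1 n.+1) (x : {x : std N n | in_horn k x}) :
  horn_act a (horn_act b x) = horn_act (op_comp b a) x.
Proof. by apply: eq_exist; apply: act_comp. Qed.
Definition horn N (k : 'I_N.+1) : sset :=
  SSet (@horn_act_id N k) (@horn_act_comp N k).

Definition horn_incl N (k : 'I_N.+1) : smap (horn k) (std N) :=
  @SMap (horn k) (std N) (fun _ x => sval x) (fun _ _ _ _ => erefl).

Definition quasi_category (A : sset) : Prop :=
  forall N (k : 'I_N.+1), (0 < k < N)%N ->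
  forall h : smap (horn k) A,
  exists f : smap (std N) A, smap_comp f (horn_incl k) = h.

Lemma sprod_act_id (X Y : sset) n (p : X n * Y n) :
  (act (op_id n.+1) p.1, act (op_id n.+1) p.2) = p.
Proof. by rewrite !act_id -surjective_pairing. Qed.
Lemma sprod_act_comp (X Y : sset) k m n (a : op k.+1 m.+1) (b : op m.+1 n.+1)
    (p : X n * Y n) :
  (act a (act b p.1), act a (act b p.2)) =
  (act (op_comp b a) p.1, act (op_comp b a) p.2).
Proof. by rewrite !act_comp. Qed.
Definition sprod (X Y : sset) : sset :=
  @SSet (fun n => X n * Y n)%type (fun m n a p => (act a p.1, act a p.2))
        (@sprod_act_id X Y) (@sprod_act_comp X Y).

Definition sfst X Y : smap (sprod X Y) X :=
  @SMap (sprod X Y) X (fun _ p => p.1) (fun _ _ _ _ => erefl).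
Definition ssnd X Y : smap (sprod X Y) Y :=
  @SMap (sprod X Y) Y (fun _ p => p.2) (fun _ _ _ _ => erefl).

Lemma spair_subproof Z X Y (f : smap Z X) (g : smap Z Y) m n
    (a : op m.+1 n.+1) (z : Z n) :
  (f m (act a z), g m (act a z)) = act a ((f n z, g n z) : sprod X Y n).
Proof. by rewrite !sfun_act. Qed.
Definition spair Z X Y (f : smap Z X) (g : smap Z Y) : smap Z (sprod X Y) :=
  @SMap Z (sprod X Y) (fun n z => (f n z, g n z)) (spair_subproof f g).

Definition sprod_map X Y X' Y' (f : smap X X') (g : smap Y Y') :
    smap (sprod X Y) (sprod X' Y') :=
  spair (smap_comp f (sfst X Y)) (smap_comp g (ssnd X Y)).

Section Pullback.
Variables (X Y Z : sset) (f : smap X Z) (g : smap Y Z).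

Definition pb_simp n := {p : X n * Y n | f n p.1 = g n p.2}.
Lemma pb_act_subproof m n (a : op m.+1 n.+1) (p : pb_simp n) :
  f m (act a (sval p).1) = g m (act a (sval p).2).
Proof. by rewrite !sfun_act (svalP p). Qed.
Definition pb_act m n (a : op m.+1 n.+1) (p : pb_simp n) : pb_simp m :=
  exist (fun q : X m * Y m => f m q.1 = g m q.2)
        (act a (sval p).1, act a (sval p).2) (pb_act_subproof a p).
Lemma pb_act_id n (p : pb_simp n) : pb_act (op_id n.+1) p = p.
Proof. by case: p => -[x y] h; apply: eq_exist; rewrite /= !act_id. Qed.
Lemma pb_act_comp k m n (a : op k.+1 m.+1) (b : op m.+1 n.+1) (p : pb_simp n) :
  pb_act a (pb_act b p) = pb_act (op_comp b a) p.
Proof. by apply: eq_exist; rewrite /= !act_comp. Qed.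
Definition pullback : sset := SSet pb_act_id pb_act_comp.

Definition pb_fst : smap pullback X :=
  @SMap pullback X (fun _ p => (sval p).1) (fun _ _ _ _ => erefl).
Definition pb_snd : smap pullback Y :=
  @SMap pullback Y (fun _ p => (sval p).2) (fun _ _ _ _ => erefl).
End Pullback.

Section InternalHom.
Variables (X B : sset).

Definition ihom_act m n (a : op m.+1 n.+1) (f : smap (sprod (std n) X) B) :
    smap (sprod (std m) X) B :=
  smap_comp f (sprod_map (std_map a) (smap_id X)).
Lemma ihom_act_id n (f : smap (sprod (std n) X) B) :
  ihom_act (op_id n.+1) f = f.
Proof. by apply: smap_ext => m [b x] /=; congr (f m (_, _)); apply: op_ext. Qed.
Lemma ihom_act_comp k m n (a : op k.+1 m.+1) (b : op m.+1 n.+1)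
    (f : smap (sprod (std n) X) B) :
  ihom_act a (ihom_act b f) = ihom_act (op_comp b a) f.
Proof. by apply: smap_ext => l [c x] /=; congr (f l (_, _)); apply: op_ext. Qed.
Definition ihom : sset := SSet ihom_act_id ihom_act_comp.
End InternalHom.

Section Transpose.
Variables (A X B : sset) (f : smap (sprod A X) B).

Lemma transpose_at_subproof n (a : A n) k l (t : op k.+1 l.+1)
    (p : sprod (std n) X l) :
  f k (act (act t p).1 a, (act t p).2) = act t (f l (act p.1 a, p.2)).
Proof. by rewrite -sfun_act /= act_comp. Qed.
Definition transpose_at n (a : A n) : ihom X B n :=
  @SMap (sprod (std n) X) B (fun k p => f k (act (p.1 : op _ _) a, p.2))
        (transpose_at_subproof a).
Lemma transpose_subproof m n (t : op m.+1 n.+1) (a : A n) :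
  transpose_at (act t a) = act t (transpose_at a).
Proof. by apply: smap_ext => k [b x] /=; rewrite act_comp. Qed.
Definition transpose : smap A (ihom X B) := SMap transpose_subproof.
End Transpose.

(* Evaluation B^X -> B at a vertex v of X, i.e. restriction along            *)
(* v : std 0 -> X followed by the canonical isomorphism B^(std 0) = B.       *)
Lemma ihom_ev_subproof (X B : sset) (v : X 0) m n (a : op m.+1 n.+1) (f : ihom X B n) :
  act a f m (op_id m.+1, act (op_const m.+1) v) =
  act a (f n (op_id n.+1, act (op_const n.+1) v)).
Proof.
rewrite -sfun_act /= act_comp.
by congr (f m (_, act _ v)); apply: op_ext => i //=; rewrite [LHS]ord1 [RHS]ord1.
Qed.
Definition ihom_ev (X B : sset) (v : X 0) : smap (ihom X B) B :=
  SMap (@ihom_ev_subproof X B v).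

Definition arrow_dom B : smap (ihom (std 1) B) B :=
  ihom_ev B (op_vtx (ord0 : 'I_2) : std 1 0).
Definition arrow_cod B : smap (ihom (std 1) B) B :=
  ihom_ev B (op_vtx (ord_max : 'I_2) : std 1 0).

Definition const_diag A X : smap A (ihom X A) := transpose (sfst A X).

Definition diag_vertex X A (d : smap X A) : smap (std 0) (ihom X A) :=
  transpose (smap_comp d (ssnd (std 0) X)).

(* The pullback identifies the codomain with d and the domain with c.        *)
Section Comma.
Variables (X A : sset) (d : smap X A).

Definition comma : sset :=
  pullback (spair (arrow_cod (ihom X A)) (arrow_dom (ihom X A)))
           (sprod_map (diag_vertex d) (const_diag A X)).

Definition comma_proj : smap comma A := smap_comp (ssnd (std 0) A) (pb_snd _ _).
End Comma.

(* The (k-1)-simplices of X, with exactly one (-1)-simplex.                   *)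
Definition aug (X : sset) (k : nat) : Type := if k is r.+1 then X r else unit.

Definition op_to0 (T : Type) m (a : op m.+1 0) : T :=
  match a ord0 with Ordinal _ h => match notF h with end end.

Definition aug_act (X : sset) k l : op k l -> aug X l -> aug X k :=
  match k, l return op k l -> aug X l -> aug X k with
  | 0, _ => fun _ _ => tt
  | r.+1, s.+1 => fun a x => act a x
  | r.+1, 0 => fun a _ => op_to0 (X r) a
  end.

Lemma aug_act_id X k (x : aug X k) : aug_act (op_id k) x = x.
Proof. by case: k x => [[]|k x] //=; apply: act_id. Qed.

Lemma aug_act_comp X k l n (a : op k l) (b : op l n) (x : aug X n) :
  aug_act a (aug_act b x) = aug_act (op_comp b a) x.
Proof.
case: k a => [|k] a //; case: l a b => [|l] a b; first by case: (a ord0).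
by case: n b x => [|n] b x; [case: (b ord0) | apply: act_comp].
Qed.

Definition aug_map X Y (f : smap X Y) k : aug X k -> aug Y k :=
  if k is r.+1 then fun x => f r x else fun _ => tt.

Lemma aug_map_act X Y (f : smap X Y) k l (a : op k l) (x : aug X l) :
  aug_map f (aug_act a x) = aug_act a (aug_map f x).
Proof.
case: k a => [|k] a //; case: l a x => [|l] a x; first by case: (a ord0).
exact: sfun_act.
Qed.

(* When n = k + l, the operator a : op m n is the ordinal sum of              *)
(* op_lo : op lo_size k and op_hi : op hi_size l.                             *)
Section Cut.
Variables (m n : nat) (a : op m n).

Definition lo_size k := #|[pred i | (a i < k)%N]|.
Definition hi_size k := #|[pred i | (k <= a i)%N]|.

Lemma lo_hi_size k : lo_size k + hi_size k = m.
Proof.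
rewrite -[RHS]card_ord -(cardC [pred i | (a i < k)%N]); congr addn.
by apply: eq_card => i; rewrite !inE /= -leqNgt.
Qed.

Lemma lo_sizeP k (i : 'I_m) : (a i < k)%N = (i < lo_size k)%N.
Proof.
pose D (j : nat) := #|[pred i : 'I_m | (i < j)%N]|.
have DE j : (j <= m)%N -> D j = j.
  move=> lejm; rewrite /D -sum1_card.
  rewrite -(big_ord_widen_cond m xpredT (fun=> 1%N) lejm).
  by rewrite sum1_card card_ord.
apply/idP/idP => [lt_aik|].
  rewrite -[X in (X <= _)%N](DE i.+1 (ltn_ord i)) /D /lo_size; apply: subset_leq_card.
  by apply/subsetP => j; rewrite !inE ltnS => /(op_le a) le_ji; apply: leq_ltn_trans lt_aik.
apply: contraLR; rewrite -!leqNgt => le_kai.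
rewrite -[X in (_ <= X)%N](DE i (ltnW (ltn_ord i))) /D /lo_size; apply: subset_leq_card.
apply/subsetP => j; rewrite !inE => lt_ajk; rewrite ltnNge; apply/negP.
by move=> /(op_le a) /(leq_trans le_kai); rewrite leqNgt lt_ajk.
Qed.

Variables (k l : nat) (kl : k + l = n).

Lemma lo_in_subproof (i : 'I_(lo_size k)) : (i < m)%N.
Proof. by rewrite (leq_trans (ltn_ord i)) // -(lo_hi_size k) leq_addr. Qed.
Definition lo_in (i : 'I_(lo_size k)) : 'I_m := Ordinal (lo_in_subproof i).
Lemma lo_val_subproof (i : 'I_(lo_size k)) : (a (lo_in i) < k)%N.
Proof. by rewrite lo_sizeP /=. Qed.
Lemma op_lo_subproof :
  {homo (fun i => Ordinal (lo_val_subproof i)) : i j / (i <= j)%N}.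
Proof. by move=> i j le_ij; apply: (op_le a). Qed.
Definition op_lo : op (lo_size k) k := mk_op op_lo_subproof.

Lemma hi_in_subproof (i : 'I_(hi_size k)) : (lo_size k + i < m)%N.
Proof. by rewrite -[X in (_ < X)%N](lo_hi_size k) ltn_add2l. Qed.
Definition hi_in (i : 'I_(hi_size k)) : 'I_m := Ordinal (hi_in_subproof i).
Lemma hi_ge (i : 'I_(hi_size k)) : (k <= a (hi_in i))%N.
Proof. by rewrite leqNgt lo_sizeP -leqNgt leq_addr. Qed.
Lemma hi_val_subproof (i : 'I_(hi_size k)) : (a (hi_in i) - k < l)%N.
Proof. by rewrite ltn_subLR ?hi_ge // kl. Qed.
Lemma op_hi_subproof :
  {homo (fun i => Ordinal (hi_val_subproof i)) : i j / (i <= j)%N}.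
Proof. by move=> i j le_ij; apply/leq_sub2r/(op_le a); rewrite /= leq_add2l. Qed.
Definition op_hi : op (hi_size k) l := mk_op op_hi_subproof.
End Cut.

(* An n-simplex of Y * X: y of dimension jk - 1 and x of dimension jl - 1,    *)
(* with (jk - 1) + (jl - 1) + 1 = n.                                          *)
Record join_simp (Y X : sset) (n : nat) := JoinSimp {
  jk : nat;
  jl : nat;
  jkl : jk + jl = n.+1;
  jy : aug Y jk;
  jx : aug X jl }.

Lemma join_simp_ext Y X n (u v : join_simp Y X n)
    (ek : jk u = jk v) (el : jl u = jl v) :
  jy u = aug_act (op_cast ek) (jy v) -> jx u = aug_act (op_cast el) (jx v) ->
  u = v.
Proof.
case: u v ek el => k l kl y x [k' l' kl' y' x'] /= ek el.
case: _ / ek kl' y' => kl' y'; case: _ / el kl' x' => kl' x'.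
have ci j : op_cast (erefl j) = op_id j by apply: op_ext => i; apply: cast_ord_id.
by rewrite !ci !aug_act_id => -> ->; rewrite (Prop_irrelevance kl kl').
Qed.

Section Join.
Variables (Y X : sset).

Definition join_act m n (a : op m.+1 n.+1) (u : join_simp Y X n) :
    join_simp Y X m :=
  JoinSimp (lo_hi_size a (jk u))
           (aug_act (op_lo a (jk u)) (jy u)) (aug_act (op_hi a (jkl u)) (jx u)).

Lemma join_act_id n (u : join_simp Y X n) : join_act (op_id n.+1) u = u.
Proof.
have ek : lo_size (op_id n.+1) (jk u) = jk u.
  have lek : (jk u <= n.+1)%N by rewrite -(jkl u) leq_addr.
  rewrite /lo_size -sum1_card.
  rewrite -(big_ord_widen_cond n.+1 xpredT (fun=> 1%N) lek).
  by rewrite sum1_card card_ord.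
have el : hi_size (op_id n.+1) (jk u) = jl u.
  by apply/eqP; rewrite -(eqn_add2l (jk u)) jkl -{1}ek lo_hi_size.
apply: (@join_simp_ext Y X n (join_act (op_id n.+1) u) u ek el) => /=; congr aug_act; apply: op_ext => i.
  exact: val_inj.
by apply: val_inj; rewrite /= ek addKn.
Qed.

Lemma join_act_comp k m n (a : op k.+1 m.+1) (b : op m.+1 n.+1)
    (u : join_simp Y X n) :
  join_act a (join_act b u) = join_act (op_comp b a) u.
Proof.
have ek : lo_size a (lo_size b (jk u)) = lo_size (op_comp b a) (jk u).
  by apply: eq_card => i; rewrite !inE -lo_sizeP.
have el : hi_size a (lo_size b (jk u)) = hi_size (op_comp b a) (jk u).
  by apply: eq_card => i; rewrite !inE leqNgt -lo_sizeP -leqNgt.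
apply: (@join_simp_ext Y X k (join_act a (join_act b u))
                       (join_act (op_comp b a) u) ek el) => /=;
  rewrite !aug_act_comp; congr aug_act; apply: op_ext => i; apply: val_inj => /=.
  by congr (val (b _)); apply: val_inj => /=; congr (val (a _)); apply: val_inj.
congr (val (b _) - _); apply: val_inj => /=.
rewrite subnKC; last by rewrite leqNgt lo_sizeP -leqNgt leq_addr.
by congr (val (a _)); apply: val_inj; rewrite /= ek.
Qed.

Definition join : sset := SSet join_act_id join_act_comp.

Definition join_inl_fun n (y : Y n) : join n :=
  @JoinSimp Y X n n.+1 0 (addn0 _) y tt.
Lemma join_inl_subproof m n (a : op m.+1 n.+1) (y : Y n) :
  join_inl_fun (act a y) = act a (join_inl_fun y).
Proof.
have ek : m.+1 = lo_size a n.+1.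
  by rewrite /lo_size -[LHS]card_ord; apply: eq_card => i; rewrite !inE ltn_ord.
have el : 0 = hi_size a n.+1.
  by apply/eqP; rewrite -(eqn_add2l (lo_size a n.+1)) lo_hi_size -ek addn0.
apply: (@join_simp_ext Y X m (join_inl_fun (act a y))
                       (join_act a (join_inl_fun y)) ek el).
  change (aug_act a (y : aug Y n.+1) =
          aug_act (op_cast ek) (aug_act (op_lo a n.+1) (y : aug Y n.+1))).
  rewrite aug_act_comp; congr aug_act.
  by apply: op_ext => i; apply: val_inj => /=; congr (val (a _)); apply: val_inj.
by [].
Qed.
Definition join_inl : smap Y join := SMap join_inl_subproof.

Definition join_inr_fun n (x : X n) : join n :=
  @JoinSimp Y X n 0 n.+1 (add0n _) tt x.
Lemma join_inr_subproof m n (a : op m.+1 n.+1) (x : X n) :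
  join_inr_fun (act a x) = act a (join_inr_fun x).
Proof.
have ek : 0 = lo_size a 0 by rewrite /lo_size eq_card0.
have el : m.+1 = hi_size a 0.
  by rewrite -[LHS](lo_hi_size a 0) -ek.
apply: (@join_simp_ext Y X m (join_inr_fun (act a x))
                       (join_act a (join_inr_fun x)) ek el) => //.
change (aug_act a (x : aug X n.+1) =
  aug_act (op_cast el) (aug_act (op_hi a (add0n n.+1)) (x : aug X n.+1))).
rewrite aug_act_comp; congr aug_act.
apply: op_ext => i; apply: val_inj => /=; rewrite subn0.
by congr (val (a _)); apply: val_inj; rewrite /= -ek.
Qed.
Definition join_inr : smap X join := SMap join_inr_subproof.
End Join.

Section JoinMap.
Variables (Y Y' X X' : sset) (f : smap Y Y') (g : smap X X').
Definition join_map_fun n (u : join Y X n) : join Y' X' n :=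
  JoinSimp (jkl u) (aug_map f (jy u)) (aug_map g (jx u)).
Lemma join_map_subproof m n (a : op m.+1 n.+1) (u : join Y X n) :
  join_map_fun (act a u) = act a (join_map_fun u).
Proof. by congr JoinSimp; apply: aug_map_act. Qed.
Definition join_map : smap (join Y X) (join Y' X') := SMap join_map_subproof.
End JoinMap.

Lemma join_map_id Y X : join_map (smap_id Y) (smap_id X) = smap_id (join Y X).
Proof.
apply: smap_ext => n [k l kl y x]; congr JoinSimp => /=.
  by case: k kl y => // kl [].
by case: l kl x => // kl [].
Qed.

Lemma join_map_comp Y Y' Y'' X X' X'' (f : smap Y Y') (f' : smap Y' Y'')
    (g : smap X X') (g' : smap X' X'') :
  smap_comp (join_map f' g') (join_map f g) =
  join_map (smap_comp f' f) (smap_comp g' g).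
Proof.
apply: smap_ext => n [k l kl y x]; congr JoinSimp => /=.
  by case: k kl y.
by case: l kl x.
Qed.

Lemma join_map_inr Y Y' X (f : smap Y Y') :
  smap_comp (join_map f (smap_id X)) (join_inr Y X) = join_inr Y' X.
Proof. exact: smap_ext. Qed.

Section Slice.
Variables (X A : sset) (d : smap X A).

Definition slice_simp n :=
  {f : smap (join (std n) X) A | smap_comp f (join_inr (std n) X) = d}.
Lemma slice_act_subproof m n (a : op m.+1 n.+1) (f : slice_simp n) :
  smap_comp (smap_comp (sval f) (join_map (std_map a) (smap_id X)))
            (join_inr (std m) X) = d.
Proof.
case: f => f /= hf.
by rewrite -hf -(join_map_inr X (std_map a)); apply: smap_ext.
Qed.
Definition slice_act m n (a : op m.+1 n.+1) (f : slice_simp n) : slice_simp m :=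
  exist (fun g => smap_comp g (join_inr (std m) X) = d)
        (smap_comp (sval f) (join_map (std_map a) (smap_id X)))
        (slice_act_subproof a f).
Lemma slice_act_id n (f : slice_simp n) : slice_act (op_id n.+1) f = f.
Proof.
case: f => f hf; apply: eq_exist; rewrite /=.
have -> : std_map (op_id n.+1) = smap_id (std n).
  by apply: smap_ext => m x; apply: op_ext.
by rewrite join_map_id; apply: smap_ext.
Qed.
Lemma slice_act_comp k m n (a : op k.+1 m.+1) (b : op m.+1 n.+1)
    (f : slice_simp n) :
  slice_act a (slice_act b f) = slice_act (op_comp b a) f.
Proof.
apply: eq_exist; rewrite /=.
have -> : std_map (op_comp b a) = smap_comp (std_map b) (std_map a).
  by apply: smap_ext => l x; apply: op_ext.
rewrite (_ : join_map (smap_comp _ _) _ =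
  smap_comp (join_map (std_map b) (smap_id X)) (join_map (std_map a) (smap_id X))).
  exact: smap_ext.
by rewrite join_map_comp; congr join_map; apply: smap_ext.
Qed.
Definition slice : sset := SSet slice_act_id slice_act_comp.

(* A map std n -> A is identified with its value at the identity of [n].      *)
Definition slice_proj_fun n (f : slice n) : A n :=
  sval f n (join_inl (std n) X n (op_id n.+1)).
Lemma slice_proj_subproof m n (a : op m.+1 n.+1) (f : slice n) :
  slice_proj_fun (act a f) = act a (slice_proj_fun f).
Proof.
rewrite /slice_proj_fun -sfun_act -sfun_act /=.
by congr (sval f m (join_inl_fun X _)); apply: op_ext.
Qed.
Definition slice_proj : smap slice A := SMap slice_proj_subproof.
End Slice.

(* Categories, with equality of parallel arrows given by a relation [heq].    *)
Record category := Category {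
  ob : Type;
  hom : ob -> ob -> Type;
  heq : forall x y, hom x y -> hom x y -> Prop;
  cid : forall x, hom x x;
  ccomp : forall x y z, hom y z -> hom x y -> hom x z;
  heq_refl : forall x y (f : hom x y), heq f f;
  heq_sym : forall x y (f g : hom x y), heq f g -> heq g f;
  heq_trans : forall x y (f g h : hom x y), heq f g -> heq g h -> heq f h;
  ccomp_heq : forall x y z (g g' : hom y z) (f f' : hom x y),
    heq g g' -> heq f f' -> heq (ccomp g f) (ccomp g' f');
  ccomp_idl : forall x y (f : hom x y), heq (ccomp (cid y) f) f;
  ccomp_idr : forall x y (f : hom x y), heq (ccomp f (cid x)) f;
  ccompA : forall w x y z (h : hom y z) (g : hom x y) (f : hom w x),
    heq (ccomp h (ccomp g f)) (ccomp (ccomp h g) f) }.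

Definition isomorphic (C : category) (x y : ob C) : Prop :=
  exists (f : hom x y) (g : hom y x),
    heq (ccomp g f) (cid x) /\ heq (ccomp f g) (cid y).

(* The left adjoint h of the nerve: h X is the free category on the vertices  *)
(* and edges of X, modulo the congruence that makes degenerate edges          *)
(* identities and the middle face of each 2-simplex the composite of the      *)
(* other two.                                                                 *)
Section HoCat.
Variable X : sset.

Record edge (x y : X 0) := Edge {
  edge_simp : X 1;
  edge_src : act (op_vtx (ord0 : 'I_2)) edge_simp = x;
  edge_tgt : act (op_vtx (ord_max : 'I_2)) edge_simp = y }.

Inductive path : X 0 -> X 0 -> Type :=
| path_nil x : path x x
| path_cons x y z : edge x y -> path y z -> path x z.

Fixpoint path_cat x y z (p : path x y) : path y z -> path x z :=
  match p in path x y return path y z -> path x z with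
  | path_nil _ => fun q => q
  | path_cons _ _ _ e p => fun q => path_cons e (path_cat p q)
  end.

Definition face01 (s : X 2) : X 1 :=
  act (@op_edge 3 (inord 0) (inord 1) ltac:(by rewrite !inordK)) s.
Definition face12 (s : X 2) : X 1 :=
  act (@op_edge 3 (inord 1) (inord 2) ltac:(by rewrite !inordK)) s.
Definition face02 (s : X 2) : X 1 :=
  act (@op_edge 3 (inord 0) (inord 2) ltac:(by rewrite !inordK)) s.

Inductive path_eq : forall x y, path x y -> path x y -> Prop :=
| path_eq_refl x y (p : path x y) : path_eq p p
| path_eq_sym x y (p q : path x y) : path_eq p q -> path_eq q p
| path_eq_trans x y (p q r : path x y) :
    path_eq p q -> path_eq q r -> path_eq p r
| path_eq_cons x y z (e : edge x y) (p q : path y z) :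
    path_eq p q -> path_eq (path_cons e p) (path_cons e q)
| path_eq_degen x y (e : edge x x) (p : path x y) :
    edge_simp e = act (op_const 2) x -> path_eq (path_cons e p) p
| path_eq_tri x y z w (s : X 2) (f : edge x y) (g : edge y z) (k : edge x z)
    (p : path z w) :
    edge_simp f = face01 s -> edge_simp g = face12 s ->
    edge_simp k = face02 s ->
    path_eq (path_cons f (path_cons g p)) (path_cons k p).

Lemma path_cat_eq x y z (p p' : path x y) (q q' : path y z) :
  path_eq p p' -> path_eq q q' -> path_eq (path_cat p q) (path_cat p' q').
Proof.
move=> hp; elim: hp q q' => {x y p p'}.
- move=> x y p; elim: p => //= {}x {}y v e p ih q q' hq.
  exact/path_eq_cons/ih.
- by move=> x y p q _ ih r r' hr; apply/path_eq_sym/ih/path_eq_sym.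
- move=> x y p q r _ ih1 _ ih2 t t' ht.
  by apply: path_eq_trans (ih1 _ _ ht) (ih2 _ _ _); apply: path_eq_refl.
- by move=> x y w e p q _ ih t t' ht; apply/path_eq_cons/ih.
- move=> x y e p he q q' hq /=; apply: path_eq_trans (path_eq_degen _ he) _.
  by elim: p {e he} q q' hq => //= ? ? ? e p ih q q' hq; apply/path_eq_cons/ih.
- move=> x y v w s f g k p hf hg hk q q' hq /=.
  apply: path_eq_trans (path_eq_tri _ hf hg hk) _; apply: path_eq_cons.
  elim: p {s f g k hf hg hk} q q' hq => //= ? ? ? e p ih q q' hq.
  exact/path_eq_cons/ih.
Qed.

Lemma path_cat_nil x y (p : path x y) : path_eq (path_cat p (path_nil y)) p.
Proof.
by elim: p => [*|? ? ? e p ih]; [apply: path_eq_refl | apply: path_eq_cons].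
Qed.

Lemma path_catA w x y z (p : path w x) (q : path x y) (r : path y z) :
  path_eq (path_cat (path_cat p q) r) (path_cat p (path_cat q r)).
Proof.
by elim: p q => [*|? ? ? e p ih q]; [apply: path_eq_refl | apply/path_eq_cons/ih].
Qed.

Definition hocat : category :=
  @Category (X 0) path path_eq path_nil (fun x y z g f => path_cat f g)
    path_eq_refl path_eq_sym path_eq_trans
    (fun x y z g g' f f' hg hf => path_cat_eq hf hg)
    path_cat_nil (fun x y => @path_eq_refl x y)
    (fun w x y z h g f => path_catA f g h).
End HoCat.

(* Equivalences in the 2-category qCat_2: 1-cells A -> B are the objects of   *)
(* h (B^A), and invertible 2-cells are the isomorphisms of h (B^A).           *)
Definition cell1 A B (f : smap A B) : ob (hocat (ihom A B)) :=
  smap_comp f (ssnd (std 0) A).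

Definition iso2 A B (f g : smap A B) : Prop := isomorphic (cell1 f) (cell1 g).

Definition qcat_equivalence A B (f : smap A B) : Prop :=
  [/\ quasi_category A, quasi_category B &
      exists g : smap B A,
        iso2 (smap_comp g f) (smap_id A) /\ iso2 (smap_comp f g) (smap_id B)].

(* Main.v *)
(* A span over [Z] is a map to [A] from a quotient of [std 3 * Z * X]: the     *)
(* four vertices of [std 3] are two copies, fat and thin, of the end over [Z]  *)
(* and of the end over [X], a thin vertex remembering one coordinate only.     *)
(* The fat part of a span is a map from [Z] to the comma, its thin part a map  *)
(* from [Z] to the slice, both over the same map from [Z] to [A]. A span on    *)
(* [Z'] included in [Z] extends to [Z] as soon as either part does: the        *)
(* missing simplices are matched by the insertion of one vertex, hence are     *)
(* added by filling inner horns, or outer horns whose first or last edge is    *)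
(* degenerate. The latter have fillers because they become iterated inner      *)
(* horns once the collapsed edge is blown up to the contractible groupoid on   *)
(* two objects. Extending from the empty simplicial set, the identity of the   *)
(* slice and that of the comma give maps in both directions; extending from    *)
(* the two ends of the product with the contractible groupoid makes them       *)
(* inverse to each other up to invertible 2-cells. Horns in the slice amount   *)
(* to inner horns in [A], and the comma inherits fillers along spans.          *)

From mathcomp Require Import all_boot all_order.
From mathcomp Require Import boolp classical_sets zify.
Require Import Defs.

Set Implicit Arguments.
Unset Strict Implicit.
Unset Printing Implicit Defensive.

(** * Operators *)

(** Fix [a : Z -> A]. Maps from [Z] to the slice over [a] are the maps to [A] from the join of [Z]
    and [X] that restrict to [a] and [d]; maps to the comma over [a] are the maps to [A] from the
    product of [std 1], [Z] and [X] that restrict to [a] and [d] at the two ends. These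
    correspondences are [thin_part] and [fat_part], injective by [slice_map_ext] and [comma_map_ext]
    and onto the maps satisfying [side_ok] by [realize_slice] and [realize_comma]. A span relates a
    map to the slice with a map to the comma over the same [a]. This relation lifts along inclusions
    on either side, as a trivial fibration would: by [extend_thin] and [extend_fat], a span over
    [Z'] extends to [Z] once one of its two parts is prescribed on [Z]. With [Z'] empty, the
    identities give [f] from the slice to the comma and [g] back, both over [A]. With two copies of
    [S] inside the product of [indisc] and [S], two maps related to a common map become isomorphic
    ([iso2_of_fat], [iso2_of_thin]). Now [g] after [f] and the identity of the slice are both
    related to [f], and symmetrically for the comma. The lifting is a matching argument. In
    [pivot_fill] each missing simplex [t] is paired with a simplex [ins t] one dimension higher, of
    which it is a face, and the two are added together along the horn opposite to [t]. [shape_fill]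
    reduces the hypotheses to the sequence of vertex types, and [stage_fill] verifies them when a
    vertex is inserted at a cut between types. Passing from thin to fat uses inner horns only; the
    converse also meets outer horns with a degenerate extreme edge, handled by
    [special_horn_initial] and [special_horn_terminal]. The same [stage_fill] shows that the slice
    is a quasi-category, and horn filling passes to the comma along spans. *)

Lemma op_val_ext m n (a b : op m n) : (forall i, a i = b i :> nat) -> a = b.
Proof. by move=> e; apply: op_ext => i; apply: val_inj; apply: e. Qed.

(* The running maximum makes [clamp f] monotone whatever [f] is; it agrees    *)
(* with [f] wherever [f] is monotone and bounded.                             *)
Definition clamp_val n (f : nat -> nat) (i : nat) : nat :=
  minn n (\max_(j < i.+1) f j).

Lemma clamp_subproof n (f : nat -> nat) i : (clamp_val n f i < n.+1)%N.
Proof. by rewrite ltnS geq_minl. Qed.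

Lemma clamp_homo m n (f : nat -> nat) :
  {homo (fun i : 'I_m => Ordinal (clamp_subproof n f i)) : i j / (i <= j)%N}.
Proof.
move=> i j le_ij; rewrite /= /clamp_val leq_min geq_minl /=.
apply: leq_trans (geq_minr _ _) _; apply/bigmax_leqP => k _.
have h : (k < j.+1)%N by rewrite ltnS (leq_trans _ le_ij) // -ltnS.
exact: (@leq_bigmax _ (fun k : 'I_j.+1 => f k) (Ordinal h)).
Qed.

Definition clamp m n (f : nat -> nat) : op m n.+1 := mk_op (@clamp_homo m n f).

Lemma clampE m n f (i : 'I_m) :
  (forall j : nat, (j <= i)%N -> (f j <= f i)%N) -> (f i <= n)%N ->
  clamp m n f i = f i :> nat.
Proof.
move=> hm hn; rewrite /= /clamp_val; have -> : \max_(j < i.+1) f j = f i.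
  apply/eqP; rewrite eqn_leq; apply/andP; split.
    by apply/bigmax_leqP => j _; apply: hm; rewrite -ltnS.
  exact: (@leq_bigmax _ (fun k : 'I_i.+1 => f k) ord_max).
exact/minn_idPr.
Qed.

Definition face n (j : nat) : op n n.+1 := clamp n n (bump j).

Lemma faceE n j (i : 'I_n) : face n j i = bump j i :> nat.
Proof. by apply: clampE => [k|]; have := ltn_ord i; rewrite /bump; lia. Qed.

#[global] Opaque clamp face.

Lemma face_factor m n (b : op m n.+2) (j : 'I_n.+2) :
  (forall i, b i <> j) -> exists b' : op m n.+1, b = op_comp (face n.+1 j) b'.
Proof.
move=> h.
have hb : {homo (fun i : 'I_m => inord (minn n (unbump j (b i))) : 'I_n.+1) : i k / (i
    <= k)%N}.
  by move=> i k /(op_le b); rewrite !inordK ?ltnS ?geq_minl // /unbump; lia.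
exists (mk_op hb); apply: op_val_ext => i /=.
rewrite faceE inordK ?ltnS ?geq_minl //.
have : b i <> j :> nat by move/val_inj; apply: h.
by have := ltn_ord (b i); have := ltn_ord j; rewrite /unbump /bump; lia.
Qed.

(* An operator hitting everything except possibly [c] is split over the face  *)
(* opposite to [c], by a section through any prescribed point.                *)
Lemma face_section m n (b : op m.+1 n.+2) (c : 'I_n.+2) (i0 : 'I_m.+1) :
  (forall j : 'I_n.+2, j <> c -> exists i, b i = j) -> b i0 <> c ->
  exists s : op n.+1 m.+1, op_comp b s = face n.+1 c /\ exists j, s j = i0.
Proof.
move=> hb hi0.
have nec (j : 'I_n.+1) : face n.+1 c j <> c.
  by move=> e; have := faceE c j; rewrite e /bump; lia.
have ex (j : 'I_n.+1) : {i | b i = face n.+1 c j /\ (b i0 = face n.+1 c j -> i = i0)}.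
  apply: boolp.cid; case: (eqVneq (b i0) (face n.+1 c j)) => [e|ne].
    by exists i0.
  by have [i hi] := hb _ (nec j); exists i; split=> // e; rewrite e eqxx in ne.
have hs : {homo (fun j => sval (ex j)) : j k / (j <= k)%N}.
  move=> j k le_jk; case: (ltngtP j k) le_jk => // [lt_jk|/val_inj->] _ //.
  rewrite leqNgt; apply/negP => /ltnW /(op_le b).
  by rewrite (svalP (ex j)).1 (svalP (ex k)).1 !faceE /bump; lia.
exists (mk_op hs); split; first by apply: op_ext => j; rewrite /= (svalP (ex j)).1.
have hlt : (unbump c (b i0) < n.+1)%N.
  have : b i0 <> c :> nat by move/val_inj.
  by have := ltn_ord (b i0); have := ltn_ord c; rewrite /unbump; lia.
have e0 : b i0 = face n.+1 c (Ordinal hlt).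
  apply: ord_inj; rewrite faceE /= unbumpK //.
  by apply/eqP => /val_inj.
by exists (Ordinal hlt); rewrite /= ((svalP (ex _)).2 e0).
Qed.

Lemma not_in_horn N (k : 'I_N.+1) n (a : std N n) :
  ~ in_horn k a -> forall j : 'I_N.+1, j <> k -> exists i, a i = j.
Proof.
by move=> h j jk; apply: contrapT => hj; apply: h; exists j; split=> // i e; apply: hj;
    exists i.
Qed.

Lemma op_inj_id n (r : op n n) : injective r -> r = op_id n.
Proof.
move=> inj.
have st (i j : 'I_n) : (i < j)%N -> (r i < r j)%N.
  move=> lt_ij; rewrite ltn_neqAle (op_le r (ltnW lt_ij)) andbT.
  by apply/eqP => /val_inj /inj e; rewrite e ltnn in lt_ij.
have lo (k : nat) (i : 'I_n) : i = k :> nat -> (k <= r i)%N.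
  elim: k i => // k ih i ei; have lt : (k < n)%N by have := ltn_ord i; lia.
  by have := ih (Ordinal lt) erefl; have := st (Ordinal lt) i; rewrite /= ei; lia.
have hi (k : nat) (i : 'I_n) : (i + k).+1 = n -> (r i + k < n)%N.
  elim: k i => [|k ih] i ei; first by rewrite addn0.
  have lt : (i.+1 < n)%N by lia.
  by have := ih (Ordinal lt); have := st i (Ordinal lt); rewrite /=; lia.
apply: op_val_ext => i /=; have := lo i i erefl; have := hi (n - i.+1)%N i.
by have := ltn_ord i; lia.
Qed.

(** * Filling partial maps *)

Definition srel (L : sset) := forall n, L n -> L n -> Prop.

Record scongr (L : sset) (E : srel L) : Prop := SCongr {
  sc_refl : forall n (t : L n), E n t t;
  sc_sym : forall n (t u : L n), E n t u -> E n u t;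
  sc_trans : forall n (t u v : L n), E n t u -> E n u v -> E n t v;
  sc_act : forall m n (a : op m.+1 n.+1) (t u : L n),
    E n t u -> E m (act a t) (act a u) }.

(* A partial simplicial map from the quotient of [L] by [E] to [A], as the    *)
(* functional graph of a map defined on a simplicial subset.                  *)
Definition graph (L A : sset) := forall n, L n -> A n -> Prop.

Record pmap (L : sset) (E : srel L) (A : sset) (G : graph L A) : Prop := PMap {
  pm_fun : forall n (t : L n) x x', G n t x -> G n t x' -> x = x';
  pm_act : forall m n (a : op m.+1 n.+1) (t : L n) x,
    G n t x -> G m (act a t) (act a x);
  pm_E : forall n (t u : L n) x, E n t u -> G n t x -> G n u x }.

Definition dom L A (G : graph L A) n (t : L n) := exists x, G n t x.

Definition subgraph L A (G H : graph L A) := forall n (t : L n) x, G n t x -> H n t x.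

Section Fill.
Variables (L A : sset) (E : srel L) (hE : scongr E).

Lemma dom_act (G : graph L A) (hG : pmap E G) m n (a : op m.+1 n.+1) (t : L n) :
  dom G t -> dom G (act a t).
Proof. by case=> x hx; exists (act a x); apply: (pm_act hG). Qed.

Lemma dom_E (G : graph L A) (hG : pmap E G) n (t u : L n) :
  E t u -> dom G t -> dom G u.
Proof. by move=> e [x hx]; exists x; apply: (pm_E hG) hx. Qed.

Lemma dom_sub (G H : graph L A) : subgraph G H -> forall n (t : L n), dom G t -> dom H t.
Proof. by move=> s n t [x hx]; exists x; apply: s. Qed.

Lemma pmap_total (G : graph L A) : pmap E G -> (forall n (t : L n), dom G t) ->
  exists f : smap L A, (forall n (t : L n), G n t (f n t)) /\
    (forall n (t u : L n), E t u -> f n t = f n u).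
Proof.
move=> hG tot; pose f n (t : L n) := sval (boolp.cid (tot n t)).
have hf n t : G n t (f n t) by apply: svalP.
have nat m n (a : op m.+1 n.+1) (t : L n) : f m (act a t) = act a (f n t).
  by apply: (pm_fun hG) (hf _ _) _; apply: (pm_act hG).
exists (SMap nat); split=> // n t u e.
by apply: (pm_fun hG) (hf n u); apply: (pm_E hG) e (hf _ _).
Qed.

(** A pushout along a horn inclusion, seen on graphs. The cell [s] meets the domain exactly in the
    horn and is embedded modulo [E] outside it, so the values of a filler on the classes of
    [act b s] are unambiguous and agree with [G]. *)
Lemma attach_cell (G : graph L A) (hG : pmap E G) N (s : L N) (k : 'I_N.+1) :
  (forall n (b : std N n), in_horn k b <-> dom G (act b s)) ->
  (forall n (b b' : std N n), ~ in_horn k b -> ~ in_horn k b' ->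
     E (act b s) (act b' s) -> b = b') ->
  (forall h : smap (horn k) A,
     (forall n (b : horn k n), G n (act (sval b) s) (h n b)) ->
     exists f : smap (std N) A, smap_comp f (horn_incl k) = h) ->
  exists G', [/\ pmap E G', subgraph G G', dom G' s &
    forall n (t : L n), dom G' t -> dom G t \/ exists b : std N n, E (act b s) t].
Proof.
move=> hdom inj fill.
have ex n (b : horn k n) : {x | G n (act (sval b) s) x}.
  by apply: boolp.cid; apply/hdom/svalP.
pose h n b := sval (ex n b).
have hh n b : G n (act (sval b) s) (h n b) by apply: svalP.
have nat m n (a : op m.+1 n.+1) (b : horn k n) : h m (act a b) = act a (h n b).
  apply: (pm_fun hG) (hh _ _) _; rewrite /= -act_comp; exact: (pm_act hG).
have [f fE] := fill (SMap nat) hh.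
have fh n (b : std N n) x : G n (act b s) x -> x = f n b.
  move=> gx; have hb : in_horn k b by apply/hdom; exists x.
  have /(congr1 (fun g : smap (horn k) A => g n (exist _ b hb))) /= -> := fE.
  exact: (pm_fun hG) gx (hh n (exist _ b hb)).
exists (fun n t x => G n t x \/ exists b : std N n, E (act b s) t /\ x = f n b).
split.
- split=> [n t x x'|m n a t x|n t u x e].
  + case=> [g|[b [e ->]]] [g'|[b' [e' ->]]].
    * exact: (pm_fun hG) g g'.
    * by apply: fh; apply: (pm_E hG) (sc_sym hE e') g.
    * by apply/esym/fh; apply: (pm_E hG) (sc_sym hE e) g'.
    * have ee := sc_trans hE e (sc_sym hE e').
      have [hb|nb] := EM (in_horn k b).
        case/hdom: (hb) => y gx.
        by rewrite -(fh _ _ _ gx); apply: fh; apply: (pm_E hG) gx.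
      have [hb|nb'] := EM (in_horn k b').
        case/hdom: (hb) => y gx.
        by rewrite -(fh _ _ _ gx); apply/esym/fh; apply: (pm_E hG) gx; apply: (sc_sym hE).
      by rewrite (inj _ _ _ nb nb' ee).
  + case=> [g|[b [e ->]]]; first by left; apply: (pm_act hG).
    right; exists (op_comp b a); split; last by rewrite -sfun_act.
    by rewrite -act_comp; apply: (sc_act hE).
  + case=> [g|[b [e' ->]]]; first by left; apply: (pm_E hG) g.
    by right; exists b; split=> //; apply: (sc_trans hE) e' e.
- by move=> n t x g; left.
- by exists (f N (op_id _)); right; exists (op_id _); rewrite act_id; split=> //;
    apply: (sc_refl hE).
- by move=> n t [x [g|[b [e _]]]]; [left; exists x|right; exists b].
Qed.

(* Extension of a partial map over a region [R] whose simplices outside the   *)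
(* domain are matched by insertion of a vertex: [t] is the face of [ins t]    *)
(* opposite to the position [pos t], and it is filled together with [ins t]   *)
(* by a horn, all other faces of [ins t] coming earlier.                      *)
Theorem pivot_fill (G0 : graph L A) (R : forall n, L n -> Prop)
    (pos : forall n, L n -> 'I_n.+2) (ins : forall n, L n -> L n.+1)
    (mu : forall n, L n -> nat) :
  pmap E G0 ->
  (forall n (t u : L n), E t u -> R n t -> R n u /\ E (ins n t) (ins n u)) ->
  (forall n (t : L n), R n t -> dom G0 t -> dom G0 (ins n t)) ->
  (forall n (t : L n), R n t -> E (act (face n.+1 (pos n t)) (ins n t)) t) ->
  (forall n (t : L n), R n t -> forall i : 'I_n.+2, i <> pos n t ->
     let t' := act (face n.+1 i) (ins n t) in
     [\/ dom G0 t', R n t' /\ (mu n t' < mu n t)%N |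
        exists m (u : L m) (e : op n.+1 m.+2),
          [/\ R m u, (mu m u < mu n t)%N & E (act e (ins m u)) t']]) ->
  (forall n (t : L n), R n t -> forall m (b : op m.+1 n.+2),
     ~ in_horn (pos n t) (b : std n.+1 m) -> R m (act b (ins n t)) ->
     exists b' : op m.+2 n.+2, E (act b' (ins n t)) (ins m (act b (ins n t)))) ->
  (forall G, pmap E G -> subgraph G0 G -> forall n (t : L n), R n t ->
     forall h : smap (horn (pos n t)) A,
     (forall m (b : horn (pos n t) m), G m (act (sval b) (ins n t)) (h m b)) ->
     exists f : smap (std n.+1) A, smap_comp f (horn_incl (pos n t)) = h) ->
  exists G, [/\ pmap E G, subgraph G0 G, forall n (t : L n), R n t -> dom G t &
    forall n (t : L n), dom G t -> dom G0 t \/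
      exists m (u : L m) (b : op n.+1 m.+2), R m u /\ E (act b (ins m u)) t].
Proof.
move=> pG0 RE G0ins insK insF insN fill.
(* Zorn's lemma is applied to the set of values added to [G0]. *)
pose gr (S : set {n & (L n * A n)%type}) : graph L A :=
  fun n t x => G0 n t x \/ S (existT _ n (t, x)).
(* Closure under insertion is part of the invariant: a face of a new cell may be a face or
   degeneracy of [ins m u] with [u] earlier, and must then be available as soon as [u] is. *)
pose good (G : graph L A) := [/\ pmap E G, forall n (t : L n), R n t -> dom G t -> dom
    G (ins n t) &
  forall n (t : L n), dom G t -> dom G0 t \/
      exists m (u : L m) (b : op n.+1 m.+2), R m u /\ E (act b (ins m u)) t].
have grS S S' : (S `<=` S')%classic -> subgraph (gr S) (gr S').
  by move=> h n t x [g|/h g]; [left|right].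
have good0 : good (gr classical_sets.set0).
  have e : gr classical_sets.set0 = G0.
    apply/functional_extensionality_dep => n; apply/funext => t; apply/funext => x.
    by apply/propext; split=> [[]//|]; left.
  by rewrite e; split=> // n t d; left.
have [F FP Ftot|S [gS maxS]] := @Zorn_bigcup _ (fun S => good (gr S)).
  (* Adjoining the empty set to the chain [F] accounts for [G0] itself, also when [F] is empty. *)
  have gF S n t x : S = classical_sets.set0 \/ F S -> gr S n t x -> gr (\bigcup_(X in
      F) X)%classic n t x.
    by case=> [->|FS]; apply: grS => // y Sy; exists S.
  have goodF S : S = classical_sets.set0 \/ F S -> good (gr S) by case=> [->|/FP].
  have ex n t x : gr (\bigcup_(X in F) X)%classic n t x ->
      exists2 S, S = classical_sets.set0 \/ F S & gr S n t x.
    by case=> [g|[S FS Sx]]; [exists classical_sets.set0; [left|left]|exists S;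
        [right|right]].
  have exD n (t : L n) : dom (gr (\bigcup_(X in F) X)%classic) t ->
      exists2 S, S = classical_sets.set0 \/ F S & dom (gr S) t.
    by case=> x /ex[S hS g]; exists S => //; exists x.
  have tot S S' : S = classical_sets.set0 \/ F S -> S' = classical_sets.set0 \/ F S' ->
      (S `<=` S')%classic \/ (S' `<=` S)%classic.
    case=> [->|FS]; first by left.
    by case=> [->|FS']; [right|apply: Ftot].
  split.
  - split.
    + move=> n t x x' /ex[S hS g] /ex[S' hS' g'].
      case: (tot _ _ hS hS') => sub.
        case: (goodF _ hS') => p _ _; exact: (pm_fun p) (grS _ _ sub _ _ _ g) g'.
      case: (goodF _ hS) => p _ _; exact: (pm_fun p) g (grS _ _ sub _ _ _ g').
    + move=> m n a t x /ex[S hS g]; case: (goodF _ hS) => p _ _.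
      by apply: (gF _ _ _ _ hS); apply: (pm_act p).
    + move=> n t u x e /ex[S hS g]; case: (goodF _ hS) => p _ _.
      by apply: (gF _ _ _ _ hS); apply: (pm_E p) g.
  - move=> n t Rt /exD[S hS d]; case: (goodF _ hS) => _ h _.
    by case: (h n t Rt d) => x hx; exists x; apply: (gF _ _ _ _ hS).
  - by move=> n t /exD[S hS d]; case: (goodF _ hS) => _ _; apply.
have sub0 : subgraph G0 (gr S) by left.
case: (gS) => pG clG bdG.
exists (gr S); split=> // n t Rt; apply: contrapT => nd.
(* A missing simplex of least measure: every face of its insertion other than itself is then
   defined. *)
have [n0 [t0 [Rt0 nd0 min0]]] : exists n (t : L n),
    [/\ R n t, ~ dom (gr S) t & forall m (u : L m), R m u ->
      (mu m u < mu n t)%N -> dom (gr S) u].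
  move: {2}(mu n t).+1 (ltnSn (mu n t)) => M; elim: M n t Rt nd => // M ih n t Rt nd.
  move=> leM; case: (EM (exists m (u : L m), [/\ R m u, ~ dom (gr S) u & (mu m u < mu n
      t)%N])).
    by case=> m [u [Ru ndu lt]]; apply: ih Ru ndu (leq_trans lt _).
  move=> no; exists n, t; split=> // m u Ru lt; apply: contrapT => ndu.
  by apply: no; exists m, u.
set c := pos n0 t0; set s := ins n0 t0.
have sK := insK _ _ Rt0; rewrite -/c -/s in sK.
have sF (i : 'I_n0.+2) : i <> c -> dom (gr S) (act (face n0.+1 i) s).
  move=> ic; case: (insF _ _ Rt0 i ic) => [d|[Ru lt]|[m [u [e [Ru lt ee]]]]].
  - exact: dom_sub d.
  - exact: min0 Ru lt.
  - by apply: (dom_E pG ee); apply/(dom_act pG)/clG => //; apply: min0.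
have inH p (b : std n0.+1 p) : in_horn c b -> dom (gr S) (act b s).
  case=> j [jc hj]; have [b' ->] := face_factor hj.
  by rewrite -act_comp; apply/(dom_act pG)/sF.
have nc (b : std n0.+1 n0) : E (act b s) t0 -> ~ in_horn c b.
  by move=> e /inH d; apply: nd0; apply: (dom_E pG e).
(* Outside the horn, [b] is split over the face opposite to [c], so [t0] is up to [E] a simplicial
   image of [act b s] and would be defined with it. *)
have notd p (b : std n0.+1 p) : ~ in_horn c b -> ~ dom (gr S) (act b s).
  move=> /not_in_horn hb d.
  have [i0 hi0] : exists i0, b i0 <> c.
    have [j jc] : exists j : 'I_n0.+2, j <> c.
      exists (if c == ord0 then ord_max else ord0).
      by case: (eqVneq c ord0) => [->|/eqP ne e]; [|apply: ne].
    by have [i e] := hb j jc; exists i; rewrite e.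
  have [r [br _]] := face_section hb hi0.
  apply: nd0; apply: (dom_E pG sK); rewrite -/c -br -act_comp.
  exact: (dom_act pG).
(* Choose a section [r] of [b] through [i]. Then [b' r] also represents [t0], so it is outside the
   horn and has a section over the face opposite to [c]; that section is an injective endomorphism,
   hence the identity, and [b' r] is the face itself. *)
have inj' p (b b' : std n0.+1 p) i : ~ in_horn c b ->
    E (act b s) (act b' s) -> b i <> c -> b' i = b i.
  move=> /not_in_horn hb e hi; have [r [br [j rj]]] := face_section hb hi.
  have e' : E (act (op_comp b' r : std n0.+1 n0) s) t0.
    apply: (sc_trans hE) sK; apply: (sc_sym hE).
    by rewrite -/c -br -!act_comp; apply: (sc_act hE).
  have hb' := not_in_horn (nc _ e'); clear e'.
  suff -> : b' i = face n0.+1 c j by rewrite -br /= rj.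
  pose q : std n0.+1 n0 := op_comp b' r.
  rewrite -rj -/(q j).
  have [i0 hi0] : exists i0, q i0 <> c by have [i0 h0] := hb' (b i) hi; exists i0;
      rewrite h0.
  have [r' [qr' _]] := face_section hb' hi0.
  suff er : r' = op_id _ by rewrite -qr' er.
  apply: op_inj_id => k l /(congr1 q).
  rewrite -[q (r' k)]/(op_comp q r' k) -[q (r' l)]/(op_comp q r' l) qr' => /(congr1
      val) /=.
  by rewrite !faceE => /(can_inj (bumpK c)) /val_inj.
have inj p (b b' : std n0.+1 p) : ~ in_horn c b -> ~ in_horn c b' ->
    E (act b s) (act b' s) -> b = b'.
  move=> hb hb' e; apply: op_ext => i; case: (eqVneq (b i) c) => [bc|/eqP bc].
    case: (eqVneq (b' i) c) => [->//|/eqP bc'].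
    exact: (inj' _ _ _ _ hb' (sc_sym hE e)).
  by rewrite (inj' _ _ _ _ hb e).
have [G' [pG' sub' dG' bdG']] : exists G', [/\ pmap E G', subgraph (gr S) G', dom G' s &
    forall n (t : L n), dom G' t -> dom (gr S) t \/ exists b : std n0.+1 n, E (act b s)
        t].
  apply: (attach_cell pG (k := c)) => //.
  - by move=> m b; split=> [/inH//|d]; apply: contrapT => /notd.
  - exact: fill.
pose S' : set {n & (L n * A n)%type} := fun p => G' (projT1 p) (projT2 p).1 (projT2 p).2.
have eG' : gr S' = G'.
  apply/functional_extensionality_dep => m; apply/funext => u; apply/funext => x.
  by apply/propext; split=> [[/sub0/sub'|]//|]; right.
have SS' : (S `<=` S')%classic by move=> [m [u x]] Sx; apply: sub'; right.
apply: (maxS S').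
  split=> // h; apply: nd0.
  case: dG' => x /(pm_act pG' (face n0.+1 c)) /(pm_E pG' sK) gx.
  by exists (act (face n0.+1 c) x); right; apply: h.
rewrite eG'; split=> //.
- move=> m u Ru; case/bdG' => [d|[b e]].
    by apply: (dom_sub sub'); apply: clG.
  (* If the simplex is new, its insertion is again obtained from [s] by an operator, by [insN], and
     so was added with [s]. *)
  case: (EM (in_horn c b)) => [hb|nb].
    by apply/(dom_sub sub')/clG => //; apply: (dom_E pG e); apply: inH.
  have [Rb _] := RE _ _ _ (sc_sym hE e) Ru.
  have [_ ei] := RE _ _ _ e Rb.
  have [b' e'] := insN _ _ Rt0 _ _ nb Rb.
  by apply: (dom_E pG' (sc_trans hE e' ei)); apply: (dom_act pG').
- move=> m u; case/bdG' => [/bdG//|[b e]]; right.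
  by exists n0, t0, b.
Qed.
End Fill.

(** * Insertion of a vertex into a simplex with typed vertices *)

Lemma face_cases n (c : 'I_n.+1) (i : 'I_n.+1) : i = c \/ exists j, i = face n c j.
Proof.
case: (unliftP c i) => [j ->|->]; [right|by left].
by exists j; apply: ord_inj; rewrite faceE.
Qed.

Lemma face_neq n (c : 'I_n.+1) (j : 'I_n) : face n c j <> c.
Proof. by move=> /(congr1 val) /= e; have := faceE c j; rewrite e /bump; lia. Qed.

Lemma face_insert m n (c : 'I_n.+1) (c' : 'I_m.+1) (b : op m n.+1) :
  (forall l : 'I_m, (l < c')%N -> (b l <= c)%N) ->
  (forall l : 'I_m, (c' <= l)%N -> (c <= b l)%N) ->
  exists b' : op m.+1 n.+1, b' c' = c /\ forall l, b' (face m c' l) = b l.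
Proof.
move=> hlo hhi; pose f i := if unlift c' i is Some l then b l else c.
have fface l : f (face m c' l) = b l.
  have -> : face m c' l = lift c' l by apply: ord_inj; rewrite faceE.
  by rewrite /f liftK.
have fc : f c' = c by rewrite /f unlift_none.
have hf : {homo f : i j / (i <= j)%N}.
  move=> i j le_ij.
  case: (face_cases c' i) (face_cases c' j) => [ei|[k ei]] [ej|[l ej]];
    rewrite ei ej ?fc ?fface in le_ij *; rewrite ?faceE in le_ij => //.
  - by apply: hhi; move: le_ij; rewrite /bump; lia.
  - by apply: hlo; move: le_ij; rewrite /bump; lia.
  - by apply: op_le; move: le_ij; rewrite /bump; lia.
by exists (mk_op hf).
Qed.

Section Base.
Variables (K : nat) (py px : pred 'I_K.+1).

(* [t] gives each vertex a type, and [p] holds of the types at which a        *)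
(* coordinate is part of the data; elsewhere the coordinate is arbitrary.     *)
Definition vis (p : pred 'I_K.+1) (Y : sset) n (t : std K n) (y y' : Y n) :=
  forall m (b : op m.+1 n.+1), (forall i, p (t (b i))) -> act b y = act b y'.

Lemma vis_act (p : pred 'I_K.+1) (Y : sset) n m (t : std K n) (t' : std K m)
    (a : op m.+1 n.+1) (y y' : Y n) :
  (forall i, p (t' i) -> p (t (a i))) -> vis p t y y' ->
  vis p t' (act a y) (act a y').
Proof. by move=> h v k b hb; rewrite !act_comp; apply: v => i; apply: h. Qed.

Lemma vis_op (p : pred 'I_K.+1) (Y : sset) n m (t : std K n)
    (a a' : op n.+1 m.+1) (y : Y m) :
  (forall i, p (t i) -> a i = a' i) -> vis p t (act a y) (act a' y).
Proof.
move=> h k b hb; rewrite !act_comp; congr (act _ y).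
by apply: op_ext => i; apply: h.
Qed.

Variables (Z X : sset).
Definition base : sset := sprod (std K) (sprod Z X).

Definition evis : srel base := fun n u v =>
  [/\ u.1 = v.1, vis py u.1 u.2.1 v.2.1 & vis px u.1 u.2.2 v.2.2].

Lemma evis_congr : scongr evis.
Proof.
split.
- by move=> n t; split.
- move=> n [t [y x]] [t' [y' x']] [/= e vy vx]; subst t'.
  by split=> // m b hb; [rewrite vy|rewrite vx].
- move=> n [t [y x]] [t' [y' x']] [t'' [y'' x'']] [/= e vy vx] [/= e' vy' vx'].
  by subst t' t''; split=> // m b hb; [rewrite vy // vy'|rewrite vx // vx'].
- move=> m n a [t [y x]] [t' [y' x']] [/= e vy vx]; subst t'.
  by split=> //=; apply: vis_act (vy) || apply: vis_act (vx).
Qed.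

Section Insert.
Variables (n : nat) (t : std K n) (c : 'I_n.+2) (v : 'I_K.+1).

Definition ins_shape : std K n.+1 :=
  clamp _ _ (fun i => if i == c then nat_of_ord v else t (inord (unbump c i))).

(** The operator by which a coordinate is pulled back to the enlarged simplex: the new vertex copies
    vertex [r], the old ones keep their own. Where the coordinate is invisible the value 0 is given,
    which leaves the running maximum in [clamp] unchanged. *)
Definition ins_pull (p : pred 'I_K.+1) (r : 'I_n.+1) : op n.+2 n.+1 :=
  clamp _ _ (fun i => if i == c then if p v then nat_of_ord r else 0
    else if p (t (inord (unbump c i))) then unbump c i else 0).

Hypothesis hlo : forall i : 'I_n.+1, (i < c)%N -> (t i <= v)%N.
Hypothesis hhi : forall i : 'I_n.+1, (c <= i)%N -> (v <= t i)%N.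

Lemma ins_shape_homo (j : nat) (i : 'I_n.+2) : (j <= i)%N ->
  ((if j == c :> nat then nat_of_ord v else t (inord (unbump c j))) <=
   (if i == c :> nat then nat_of_ord v else t (inord (unbump c i))))%N.
Proof.
move=> le_ji; have := ltn_ord i; have := ltn_ord c => lc li.
have inE (k : nat) : (k < n.+2)%N -> k != c -> (inord (unbump c k) : 'I_n.+1) = unbump
    c k :> nat.
  by move=> lk kc; rewrite inordK // /unbump; lia.
have lj := leq_ltn_trans le_ji li.
case: eqVneq => [ej|nj]; case: eqVneq => [ei|ni] //.
- by apply: hhi; rewrite inE // /unbump; lia.
- by apply: hlo; rewrite inE // /unbump; lia.
- by apply: op_le; rewrite !inE // /unbump; lia.
Qed.

Lemma ins_shape_pos : ins_shape c = v.
Proof.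
apply: ord_inj; rewrite /ins_shape clampE; first by rewrite eqxx.
  by move=> j; apply: ins_shape_homo.
by rewrite eqxx -ltnS ltn_ord.
Qed.

Lemma ins_shape_face i : ins_shape (face _ c i) = t i.
Proof.
have e : (face n.+1 c i == c :> nat) = false by rewrite faceE /bump; lia.
apply: ord_inj; rewrite /ins_shape clampE.
- by rewrite e faceE bumpK inord_val.
- by move=> j; apply: ins_shape_homo.
- by rewrite e -ltnS ltn_ord.
Qed.

Variables (p : pred 'I_K.+1) (r : 'I_n.+1).
Hypothesis rlo : p v -> forall i : 'I_n.+1, p (t i) -> (i < c)%N -> (i <= r)%N.
Hypothesis rhi : p v -> forall i : 'I_n.+1, p (t i) -> (c <= i)%N -> (r <= i)%N.

Lemma ins_pull_pos : p v -> ins_pull p r c = r.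
Proof.
move=> pv; apply: ord_inj; rewrite /ins_pull clampE; rewrite ?eqxx ?pv //.
  move=> j le_jc; case: eqVneq => // nj; case: ifP => // pj.
  rewrite -[X in (X <= _)%N](_ : (inord (unbump c j) : 'I_n.+1) = _ :> nat); last first.
    by rewrite inordK // /unbump; have := ltn_ord c; lia.
  apply: rlo => //; rewrite inordK // /unbump; have := ltn_ord c; lia.
by rewrite -ltnS ltn_ord.
Qed.

Lemma ins_pull_face i : p (t i) -> ins_pull p r (face _ c i) = i.
Proof.
move=> pi; have e : (face n.+1 c i == c :> nat) = false by rewrite faceE /bump; lia.
have ub : unbump c (face n.+1 c i) = i by rewrite faceE bumpK.
apply: ord_inj; rewrite /ins_pull clampE; rewrite ?e ub inord_val pi //.
  move=> j le_ji; case: eqVneq => [ej|nj].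
    case: ifP => // pv; apply: rhi => //.
    by move: le_ji; rewrite faceE ej /bump; lia.
  case: ifP => // _; move: le_ji; rewrite faceE /unbump /bump; lia.
by rewrite -ltnS ltn_ord.
Qed.
End Insert.

Section ShapeFill.
Variables (A : sset) (G0 : graph base A) (v : 'I_K.+1)
  (R D : forall n, std K n -> Prop)
  (pos : forall n, std K n -> 'I_n.+2)
  (ry rx : forall n, std K n -> 'I_n.+1)
  (mu : forall n, std K n -> nat).

(* The inserted vertex has type [v]; its coordinate in [Z] (in [X]) is that   *)
(* of the vertex [r] of [t], when that coordinate is visible at type [v].     *)
Definition ref_ok (p : pred 'I_K.+1) (r : forall n, std K n -> 'I_n.+1) :=
  p v -> forall n (t : std K n), R t -> p (t (r n t)) /\ forall i, p (t i) ->
    ((i < pos t)%N -> (i <= r n t)%N) /\ ((pos t <= i)%N -> (r n t <= i)%N).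

(** Deleting vertex [j] does not change the vertex whose coordinate is copied, so insertion commutes
    with this face. *)
Definition ref_face (p : pred 'I_K.+1) (r : forall n, std K n -> 'I_n.+1)
    n (t : std K n.+1) (j : 'I_n.+2) :=
  p v -> face _ j (r n (op_comp t (face _ j))) = r n.+1 t.

(** The inserted vertex and the one it copies have the same coordinate, so either is an acceptable
    image of the reference vertex of [u]. *)
Definition ref_split (p : pred 'I_K.+1) (r : forall n, std K n -> 'I_n.+1)
    n (t : std K n) m (b : op m.+1 n.+2) (u : std K m) :=
  p v -> b (r m u) = pos t \/ b (r m u) = face _ (pos t) (r n t).

Definition insert n (u : base n) : base n.+1 :=
  (ins_shape u.1 (pos u.1) v,
   (act (ins_pull u.1 (pos u.1) v py (ry u.1)) u.2.1,
    act (ins_pull u.1 (pos u.1) v px (rx u.1)) u.2.2)).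

Hypothesis pG0 : pmap evis G0.
Hypothesis Rpos : forall n (t : std K n), R t -> forall i : 'I_n.+1,
  ((i < pos t)%N -> (t i <= v)%N) /\ ((pos t <= i)%N -> (v <= t i)%N).
Hypothesis ry_ok : ref_ok py ry.
Hypothesis rx_ok : ref_ok px rx.
Hypothesis R0 : forall t : std K 0, ~ R t.
Hypothesis DG0 : forall n (u : base n), D u.1 -> dom G0 u.
Hypothesis G0ins : forall n (u : base n), R u.1 -> dom G0 u -> dom G0 (insert u).
Hypothesis RF : forall n (t : std K n.+1), R t -> forall j : 'I_n.+2,
  let t' := op_comp (ins_shape t (pos t) v) (face _ (face _ (pos t) j)) in
  [\/ D (t' : std K n.+1), R (t' : std K n.+1) /\ (mu (t' : std K n.+1) < mu t)%N |
   let u : std K n := op_comp t (face _ j) in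
   [/\ R u, (mu u < mu t)%N, pos u = unbump j (pos t) :> nat,
     ref_face py ry t j & ref_face px rx t j]].
Hypothesis RN : forall n (t : std K n), R t -> forall m (b : op m.+1 n.+2),
  ~ in_horn (pos t) (b : std n.+1 m) ->
  let u : std K m := op_comp (ins_shape t (pos t) v) b in R u ->
  [/\ forall l : 'I_m.+1, (l < pos u)%N -> (b l <= pos t)%N,
      forall l : 'I_m.+1, (pos u <= l)%N -> (pos t <= b l)%N,
      ref_split py ry t b u & ref_split px rx t b u].
Hypothesis fill : forall G, pmap evis G -> subgraph G0 G ->
  forall n (u : base n), R u.1 -> forall h : smap (horn (pos u.1)) A,
  (forall m (b : horn (pos u.1) m), G m (act (sval b) (insert u)) (h m b)) ->
  exists f : smap (std n.+1) A, smap_comp f (horn_incl (pos u.1)) = h.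

Let shp n (t : std K n) (Rt : R t) i := ins_shape_face (fun i => (Rpos Rt i).1) (fun i
    => (Rpos Rt i).2) i.
Let shc n (t : std K n) (Rt : R t) := ins_shape_pos (fun i => (Rpos Rt i).1) (fun i =>
    (Rpos Rt i).2).

Lemma pull_face p r (hr : ref_ok p r) n (t : std K n) (Rt : R t) i :
  p (t i) -> ins_pull t (pos t) v p (r n t) (face _ (pos t) i) = i.
Proof.
by apply: ins_pull_face => pv j hj; case: ((hr pv n t Rt).2 j hj).
Qed.

Lemma pull_pos p r (hr : ref_ok p r) n (t : std K n) (Rt : R t) :
  p v -> ins_pull t (pos t) v p (r n t) (pos t) = r n t.
Proof.
by move=> pv; apply: ins_pull_pos => // _ i hi; case: ((hr pv n t Rt).2 i hi).
Qed.

Lemma pull_vis p r (hr : ref_ok p r) n (t : std K n) (Rt : R t) i :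
  p (ins_shape t (pos t) v i) -> p (t (ins_pull t (pos t) v p (r n t) i)).
Proof.
case: (face_cases (pos t) i) => [->|[j ->]].
  by rewrite shc // => pv; rewrite (pull_pos hr) //; apply: (hr pv n t Rt).1.
by rewrite shp // => pj; rewrite (pull_face hr).
Qed.

Lemma face_face n (j : 'I_n.+2) (c : 'I_n.+3) (c' : 'I_n.+2) (l : 'I_n.+1) :
  c' = unbump j c :> nat ->
  face _ (face _ c j) (face _ c' l) = face _ c (face _ j l).
Proof.
by move=> e; apply: ord_inj; rewrite !faceE e /bump /unbump; lia.
Qed.

Lemma face_face_pos n (j : 'I_n.+2) (c : 'I_n.+3) (c' : 'I_n.+2) :
  c' = unbump j c :> nat -> face _ (face _ c j) c' = c.
Proof.
by move=> e; apply: ord_inj; rewrite !faceE e /bump /unbump; lia.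
Qed.

Lemma pull_face_nat p r (hr : ref_ok p r) n (t : std K n.+1) (Rt : R t)
    (j : 'I_n.+2) (u := op_comp t (face _ j) : std K n) (Ru : R u) l :
  pos u = unbump j (pos t) :> nat -> ref_face p r t j ->
  p (ins_shape u (pos u) v l) ->
  face _ j (ins_pull u (pos u) v p (r n u) l) =
  ins_pull t (pos t) v p (r n.+1 t) (face _ (face _ (pos t) j) l).
Proof.
move=> e hf; case: (face_cases (pos u) l) => [->|[k ->]].
  by rewrite shc // => pv; rewrite (pull_pos hr) // face_face_pos // (pull_pos hr) // hf.
by rewrite shp // => pk; rewrite (pull_face hr) // face_face // (pull_face hr).
Qed.

(** An instance of [pivot_fill] in which region, position and measure depend on vertex types only.
    Insertion respects [evis] because a visible coordinate of the enlarged simplex is copied from a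
    vertex where it was visible ([pull_vis]); [ref_face] and [ref_split] make the copied coordinates
    agree in the two conditions on faces and on operators outside the horn. *)
Theorem shape_fill : exists G, [/\ pmap evis G, subgraph G0 G,
  forall n (u : base n), R u.1 -> dom G u &
  forall n (u : base n), dom G u -> dom G0 u \/
    exists m (t : std K m) (b : op n.+1 m.+2),
      R t /\ u.1 = op_comp (ins_shape t (pos t) v) b].
Proof.
have [G [pG sG RG bG]] : exists G, [/\ pmap evis G, subgraph G0 G,
    forall n (u : base n), R u.1 -> dom G u &
    forall n (u : base n), dom G u -> dom G0 u \/
      exists m (w : base m) (b : op n.+1 m.+2), R w.1 /\ evis (act b (insert w)) u].
  apply: (pivot_fill evis_congr (R := fun n (u : base n) => R u.1)
     (pos := fun n (u : base n) => pos u.1) (mu := fun n (u : base n) => mu u.1)) => //.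
  - move=> n [t [y x]] [t' [y' x']] [/= e vy vx] Rt; subst t'; split=> //.
    split=> //=; apply: vis_act; [|exact: vy| |exact: vx] => i.
      exact: (pull_vis ry_ok).
    exact: (pull_vis rx_ok).
  - move=> n [t [y x]] /= Rt; split=> /=.
    + by apply: op_ext => i; rewrite /= shp.
    + rewrite act_comp -[X in vis _ _ _ X]act_id.
      by apply: vis_op => i /=; rewrite shp // => pi; rewrite (pull_face ry_ok).
    + rewrite act_comp -[X in vis _ _ _ X]act_id.
      by apply: vis_op => i /=; rewrite shp // => pi; rewrite (pull_face rx_ok).
  - move=> n [t [y x]] /= Rt i ic.
    case: n t y x Rt i ic => [|n] t y x Rt i ic; first by case: (R0 Rt).
    have [j ei] : exists j, i = face _ (pos t) j by case: (face_cases (pos t) i).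
    rewrite ei; have /= := RF Rt j; set t' := op_comp _ (face _ (face _ _ _)).
    case=> [Dt|Rt'|[Ru lt ep fy fx]].
    + by constructor 1; apply: DG0.
    + by constructor 2.
    + constructor 3; set u : std K n := op_comp t (face n.+1 j) in Ru lt ep.
      exists n, (u, (act (face n.+1 j) y, act (face n.+1 j) x)), (op_id _).
      have et : ins_shape u (pos u) v = t'.
        apply: op_ext => l; rewrite /t' /=; case: (face_cases (pos u) l) => [->|[k ->]].
          by rewrite face_face_pos // !shc.
        by rewrite face_face // !shp.
      pose w : base n := (u, (act (face n.+1 j) y, act (face n.+1 j) x)).
      have h : evis (insert w) (act (face _ (face _ (pos t) j)) (insert (t, (y, x)) :
          base _)).
        split; first exact: et.
          rewrite /= !act_comp; apply: vis_op => l pl; exact: (pull_face_nat ry_ok).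
        rewrite /= !act_comp; apply: vis_op => l pl; exact: (pull_face_nat rx_ok).
      split=> //; exact: (eq_ind_r (fun z => evis z _) h (act_id (insert w : base _))).
  - move=> n [t [y x]] /= Rt m b nb Ru.
    have [hlo hhi fy fx] := RN Rt nb Ru.
    set u : std K m := op_comp _ b in Ru hlo hhi fy fx.
    have [b' [bp bf]] := face_insert hlo hhi.
    have hp p r (hr : ref_ok p r) : ref_split p r t b u -> forall l,
        p (op_comp (ins_shape t (pos t) v) b' l) ->
        ins_pull t (pos t) v p (r n t) (b' l) =
        ins_pull t (pos t) v p (r n t) (b (ins_pull u (pos u) v p (r m u) l)).
      move=> hs l; case: (face_cases (pos u) l) => [->|[k ->]] /=.
        rewrite bp shc // => pv; rewrite (pull_pos hr) // (pull_pos hr) //.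
        have [pr _] := hr pv _ _ Rt.
        by case: (hs pv) => ->; [rewrite (pull_pos hr)|rewrite (pull_face hr)].
      by rewrite bf => pk; rewrite (pull_face hr).
    exists b'; split=> /=.
    + apply: op_ext => l /=; case: (face_cases (pos u) l) => [->|[k ->]].
        by rewrite bp !shc.
      by rewrite bf shp.
    + by rewrite !act_comp; apply: vis_op => l pl; apply: (hp _ _ ry_ok fy).
    + by rewrite !act_comp; apply: vis_op => l pl; apply: (hp _ _ rx_ok fx).
exists G; split=> // n u /bG[|[m [w [b [Rw [/= e _ _]]]]]]; first by left.
by right; exists m, w.1, b.
Qed.
End ShapeFill.
End Base.

(** * Special outer horns *)

(* The nerve of the contractible groupoid on two objects.                     *)
Lemma indisc_id n (w : 'I_n.+1 -> bool) : w \o op_id n.+1 = w.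
Proof. by []. Qed.
Lemma indisc_comp k m n (a : op k.+1 m.+1) (b : op m.+1 n.+1) (w : 'I_n.+1 -> bool) :
  (w \o b) \o a = w \o op_comp b a.
Proof. by []. Qed.
Definition indisc : sset :=
  @SSet (fun n => 'I_n.+1 -> bool) (fun _ _ a w => w \o a) indisc_id indisc_comp.

Section SpecialHorn.
Variables (A : sset) (hA : quasi_category A) (M : nat).
Variables (h : smap (@horn M.+2 ord0) A) (x0 : A 0).
Hypothesis h_const : forall n (b : horn ord0 n),
  (forall i, (sval b i <= 1)%N) -> h n b = act (op_const n.+1) x0.

(* Simplices of the standard simplex with its first vertex replaced by        *)
(* [indisc], up to the relation that forgets the word off that vertex.        *)
Let L := sprod (std M.+1) indisc.

Let E : srel L := fun n u v => u.1 = v.1 /\ forall i, u.1 i = ord0 -> u.2 i = v.2 i.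

Let E_congr : scongr E.
Proof.
split.
- by [].
- by move=> n [a w] [a' w'] [/= <- e]; split=> // i /e.
- move=> n [a w] [a' w'] [a'' w''] [/= e1 e] [/= e2 e']; subst a' a''.
  by split=> //= i hi; rewrite e ?e'.
- by move=> m n b [a w] [a' w'] [/= e1 e]; subst a'; split=> //= i /e.
Qed.

Let low : op M.+3 M.+2 := clamp M.+3 M.+1 predn.
Let lowE (i : 'I_M.+3) : low i = i.-1 :> nat.
Proof. by apply: clampE => [j|]; have := ltn_ord i; lia. Qed.

Let kap_act m n (a : op m.+1 n.+1) (b : std M.+2 n) :
  (op_comp low (act a b), (fun i => act a b i == 1%N :> nat)) =
  act a ((op_comp low b, (fun i => b i == 1%N :> nat)) : L n).
Proof. by congr pair; apply: op_ext. Qed.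
Let kap : smap (std M.+2) L := @SMap (std M.+2) L
  (fun n b => (op_comp low b, (fun i => b i == 1%N :> nat))) kap_act.

Let kap_inj n (b b' : std M.+2 n) : E (kap n b) (kap n b') -> b = b'.
Proof.
case=> /= e1 e2; apply: op_val_ext => i.
have /(congr1 (@nat_of_ord _)) := congr1 (fun f : op _ _ => f i) e1.
rewrite /= !lowE => e; have := e2 i.
case: (eqVneq (low (b i)) ord0) => [e0 /(_ e0)|ne _].
  by move/(congr1 (@nat_of_ord _)): e0; rewrite lowE /=; lia.
by move: ne; rewrite -val_eqE /= lowE; lia.
Qed.

(** The given horn, its vertices 0 and 1 becoming the two objects of the groupoid, together with the
    constant map at [x0] on the whole groupoid. They agree on the first edge by [h_const]. *)
Let G0 : graph L A := fun n u x =>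
  (exists b : horn ord0 n, E (kap n (sval b)) u /\ x = h n b) \/
  ((forall i, u.1 i = ord0) /\ x = act (op_const n.+1) x0).

Let pG0 : pmap E G0.
Proof.
have comp n (u : L n) (b : horn ord0 n) : E (kap n (sval b)) u -> (forall i, u.1 i =
    ord0) ->
    h n b = act (op_const n.+1) x0.
  move=> [/= e _] e0; apply: h_const => i.
  by have := e0 i; rewrite -e => /(congr1 (@nat_of_ord _)); rewrite lowE /=; lia.
split.
- move=> n u x x' [[b [e ->]]|[e ->]] [[b' [e' ->]]|[e' ->]] //.
  + congr (h n _); case: b b' e e' => b hb [b' hb'] /= e e'; apply: eq_exist;
      apply: kap_inj.
    exact: (sc_trans E_congr) e (sc_sym E_congr e').
  + exact: comp e e'.
  + by apply/esym; apply: comp e' e.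
- move=> m n a u x [[b [e ->]]|[e ->]].
    left; exists (act a b); rewrite sfun_act; split=> //.
    by rewrite -[sval _]/(act a (sval b)) sfun_act; apply: (sc_act E_congr).
  right; split=> [i|]; first exact: e.
  by rewrite act_comp; congr (act _ _); apply: op_ext.
- move=> n u v x e [[b [e' ->]]|[e' ->]].
    by left; exists b; split=> //; apply: (sc_trans E_congr) e' e.
  by right; split=> // i; rewrite -e.1.
Qed.

(** These describe the image of the horn among simplices not wholly inside the groupoid: monotone
    words come from the standard simplex, [flat] is the face opposite to vertex 1, and [misses]
    collects the faces opposite to the vertices beyond it. *)
Let mono n (u : L n) := forall i j : 'I_n.+1, (i <= j)%N -> u.1 j = ord0 -> u.2 i ->
    u.2 j.
Let flat n (u : L n) := forall i, u.1 i = ord0 -> u.2 i = false.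
Let misses n (u : L n) := exists2 j : 'I_M.+2, j <> ord0 & forall i, u.1 i <> j.

Let dom_intro n (u : L n) : mono u -> flat u \/ misses u -> dom G0 u.
Proof.
case: u => a w mu fm.
pose f (i : 'I_n.+1) := if a i == ord0 then nat_of_ord (inord (w i) : 'I_M.+3) else (a
    i).+1.
have wE (c : bool) : (inord c : 'I_M.+3) = c :> nat by rewrite inordK //; case: c.
have fb i : (f i < M.+3)%N by rewrite /f; case: eqP => // _; rewrite ltnS ltn_ord.
have fm' : {homo (fun i => Ordinal (fb i)) : i j / (i <= j)%N}.
  move=> i j le_ij /=; rewrite /f !wE; have := op_le a le_ij.
  case: eqP => [ai|ai]; case: eqP => [aj|aj] //.
  - by move=> _; have := mu i j le_ij aj; rewrite /=; case: (w i) => //= ->.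
  - by case: (w i).
  - by rewrite aj leqn0 => /eqP ai0; case: ai; apply: val_inj.
have fE i : mk_op fm' i = f i :> nat by [].
have e : E (kap n (mk_op fm')) (a, w).
  split=> /= [|i].
    apply: op_val_ext => i; rewrite [LHS]lowE fE /f.
    by case: eqP => [->|_] //; rewrite wE; case: (w i).
  have elo : low (mk_op fm' i) = a i.
    apply: ord_inj; rewrite [LHS]lowE fE /f.
    by case: eqP => [->|_] //; rewrite wE; case: (w i).
  move=> e0; have ai : a i = ord0 by rewrite -elo.
  by rewrite -[LHS]/(f i == 1%N) /f ai eqxx wE; case: (w i).
have hb : in_horn ord0 (mk_op fm' : std M.+2 n).
  case: fm => [fl|[j j0 mj]].
    exists (inord 1); split=> [/(congr1 val)|i /(congr1 (@nat_of_ord _))].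
      by rewrite /= inordK.
    rewrite fE inordK // /f; case: eqP => [ai|/eqP]; first by have := fl i ai;
        rewrite /= wE => ->.
    by rewrite -val_eqE /=; lia.
  exists (lift ord0 j); split=> // i /(congr1 (@nat_of_ord _)); rewrite fE /f lift0.
  case: eqP => [ai|ai].
    rewrite wE; have : j <> 0 :> nat by move=> e0; apply: j0; apply: ord_inj.
    by case: (w i); rewrite /=; lia.
  by case=> /val_inj; apply: mj.
by exists (h n (exist _ _ hb)); left; exists (exist _ _ hb).
Qed.

Let dom_elim n (u : L n) : (exists i, u.1 i <> ord0) -> dom G0 u ->
  mono u /\ (flat u \/ misses u).
Proof.
case: u => a w [i0 hi0] [x [[[b [j [j0 hj]]] [/= [/= e ew] _]]|[/(_ i0)//]]].
rewrite {}/x -{}e in ew hi0 * => {a}.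
have bE i : low (b i) = ord0 -> w i = (b i == 1%N :> nat) by move=> /ew <-.
split=> [i k le_ik /= bk|].
  have bi : low (b i) = ord0.
    move/(congr1 (@nat_of_ord _)): bk; rewrite lowE /= => bk; apply: ord_inj;
        rewrite lowE /=.
    by have := op_le b le_ik; lia.
  rewrite !bE //; move/(congr1 (@nat_of_ord _)): bk; rewrite lowE /=.
  by have := op_le b le_ik; lia.
case: (eqVneq (j : nat) 1%N) => [j1|j1].
  left=> i bi; rewrite /= bE //; apply/negP => /eqP e.
  by apply: (hj i); apply: ord_inj; rewrite e j1.
right; have jn : j <> 0 :> nat by move=> e0; apply: j0; apply: ord_inj.
exists (low j) => [/(congr1 (@nat_of_ord _))|i /(congr1 (@nat_of_ord _))].
  by rewrite lowE /=; lia.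
rewrite !lowE => e; apply: (hj i); apply: ord_inj; lia.
Qed.

Let surj n (a : std M.+1 n) := [forall j, [exists i, a i == j]].

Let R n (u : L n) := (exists i, u.1 i = ord0) /\ exists i, u.1 i <> ord0.
Let pos n (u : L n) : 'I_n.+2 := inord (lo_size u.1 1).
Let insw n (c : 'I_n.+2) (v : bool) (w : 'I_n.+1 -> bool) (i : 'I_n.+2) :=
  if unlift c i is Some j then w j else v.
(** The new letter is put last over the blown-up vertex, hence at an inner position. Its value keeps
    the horn closed under insertion: appending [true] keeps a word monotone when a later vertex is
    missed, and appending [false] keeps a flat word flat when none is. *)
Let ins n (u : L n) : L n.+1 :=
  (ins_shape u.1 (pos u) ord0, insw (pos u) (~~ surj u.1) u.2).

Let inswf n c v w (i : 'I_n.+1) : insw c v w (face _ c i) = w i.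
Proof.
have -> : face n.+1 c i = lift c i by apply: ord_inj; rewrite faceE.
by rewrite /insw liftK.
Qed.
Let inswc n c v (w : 'I_n.+1 -> bool) : insw c v w c = v.
Proof. by rewrite /insw unlift_none. Qed.

Let posE n (u : L n) (i : 'I_n.+1) : (i < pos u)%N = (u.1 i == ord0).
Proof.
rewrite /pos inordK; last by rewrite ltnS -[X in (_ <= X)%N](lo_hi_size u.1 1) leq_addr.
by rewrite -(lo_sizeP u.1 1) ltnS leqn0 -val_eqE.
Qed.

Let insc n (u : L n) : (ins u).1 (pos u) = ord0.
Proof.
apply: ins_shape_pos => i; last by rewrite leq0n.
by rewrite posE => /eqP ->.
Qed.
Let insf n (u : L n) i : (ins u).1 (face _ (pos u) i) = u.1 i.
Proof.
apply: ins_shape_face => j; last by rewrite leq0n.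
by rewrite posE => /eqP ->.
Qed.

Let ins_lt n (u : L n) i : ((ins u).1 i == ord0) = (i <= pos u)%N.
Proof.
case: (face_cases (pos u) i) => [->|[j ->]]; first by rewrite insc leqnn.
by rewrite insf -posE faceE /bump; lia.
Qed.

Let E_ins n (u v : L n) : E u v -> E (ins u) (ins v).
Proof.
case: u v => a w [a' w'] [/= e1 e]; subst a'; split=> // i.
have ep : pos (a, w') = pos (a, w) by [].
case: (face_cases (pos (a, w)) i) => [->|[j ->]]; rewrite /= ep ?inswc // => hj.
by rewrite !inswf; apply: e; rewrite -hj; apply/esym/(insf (a, w)).
Qed.

Let dom_ins n (u : L n) : R u -> dom G0 u -> dom G0 (ins u).
Proof.
move=> [[i0 hi0] hR] /(dom_elim hR) [mu fm]; apply: dom_intro.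
  move=> i j; case: (face_cases (pos u) i) => [->|[k ->]];
    case: (face_cases (pos u) j) => [->|[l ->]]; rewrite /= ?inswf ?inswc ?insf ?faceE //.
  - by move=> le ul; have := posE u l; rewrite ul eqxx => lt; move: le; rewrite /bump;
      lia.
  - move=> le _ wk; apply/negP => /forallP sj.
    have uk : u.1 k = ord0 by apply/eqP; rewrite -posE; move: le; rewrite /bump; lia.
    case: fm => [/(_ k uk)|[j0 _ hj]]; first by rewrite wk.
    by have /existsP[i1 /eqP] := sj j0; apply: hj.
  - by move=> le ul; apply: mu => //; move: le; rewrite /bump; lia.
case: (boolP (surj u.1)) => [sj|/forallPn[j]].
  left=> i; case: (face_cases (pos u) i) => [->|[k ->]];
      rewrite /= ?inswc ?sj // inswf insf => uk.
  case: fm => [fl|[j0 _ hj]]; first exact: fl.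
  by have /forallP/(_ j0)/existsP[i1 /eqP] := sj; case/hj.
rewrite negb_exists => /forallP hj; right; exists j.
  by move=> j0; have := hj i0; rewrite hi0 j0 eqxx.
move=> i; case: (face_cases (pos u) i) => [->|[k ->]].
  by rewrite insc => j0; have := hj i0; rewrite hi0 j0 eqxx.
by rewrite insf; apply/eqP.
Qed.

(** Deleting a vertex may destroy surjectivity, and then the inserted letter is the wrong one for
    the smaller simplex. Such a face is treated as a simplex of the region in its own right, so
    non-surjective simplices must precede surjective ones of the same dimension. *)
Let mu n (u : L n) := (surj u.1 + n)%N.

Let surj_ext m n (a : std M.+1 m) (a' : std M.+1 n) :
  (forall i, exists j, a i = a' j) -> (forall j, exists i, a' j = a i) -> surj a = surj
      a'.
Proof.
move=> i1 i2; apply/forallP/forallP => s j; have /existsP[i /eqP <-] := s j;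
    apply/existsP.
  by have [k ->] := i1 i; exists k.
by have [k ->] := i2 i; exists k.
Qed.

Let surj_ins n (u : L n) : R u -> surj (ins u).1 = surj u.1.
Proof.
case=> [[i0 hi0] _]; apply: surj_ext => i; last by exists (face _ (pos u) i);
    rewrite insf.
by case: (face_cases (pos u) i) => [->|[k ->]]; [exists i0; rewrite insc|exists k;
    rewrite insf].
Qed.

Let face_case n (u : L n.+1) : R u -> forall i : 'I_n.+3, i <> pos u ->
  let t' := act (face n.+2 i) (ins u) : L n.+1 in
  [\/ dom G0 t', R t' /\ (mu t' < mu u)%N |
     exists m (t : L m) (e : op n.+2 m.+2),
       [/\ R t, (mu t < mu u)%N & E (act e (ins t)) t']].
Proof.
move=> Ru i ic; have [j ei] : exists j, i = face _ (pos u) j by case: (face_cases (pos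
    u) i).
have [[i0 hi0] [i1 hi1]] := Ru.
pose t : L n := act (face n.+1 j) u; set t' := act _ _ => /=.
have tE l : t.1 l = u.1 (face n.+1 j l) by [].
have post : pos t = unbump j (pos u) :> nat.
  apply/eqP; rewrite eqn_leq; apply/andP; split; rewrite leqNgt; apply/negP => lt.
    have lt' : (unbump j (pos u) < n.+1)%N by have := ltn_ord (pos t); lia.
    have := posE t (Ordinal lt'); rewrite lt tE -posE faceE /= /bump /unbump; lia.
  have lt' : (pos t < n.+1)%N by move: lt; have := ltn_ord (pos u); have := ltn_ord j;
      rewrite /unbump; lia.
  have := posE t (Ordinal lt'); rewrite tE -posE faceE /= ltnn; move: lt;
      rewrite /bump /unbump; lia.
have t'c : t'.1 (pos t) = ord0.
  by rewrite /t' ei /= face_face_pos // insc.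
have t'f l : t'.1 (face _ (pos t) l) = t.1 l by rewrite /t' ei /= face_face // insf.
have w'c : t'.2 (pos t) = ~~ surj u.1 by rewrite /t' ei /= face_face_pos // inswc.
have w'f l : t'.2 (face _ (pos t) l) = t.2 l by rewrite /t' ei /= face_face // inswf.
case: (EM (exists l, t.1 l <> ord0)) => [ex1|no1]; last first.
  constructor 1; exists (act (op_const n.+2) x0); right; split=> // l.
  case: (face_cases (pos t) l) => [->//|[k ->]]; rewrite t'f.
  by apply: contrapT => hk; apply: no1; exists k.
(* If no other vertex lies over the blown-up one, the inserted letter is the whole word, and its
   value puts the face in the horn. *)
case: (EM (exists l, t.1 l = ord0)) => [ex0|no0]; last first.
  have uj : forall l, u.1 l = ord0 -> l = j.
    move=> l ul; case: (face_cases j l) => // -[k ek]; case: no0.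
    by exists k; rewrite tE -ek.
  have t'0 l : t'.1 l = ord0 -> l = pos t.
    case: (face_cases (pos t) l) => [->//|[k ->]]; rewrite t'f => tk.
    by case: no0; exists k.
  constructor 1; apply: dom_intro.
    move=> k l le_kl /t'0 el; case: (eqVneq (t'.1 k) ord0) => [/t'0 ->|];
        first by rewrite el.
    by move/eqP; have := op_le t'.1 le_kl; rewrite el t'c leqn0 => /eqP e0 [];
        apply: ord_inj.
  case: (boolP (surj u.1)) => [sj|/forallPn[j1]].
    by left=> l /t'0 ->; rewrite w'c sj.
  rewrite negb_exists => /forallP hj; right; exists j1.
    by move=> j0; have := hj i0; rewrite hi0 j0 eqxx.
  move=> l; case: (face_cases (pos t) l) => [->|[k ->]].
    by rewrite t'c => e; have := hj i0; rewrite hi0 e eqxx.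
  by rewrite t'f tE; apply/eqP.
have Rt : R t by [].
have Rt' : R t'.
  by split; [exists (pos t)|have [l hl] := ex1; exists (face _ (pos t) l); rewrite t'f].
have st' : surj t'.1 = surj t.1.
  have [k hk] := ex0.
  apply: surj_ext => l; last by exists (face _ (pos t) l); rewrite t'f.
  by case: (face_cases (pos t) l) => [->|[k' ->]]; [exists k; rewrite t'c|exists k';
      rewrite t'f].
have leS : (surj t.1 <= surj u.1)%N.
  case: (boolP (surj t.1)) => // /forallP s; rewrite lt0b; apply/forallP => l.
  by have /existsP[k hk] := s l; apply/existsP; exists (face _ j k).
case: (eqVneq (surj t.1) (surj u.1)) => [es|ns].
  constructor 3; exists n, t, (op_id _); split=> //; first by rewrite /mu es; lia.
  suff hE : E (ins t) t' by exact: (eq_ind_r (fun z => E z _) hE (act_id (ins t))).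
  split=> [|l _].
    apply: op_ext => l; case: (face_cases (pos t) l) => [->|[k ->]];
        first by rewrite t'c insc.
    by rewrite t'f insf.
  case: (face_cases (pos t) l) => [->|[k ->]]; first by rewrite w'c /= inswc es.
  by rewrite w'f /= inswf.
constructor 2; split=> //; rewrite /mu st'; move: leS ns.
by case: (surj t.1); case: (surj u.1) => //=; lia.
Qed.

(** Once [indisc] replaces the vertex, a letter can always be inserted between the groupoid part and
    the rest, so everything missing is added along inner horns. Restricting the extension to the
    simplex spanned by the two objects and the other vertices fills the original horn. *)
Lemma special_horn_initial : exists f : smap (std M.+2) A, smap_comp f (horn_incl ord0)
    = h.
Proof.
have [G [pG sG RG _]] : exists G, [/\ pmap E G, subgraph G0 G,
    forall n (u : L n), R u -> dom G u &
    forall n (u : L n), dom G u -> dom G0 u \/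
      exists m (w : L m) (b : op n.+1 m.+2), R w /\ E (act b (ins w)) u].
  apply: (pivot_fill E_congr (mu := mu) (pos := pos)) => //.
  - move=> n u v e Ru; split; last exact: E_ins.
    by case: Ru => -[i hi] [j hj]; split; [exists i|exists j]; rewrite -e.1.
  - move=> n u Ru; split=> [|i _] /=; last by rewrite inswf.
    by apply: op_ext => i; rewrite /= insf.
  - move=> [|n] u Ru i ic; last exact: face_case.
    by case: Ru => -[i0 e0] [i1]; case; rewrite (ord1 i1) -(ord1 i0).
  - move=> n u Ru m b /not_in_horn hb Rv; set v := act b (ins u) in Rv *.
    have vE l : v.1 l = (ins u).1 (b l) by [].
    have [l|l|b' [bc bf]] := @face_insert _ _ (pos u) (pos v) b.
    + by rewrite posE vE ins_lt.
    + by rewrite leqNgt posE vE ins_lt -ltnNge => /ltnW.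
    have sv : surj v.1 = surj u.1.
      rewrite -(surj_ins Ru); apply: surj_ext => l; first by exists (b l).
      case: (eqVneq l (pos u)) => [->|/eqP lc].
        by have [[k hk] _] := Rv; exists k; rewrite hk insc.
      by have [k <-] := hb l lc; exists k.
    exists b'; split=> [|l _] /=.
      apply: op_ext => l /=; case: (face_cases (pos v) l) => [->|[k ->]].
        by rewrite bc !insc.
      by rewrite bf insf.
    case: (face_cases (pos v) l) => [->|[k ->]].
      by rewrite bc !inswc sv.
    by rewrite bf inswf.
  - move=> G pG sG n u Ru g _; apply: hA.
    have [[i0 hi0] [i1 hi1]] := Ru.
    have := posE u i0; have := posE u i1; rewrite hi0 eqxx.
    have -> : (u.1 i1 == ord0) = false by apply/eqP.
    by have := ltn_ord i1; lia.
have tot n (u : L n) : dom G u.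
  case: (EM (exists i, u.1 i = ord0)) => [ex0|no0]; last first.
    apply: (dom_sub sG); apply: dom_intro => [i j _ uj|].
      by case: no0; exists j.
    by left=> i ui; case: no0; exists i.
  case: (EM (exists i, u.1 i <> ord0)) => [ex1|no1]; first exact: RG.
  apply: (dom_sub sG); exists (act (op_const n.+1) x0); right; split=> // i.
  by apply: contrapT => hi; apply: no1; exists i.
have [F [FG _]] := pmap_total pG tot.
exists (smap_comp F kap); apply: smap_ext => n b /=.
apply: (pm_fun pG) (FG _ _) _; apply: sG; left; exists b; split=> //.
Qed.
End SpecialHorn.

(** * Opposite simplicial sets and special horns at the last vertex *)

Lemma op_rev_subproof m n (a : op m n) :
  {homo (fun i => rev_ord (a (rev_ord i))) : i j / (i <= j)%N}.
Proof.
move=> i j le_ij /=; apply: leq_sub2l.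
by apply: (op_le a) => /=; apply: leq_sub2l.
Qed.
Definition op_rev m n (a : op m n) : op m n := mk_op (op_rev_subproof a).

Lemma op_revK m n (a : op m n) : op_rev (op_rev a) = a.
Proof. by apply: op_ext => i /=; rewrite !rev_ordK. Qed.

Lemma op_rev_comp k m n (b : op m n) (a : op k m) :
  op_rev (op_comp b a) = op_comp (op_rev b) (op_rev a).
Proof. by apply: op_ext => i /=; rewrite rev_ordK. Qed.

Lemma op_rev_id n : op_rev (op_id n) = op_id n.
Proof. by apply: op_ext => i /=; rewrite rev_ordK. Qed.

Lemma sop_act_id (A : sset) n (x : A n) : act (op_rev (op_id n.+1)) x = x.
Proof. by rewrite op_rev_id act_id. Qed.
Lemma sop_act_comp (A : sset) k m n (a : op k.+1 m.+1) (b : op m.+1 n.+1) (x : A n) :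
  act (op_rev a) (act (op_rev b) x) = act (op_rev (op_comp b a)) x.
Proof. by rewrite act_comp op_rev_comp. Qed.
Definition sop (A : sset) : sset :=
  @SSet A (fun _ _ a x => act (op_rev a) x) (@sop_act_id A) (@sop_act_comp A).

Lemma in_horn_rev N (k : 'I_N.+1) n (b : std N n) :
  in_horn k b -> in_horn (rev_ord k) (op_rev b : std N n).
Proof.
case=> j [jk hj]; exists (rev_ord j); split=> [/rev_ord_inj//|i /rev_ord_inj].
exact: hj.
Qed.

Lemma in_horn_rev' N (k : 'I_N.+1) n (b : std N n) :
  in_horn (rev_ord k) b -> in_horn k (op_rev b : std N n).
Proof. by move/in_horn_rev; rewrite rev_ordK. Qed.

(* [phi] is to be the identity [A -> sop A] or [sop A -> A]; this avoids      *)
(* comparing [sop (sop A)] with [A].                                          *)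
Lemma fill_rev (A B : sset) (phi : forall n, A n -> B n) (psi : forall n, B n -> A n)
    N (k : 'I_N.+1) (h : smap (horn k) A) :
  (forall m n (a : op m.+1 n.+1) x, phi m (act a x) = act (op_rev a) (phi n x)) ->
  (forall m n (a : op m.+1 n.+1) x, psi m (act a x) = act (op_rev a) (psi n x)) ->
  (forall n x, psi n (phi n x) = x) ->
  exists h' : smap (horn (rev_ord k)) B,
    (forall n (b : horn (rev_ord k) n),
       h' n b = phi n (h n (exist _ _ (in_horn_rev' (svalP b))))) /\
    ((exists f', smap_comp f' (horn_incl (rev_ord k)) = h') ->
     exists f, smap_comp f (horn_incl k) = h).
Proof.
move=> phiA psiA phiK.
have nat m n (a : op m.+1 n.+1) (b : horn (rev_ord k) n) :
    phi m (h m (exist _ _ (in_horn_rev' (svalP (act a b))))) =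
    act a (phi n (h n (exist _ _ (in_horn_rev' (svalP b))))).
  rewrite -[a in RHS]op_revK -phiA -sfun_act; congr (phi _ (h _ _)).
  by apply: eq_exist; rewrite /= op_rev_comp.
exists (SMap nat); split=> // -[f' f'E].
have nat' m n (a : op m.+1 n.+1) (b : std N n) :
    psi m (f' m (op_rev (act a b) : std N m)) = act a (psi n (f' n (op_rev b : std N n))).
  rewrite -[a in RHS]op_revK -psiA -sfun_act; congr (psi _ (f' _ _)).
  by rewrite /= op_rev_comp.
exists (@SMap (std N) A (fun n b => psi n (f' n (op_rev b : std N n))) nat').
apply: smap_ext => n [b hb] /=.
have /(congr1 (fun g : smap (horn (rev_ord k)) B => g n (exist _ _ (in_horn_rev hb))))
    /= -> := f'E.
by rewrite phiK; congr (h n _); apply: eq_exist; rewrite op_revK.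
Qed.

Lemma quasi_category_sop (A : sset) : quasi_category A -> quasi_category (sop A).
Proof.
move=> hA N k kN h.
have [||//|h' [_]] := @fill_rev (sop A) A (fun _ x => x) (fun _ x => x) N k h.
- by move=> m n a x.
- by move=> m n a x; rewrite /= op_revK.
by apply; apply: hA; rewrite /=; lia.
Qed.

Lemma special_horn_terminal (A : sset) (hA : quasi_category A) M
    (h : smap (@horn M.+2 ord_max) A) (x0 : A 0) :
  (forall n (b : horn ord_max n), (forall i, (M.+1 <= sval b i)%N) ->
     h n b = act (op_const n.+1) x0) ->
  exists f : smap (std M.+2) A, smap_comp f (horn_incl ord_max) = h.
Proof.
move=> hc.
have [||//|h' [h'E]] := @fill_rev A (sop A) (fun _ x => x) (fun _ x => x) M.+2 ord_max h.
- by move=> m n a x /=; rewrite op_revK.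
- by [].
apply; have e0 : rev_ord (ord_max : 'I_M.+3) = ord0 by apply: ord_inj; rewrite /= subnn.
have hc' n (b : horn (rev_ord ord_max) n) : (forall i, (sval b i <= 1)%N) ->
    h' n b = act (op_const n.+1) (x0 : sop A 0).
  move=> hb; rewrite h'E hc => [|i /=]; last first.
    rewrite subSS; apply: leq_trans (leq_sub2l M.+2 (hb (rev_ord i))).
    by rewrite subSS subn0.
  change (act (op_const n.+1) x0 = act (op_rev (op_const n.+1)) x0).
  by congr (act _ _); apply: op_ext => i; rewrite [LHS]ord1 [RHS]ord1.
move: h' hc' {h'E}; rewrite e0 => h' hc'.
exact: (special_horn_initial (quasi_category_sop hA) hc').
Qed.

(** * Insertion of a vertex at a cut *)

Section Cuts.
Variable (K : nat).

Definition cut (th : nat) n (t : std K n) : 'I_n.+2 := inord (lo_size t th).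

Lemma cut_val th n (t : std K n) : cut th t = lo_size t th :> nat.
Proof. by rewrite inordK // ltnS -[X in (_ <= X)%N](lo_hi_size t th) leq_addr. Qed.

Lemma cutE th n (t : std K n) (i : 'I_n.+1) : (i < cut th t)%N = (t i < th)%N.
Proof.
by rewrite (lo_sizeP t th) cut_val.
Qed.

Lemma cut_unique th n (t : std K n) (c : nat) : (c <= n.+1)%N ->
  (forall i : 'I_n.+1, (i < c)%N = (t i < th)%N) -> cut th t = c :> nat.
Proof.
move=> hc h; apply/eqP; rewrite eqn_leq; apply/andP; split; rewrite leqNgt;
    apply/negP => lt.
  have lt' : (c < n.+1)%N by have := ltn_ord (cut th t); lia.
  by have := cutE th t (Ordinal lt'); rewrite -h /= lt ltnn.
have lt' : (cut th t < n.+1)%N by lia.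
by have := cutE th t (Ordinal lt'); rewrite -h /= lt ltnn.
Qed.

Lemma cut_face th n (t : std K n.+1) (j : 'I_n.+2) :
  cut th (op_comp t (face _ j) : std K n) = unbump j (cut th t) :> nat.
Proof.
apply: cut_unique => [|i].
  by have := ltn_ord (cut th t); have := ltn_ord j; rewrite /unbump; lia.
by rewrite -[RHS](cutE th t (face _ j i)) faceE /bump /unbump; lia.
Qed.

Definition last_below th n (t : std K n) : 'I_n.+1 := inord (cut th t).-1.
Definition first_above th n (t : std K n) : 'I_n.+1 := inord (minn n (cut th t)).

Lemma last_belowP th n (t : std K n) i0 : (t i0 < th)%N ->
  (t (last_below th t) < th)%N /\ forall i, (t i < th)%N -> (i <= last_below th t)%N.
Proof.
rewrite -!cutE => h0; have e : last_below th t = (cut th t).-1 :> nat.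
  by rewrite inordK //; have := ltn_ord (cut th t); lia.
by split=> [|i]; rewrite -?cutE e; lia.
Qed.

Lemma first_aboveP th n (t : std K n) i0 : (th <= t i0)%N ->
  (th <= t (first_above th t))%N /\ forall i, (th <= t i)%N -> (first_above th t <= i)%N.
Proof.
rewrite leqNgt -cutE -leqNgt => h0; have e : first_above th t = cut th t :> nat.
  by rewrite inordK; have := ltn_ord (cut th t); have := ltn_ord i0; lia.
by split=> [|i]; rewrite leqNgt -cutE -leqNgt e.
Qed.

Lemma last_below_comp th m n (t : std K n) (b : op m.+1 n.+1) k :
  b k = last_below th t -> (t (b k) < th)%N ->
  b (last_below th (op_comp t b : std K m)) = last_below th t.
Proof.
move=> bk hk; have [h1 h2] := @last_belowP th m (op_comp t b) k hk.
have [_ h4] := last_belowP hk.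
apply: ord_inj; apply/eqP; rewrite eqn_leq h4 //= -bk.
by apply: (op_le b); apply: h2.
Qed.

Lemma first_above_comp th m n (t : std K n) (b : op m.+1 n.+1) k :
  b k = first_above th t -> (th <= t (b k))%N ->
  b (first_above th (op_comp t b : std K m)) = first_above th t.
Proof.
move=> bk hk; have [h1 h2] := @first_aboveP th m (op_comp t b) k hk.
have [_ h4] := first_aboveP hk.
apply: ord_inj; apply/eqP; rewrite eqn_leq h4 //= andbT -bk.
by apply: (op_le b); apply: h2.
Qed.
End Cuts.

Section Stage.
Variables (K : nat) (py px : pred 'I_K.+1) (Z X A : sset).
Variables (v : 'I_K.+1) (th : nat) (R : forall n, std K n -> Prop).
Hypothesis v_th : (th.-1 <= v <= th)%N.
Hypothesis R_ext : forall m n (s : std K m) (t : std K n),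
  (forall w, w <> v -> (exists i, s i = w) <-> (exists i, t i = w)) -> R s -> R t.
(** By [v_th], [v] is one of the two types adjacent to the cut. The new vertex goes next to the cut
    on the side of [v], and copies its coordinate from the nearest suitable vertex across the
    cut. *)
Definition ref_at th' n (t : std K n) :=
  if (v < th)%N then first_above th' t else last_below th' t.

(** The threshold [th'] skips the types across the cut that do not see the coordinate. The region
    supplies a vertex beyond [th'] such that every type from [th'] to its own does see it, so the
    nearest one does. *)
Definition ref_cond (p : pred 'I_K.+1) th' := p v ->
  if (v < th)%N then
    [/\ (th <= th')%N, forall w : 'I_K.+1, p w -> (th <= w)%N -> (th' <= w)%N &
        forall n (t : std K n), R t -> exists i, (th' <= t i)%N /\
          forall w : 'I_K.+1, (th' <= w)%N -> (w <= t i)%N -> p w]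
  else
    [/\ (th' <= th)%N, forall w : 'I_K.+1, p w -> (w < th)%N -> (w < th')%N &
        forall n (t : std K n), R t -> exists i, (t i < th')%N /\
          forall w : 'I_K.+1, (w < th')%N -> (t i <= w)%N -> p w].

Let pos n (t : std K n) := cut th t.

Lemma stage_pos n (t : std K n) (i : 'I_n.+1) :
  ((i < pos t)%N -> (t i <= v)%N) /\ ((pos t <= i)%N -> (v <= t i)%N).
Proof.
split; first by rewrite cutE; lia.
by rewrite leqNgt cutE -leqNgt; lia.
Qed.

Lemma stage_shape_face n (t : std K n) i :
  ins_shape t (pos t) v (face _ (pos t) i) = t i.
Proof. by apply: ins_shape_face => j; case: (stage_pos t j). Qed.

Lemma stage_shape_pos n (t : std K n) : ins_shape t (pos t) v (pos t) = v.
Proof. by apply: ins_shape_pos => j; case: (stage_pos t j). Qed.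

Lemma stage_ref_ok p th' : ref_cond p th' -> ref_ok v R pos p (ref_at th').
Proof.
move=> hp pv n t Rt; have := hp pv; rewrite /ref_at;
    case: ifP => _ [le hw /(_ n t Rt)[i [hi hpi]]].
  have [h1 h2] := first_aboveP hi; split.
    by apply: hpi => //; apply: (op_le t); apply: h2.
  move=> j pj; split; last by rewrite leqNgt cutE -leqNgt => hj; apply/h2/hw.
  rewrite cutE => lt; apply/ltnW; rewrite ltnNge; apply/negP => /(op_le t).
  by move=> h3; move: (leq_trans h1 h3); lia.
have [h1 h2] := last_belowP hi; split.
  by apply: hpi => //; apply: (op_le t); apply: h2.
move=> j pj; split; first by rewrite cutE => hj; apply/h2/hw.
rewrite leqNgt cutE -leqNgt => lt; rewrite leqNgt; apply/negP => /ltnW /(op_le t).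
by move=> h3; move: (leq_ltn_trans h3 h1); lia.
Qed.

Lemma ins_shape_th n (t : std K n) i :
  (ins_shape t (pos t) v i < th)%N = if (v < th)%N then (i <= pos t)%N else (i < pos t)%N.
Proof.
case: (face_cases (pos t) i) => [->|[j ->]]; first by rewrite stage_shape_pos;
    case: ifP; lia.
by rewrite stage_shape_face -cutE -/(pos t) faceE /bump; case: ifP; lia.
Qed.

Lemma ref_at_comp p th' m n (t : std K n) (b : op m.+1 n.+1) k : ref_cond p th' -> p v ->
  R t -> b k = ref_at th' t -> b (ref_at th' (op_comp t b : std K m)) = ref_at th' t.
Proof.
move=> hp pv Rt; have := hp pv; rewrite /ref_at;
    case: ifP => _ [_ _ /(_ n t Rt)[i [hi _]]] bk.
  by apply: (first_above_comp bk); rewrite bk; have [] := first_aboveP hi.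
by apply: (last_below_comp bk); rewrite bk; have [] := last_belowP hi.
Qed.

Lemma ref_at_ins p th' n (t : std K n) : ref_cond p th' -> p v -> R t ->
  ref_at th' (ins_shape t (pos t) v) = face _ (pos t) (ref_at th' t).
Proof.
move=> hp pv Rt; have := hp pv; rewrite /ref_at; set s := ins_shape _ _ _.
have sc : s (pos t) = v by apply: stage_shape_pos.
have sf i : s (face _ (pos t) i) = t i by apply: stage_shape_face.
case: ifP => lt [le _ /(_ n t Rt)[i [hi _]]].
  have [h1 h2] := first_aboveP hi.
  have hi' : (th' <= s (face _ (pos t) i))%N by rewrite sf.
  have [h3 h4] := first_aboveP hi'.
  case: (face_cases (pos t) (first_above th' s)) => [e|[k e]].
    by move: h3; rewrite e sc; lia.
  have hk : (first_above th' t <= k)%N by apply: h2; rewrite -sf -e.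
  have := h4 (face _ (pos t) (first_above th' t)); rewrite sf => /(_ h1).
  by rewrite e !faceE => hk'; apply: ord_inj; rewrite !faceE; move: hk'; rewrite /bump;
      lia.
have [h1 h2] := last_belowP hi.
have hi' : (s (face _ (pos t) i) < th')%N by rewrite sf.
have [h3 h4] := last_belowP hi'.
case: (face_cases (pos t) (last_below th' s)) => [e|[k e]].
  by move: h3; rewrite e sc; lia.
have hk : (k <= last_below th' t)%N by apply: h2; rewrite -sf -e.
have := h4 (face _ (pos t) (last_below th' t)); rewrite sf => /(_ h1).
by rewrite e !faceE => hk'; apply: ord_inj; rewrite !faceE; move: hk'; rewrite /bump; lia.
Qed.

Lemma R_ins n (t : std K n) : R t -> R (ins_shape t (pos t) v).
Proof.
apply: R_ext => w wv; split=> -[i hi].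
  by exists (face _ (pos t) i); rewrite stage_shape_face.
case: (face_cases (pos t) i) hi => [->|[j ->]]; last by rewrite stage_shape_face => hj;
    exists j.
by rewrite stage_shape_pos => e; case: wv.
Qed.

Lemma stage_split p th' n (t : std K n) m (b : op m.+1 n.+2) : ref_cond p th' -> R t ->
  ~ in_horn (pos t) (b : std n.+1 m) ->
  ref_split v pos p (ref_at th') t b (op_comp (ins_shape t (pos t) v) b).
Proof.
move=> hp Rt /not_in_horn hb pv; right.
have e := ref_at_ins hp pv Rt.
have [k hk] := hb (ref_at th' (ins_shape t (pos t) v)) ltac:(by rewrite e;
    apply: face_neq).
by rewrite (ref_at_comp hp pv _ hk) //; apply: R_ins.
Qed.

Lemma ref_at_side p th' n (t : std K n) : ref_cond p th' -> p v -> R t ->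
  (ref_at th' t < pos t)%N = ~~ (v < th)%N.
Proof.
move=> hp pv Rt; rewrite cutE; have := hp pv; rewrite /ref_at; case: ifP => lt.
  by case=> le _ /(_ n t Rt)[i [hi _]]; have [h1 _] := first_aboveP hi; lia.
by case=> le _ /(_ n t Rt)[i [hi _]]; have [h1 _] := last_belowP hi; lia.
Qed.

(** A vertex deleted on the side of [v] cannot be the reference vertex, which lies across the
    cut. *)
Lemma stage_face p th' n (t : std K n.+1) (j : 'I_n.+2) : ref_cond p th' -> R t ->
  (j < pos t)%N = (v < th)%N -> ref_face v p (ref_at th') t j.
Proof.
move=> hp Rt hj pv; have side := ref_at_side hp pv Rt.
case: (face_cases j (ref_at th' t)) => [e|[k hk]].
  by move: side; rewrite e hj; case: (v < th)%N.
exact: (ref_at_comp hp pv Rt (esym hk)).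
Qed.

(** The number of vertices across the cut from [v], plus the dimension. *)
Let mu n (t : std K n) := ((if (v < th)%N then n.+1 - pos t else pos t) + n)%N.

Lemma pos_ins n (t : std K n) :
  pos (ins_shape t (pos t) v) = (pos t + (v < th))%N :> nat.
Proof.
apply: cut_unique => [|i]; first by have := ltn_ord (pos t); case: (v < th)%N; lia.
by rewrite ins_shape_th; case: ifP; lia.
Qed.

Variables (ty tx : nat) (D : forall n, std K n -> Prop).
Variables (Zs : forall n, Z n -> Prop) (G0 : graph (base K Z X) A).
Hypothesis hy : ref_cond py ty.
Hypothesis hx : ref_cond px tx.
Hypothesis R0 : forall t : std K 0, ~ R t.
Hypothesis RD : forall n (t : std K n) m (b : op m.+1 n.+2) (u : std K m),
  R t -> u = op_comp (ins_shape t (pos t) v) b -> ~ R u -> D u.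
Hypothesis DR : forall n (t : std K n), R t -> ~ D t.
Hypothesis Zs_act : forall m n (a : op m.+1 n.+1) (y : Z n), Zs y -> Zs (act a y).

Definition zclosed n (u : base K Z X n) :=
  exists y, Zs y /\ vis py u.1 u.2.1 y.

Hypothesis pG0 : pmap (@evis K py px Z X) G0.
Hypothesis domG0 : forall n (u : base K Z X n), dom G0 u -> D u.1 \/ zclosed u.
Hypothesis zdom : forall n (u : base K Z X n), zclosed u -> dom G0 u.
Hypothesis Ddom : forall n (u : base K Z X n), D u.1 -> dom G0 u.
Hypothesis fill : forall G, pmap (@evis K py px Z X) G -> subgraph G0 G ->
  forall n (u : base K Z X n), R u.1 -> forall h : smap (horn (pos u.1)) A,
  (forall m (b : horn (pos u.1) m),
     G m (act (sval b) (insert py px v pos (ref_at ty) (ref_at tx) u)) (h m b)) ->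
  exists f : smap (std n.+1) A, smap_comp f (horn_incl (pos u.1)) = h.

(** Consider a face of the enlarged simplex that deletes an old vertex. On the side of [v], the face
    is the insertion into a face of [t], of smaller dimension. Across the cut the reference may be
    lost, but the face, of the dimension of [t], has one vertex fewer there. Either way the measure
    drops, unless the face has left the region and is already given. *)
Theorem stage_fill : exists G, [/\ pmap (@evis K py px Z X) G, subgraph G0 G,
  forall n (u : base K Z X n), R u.1 -> dom G u &
  forall n (u : base K Z X n), dom G u -> dom G0 u \/
    exists m (t : std K m) (b : op n.+1 m.+2),
      R t /\ u.1 = op_comp (ins_shape t (pos t) v) b].
Proof.
have Rp n (t : std K n) : R t -> forall i : 'I_n.+1,
  ((i < pos t)%N -> (t i <= v)%N) /\ ((pos t <= i)%N -> (v <= t i)%N).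
  by move=> _; apply: stage_pos.
apply: (shape_fill (D := D) (ry := ref_at ty) (rx := ref_at tx) (mu := mu)) => //.
- exact: stage_ref_ok.
- exact: stage_ref_ok.
- move=> n u Ru /domG0[/(DR Ru)//|[y [Zy vy]]]; apply: zdom.
  exists (act (ins_pull u.1 (pos u.1) v py (ref_at ty u.1)) y); split;
      first exact: Zs_act.
  apply: vis_act vy => i; exact: (pull_vis Rp (stage_ref_ok hy) Ru).
- move=> n t Rt j; set i := face _ _ j; set s := ins_shape _ _ _; set t' := op_comp s _.
  have [Rt'|/(RD Rt erefl)] := EM (R (t' : std K n.+1)); last by constructor 1.
  have lti := ltn_ord (pos t).
  have pos' : pos (t' : std K n.+1) = unbump i (pos t + (v < th)) :> nat.
    by rewrite /pos cut_face -/(pos _) pos_ins.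
  have iE : i = bump (pos t) j :> nat by rewrite /i faceE.
  (* Is the deleted vertex on the same side of the cut as [v]? *)
  have [hj|hj] := boolP ((j < pos t)%N == (v < th)%N).
    constructor 3; set u := op_comp t _.
    have Ru : R (u : std K n).
      apply: R_ext Rt' => w wv; split=> -[l hl].
        case: (face_cases (cut th (u : std K n)) l) hl => [->|[k ->]].
          by rewrite /t' /= face_face_pos ?cut_face // stage_shape_pos => e; case: wv.
        by rewrite /t' /= face_face ?cut_face // stage_shape_face => hk; exists k.
      exists (face _ (cut th (u : std K n)) l).
      by rewrite /t' /= face_face ?cut_face // stage_shape_face.
    split=> //.
    + rewrite /mu [pos (u : std K n)]lock /= -lock /pos cut_face -/(pos t).
      by move: (eqP hj); rewrite /unbump; case: ifP; have := ltn_ord j; lia.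
    + by rewrite /pos cut_face.
    + exact: (stage_face hy Rt (eqP hj)).
    + exact: (stage_face hx Rt (eqP hj)).
  constructor 2; split=> //; rewrite /mu pos' iE; move: hj; rewrite /unbump /bump.
  by have := ltn_ord j; case: ifP; lia.
- move=> n t Rt m b nb u Ru; split.
  + by move=> l; rewrite cutE ins_shape_th; case: ifP; lia.
  + by move=> l; rewrite leqNgt cutE ins_shape_th; case: ifP; lia.
  + exact: stage_split.
  + exact: stage_split.
Qed.
End Stage.

(** * Extension of spans *)

Section ImageGraph.
Variables (L A : sset) (E : srel L) (hE : scongr E).

Definition image_graph K (j : smap K L) (f : smap K A) : graph L A :=
  fun n u x => exists w, E (j n w) u /\ x = f n w.

Lemma image_pmap K (j : smap K L) (f : smap K A) :
  (forall n (w w' : K n), E (j n w) (j n w') -> f n w = f n w') ->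
  pmap E (image_graph j f).
Proof.
move=> jf; split.
- move=> n u x x' [w [e ->]] [w' [e' ->]]; apply: jf.
  exact: (sc_trans hE) e (sc_sym hE e').
- move=> m n a u x [w [e ->]]; exists (act a w); rewrite !sfun_act; split=> //.
  exact: (sc_act hE).
- by move=> n u v x e [w [e' ->]]; exists w; split=> //; apply: (sc_trans hE) e' e.
Qed.

Definition graphU (G H : graph L A) : graph L A := fun n u x => G n u x \/ H n u x.

Lemma graphU_pmap G H : pmap E G -> pmap E H ->
  (forall n (u : L n) x x', G n u x -> H n u x' -> x = x') -> pmap E (graphU G H).
Proof.
move=> pG pH c; split.
- move=> n u x x' [g|g] [g'|g'];
    [exact: (pm_fun pG) g g'|exact: c g g'| |exact: (pm_fun pH) g g'].
  by apply/esym; apply: c g' g.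
- by move=> m n a u x [g|g]; [left; apply: (pm_act pG)|right; apply: (pm_act pH)].
- by move=> n u v x e [g|g]; [left; apply: (pm_E pG) g|right; apply: (pm_E pH) g].
Qed.
End ImageGraph.

Lemma special_horn_first (A : sset) (hA : quasi_category A) N (c : 'I_N.+1)
    (h : smap (horn c) A) (x0 : A 0) : (1 < N)%N -> c = 0 :> nat ->
  (forall n (b : horn c n), (forall i, (sval b i <= 1)%N) -> h n b = act (op_const
      n.+1) x0) ->
  exists f : smap (std N) A, smap_comp f (horn_incl c) = h.
Proof.
case: N c h => [|[|M]] // c h _ c0; have e : c = ord0 by apply: ord_inj.
subst c; exact: special_horn_initial.
Qed.

Lemma special_horn_last (A : sset) (hA : quasi_category A) N (c : 'I_N.+1)
    (h : smap (horn c) A) (x0 : A 0) : (1 < N)%N -> c = N :> nat ->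
  (forall n (b : horn c n), (forall i, (N.-1 <= sval b i)%N) -> h n b = act (op_const
      n.+1) x0) ->
  exists f : smap (std N) A, smap_comp f (horn_incl c) = h.
Proof.
case: N c h => [|[|M]] // c h _ c0; have e : c = ord_max by apply: ord_inj.
subst c; exact: special_horn_terminal.
Qed.

(* The types [0], [1], [2], [3] of the vertices of a simplex of [base 3 Z X]  *)
(* stand for: fat over [Z], thin over [Z], thin over [X], fat over [X]; thin  *)
(* vertices have a coordinate in one of [Z] and [X] only.                     *)
Definition seesZ (w : 'I_4) := w != 2 :> nat.
Definition seesX (w : 'I_4) := w != 1 :> nat.

Lemma seesZ_le (w : 'I_4) : (w <= 1)%N -> seesZ w.
Proof. by rewrite /seesZ; lia. Qed.
Lemma seesX_gt (w : 'I_4) : (1 < w)%N -> seesX w.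
Proof. by rewrite /seesX; lia. Qed.

Definition fat : op 2 4 := clamp 2 3 (muln 3).
Definition thin : op 2 4 := clamp 2 3 succn.
Definition first_end : op 2 4 := clamp 2 3 id.
Definition last_end : op 2 4 := clamp 2 3 (addn 2).

Lemma fatE i : fat i = 3 * i :> nat.
Proof. by apply: clampE => [j|]; have := ltn_ord i; lia. Qed.
Lemma thinE i : thin i = i.+1 :> nat.
Proof. by apply: clampE => [j|]; have := ltn_ord i; lia. Qed.
Lemma first_endE i : first_end i = i :> nat.
Proof. by apply: clampE => [j|]; have := ltn_ord i; lia. Qed.
Lemma last_endE i : last_end i = 2 + i :> nat.
Proof. by apply: clampE => [j|]; have := ltn_ord i; lia. Qed.

Lemma factor_edge m (e : op 2 4) (t : op m 4) : (e ord0 < e ord_max)%N ->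
  (forall i, t i = e ord0 \/ t i = e ord_max) -> exists s, t = op_comp e s.
Proof.
move=> lt h; pose f i : 'I_2 := if t i == e ord0 then ord0 else ord_max.
have hf : {homo f : i j / (i <= j)%N}.
  move=> i j le_ij; rewrite /f; case: eqP => // ti; case: eqP => // tj.
  by have := op_le t le_ij; have := lt; case: (h i) => [//|->]; rewrite tj; lia.
exists (mk_op hf); apply: op_ext => i /=; rewrite /f; case: eqP => // ti.
by case: (h i).
Qed.

Lemma vis_total K (p : pred 'I_K.+1) n (t : std K n) (Y : sset) (y y' : Y n) :
  (forall i, p (t i)) -> vis p t y y' -> y = y'.
Proof. by move=> h v; rewrite -(act_id y) -(act_id y'); apply: v => i. Qed.

Lemma ord2_cases (i : 'I_2) : i = ord0 \/ i = ord_max.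
Proof.
case: (eqVneq i ord0) => [|ne]; [by left|right]; apply: ord_inj.
by have := ltn_ord i; move: ne; rewrite -val_eqE /=; lia.
Qed.

Definition has n (t : std 3 n) (w : 'I_4) := exists i, t i = w.

Definition w0 : 'I_4 := Ordinal (isT : 0 < 4)%N.
Definition w1 : 'I_4 := Ordinal (isT : 1 < 4)%N.
Definition w2 : 'I_4 := Ordinal (isT : 2 < 4)%N.
Definition w3 : 'I_4 := Ordinal (isT : 3 < 4)%N.

Lemma type_cases (w : 'I_4) : [\/ w = w0, w = w1, w = w2 | w = w3].
Proof.
by case: w => -[|[|[|[|//]]]] h;
    [constructor 1|constructor 2|constructor 3|constructor 4];
  apply: ord_inj.
Qed.

Lemma not_has n (t : std 3 n) w i : ~ has t w -> t i <> w.
Proof. by move=> h e'; apply: h; exists i. Qed.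

Lemma hasE m n (s : std 3 m) (t : std 3 n) (v w : 'I_4) :
  (forall w, w <> v -> (exists i, s i = w) <-> (exists i, t i = w)) -> w <> v ->
  has s w = has t w.
Proof. by move=> h /h e'; apply/propext. Qed.

Lemma two_vertices n (t : std 3 n) i j : t i <> t j -> (1 < n.+1)%N.
Proof. by case: n t i j => // t i j; rewrite (ord1 i) (ord1 j). Qed.

Lemma cut_inner K th n (t : std K n) i j : (t i < th)%N -> (th <= t j)%N ->
  (0 < cut th t < n.+1)%N.
Proof.
move=> hi hj; have := cutE th t i; have := cutE th t j;
    rewrite hi [(t j < th)%N]ltnNge hj /= => hj' hi'.
by have := ltn_ord j; lia.
Qed.

Section Spans.
Variables (A X : sset) (d : smap X A).

Notation E := (@evis 3 seesZ seesX _ X).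

Definition emap Z (e : op 2 4) : smap (base 1 Z X) (base 3 Z X) :=
  sprod_map (std_map e : smap (std 1) (std 3)) (smap_id _).
Definition zmap K Z Z' (g : smap Z Z') : smap (base K Z X) (base K Z' X) :=
  sprod_map (smap_id _) (sprod_map g (smap_id _)).

Record span_ok Z (a : smap Z A) (f : smap (base 3 Z X) A) : Prop := SpanOk {
  span_E : forall n (u u' : base 3 Z X n), E u u' -> f n u = f n u';
  span_first : forall n (u : base 3 Z X n), (forall i, (u.1 i <= 1)%N) -> f n u = a n
      u.2.1;
  span_last : forall n (u : base 3 Z X n), (forall i, (1 < u.1 i)%N) -> f n u = d n
      u.2.2 }.

(** A map out of the join of [Z] and [X] under [a] and [d]. For [fat] both coordinates are visible
    everywhere and only the two ends are collapsed; for [thin] each vertex keeps one coordinate,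
    which is Joyal's join. *)
Record side_ok (e : op 2 4) Z (a : smap Z A) (f : smap (base 1 Z X) A) : Prop := SideOk {
  side_E : forall n (u u' : base 1 Z X n), E (emap Z e n u) (emap Z e n u') -> f n u =
      f n u';
  side_first : forall n (u : base 1 Z X n), (forall i, u.1 i = ord0) -> f n u = a n u.2.1;
  side_last : forall n (u : base 1 Z X n), (forall i, u.1 i = ord_max) -> f n u = d n
      u.2.2 }.

Lemma span_side (e : op 2 4) Z (a : smap Z A) f : (e ord0 <= 1)%N -> (1 < e ord_max)%N
    -> span_ok a f ->
  side_ok e a (smap_comp f (emap Z e)).
Proof.
move=> e0 e1 [fE f0 f1]; split.
- by move=> n u u' /fE.
- by move=> n u hu; apply: f0 => i; rewrite /= hu.
- by move=> n u hu; apply: f1 => i; rewrite /= hu.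
Qed.

Lemma span_zmap Z Z' (g : smap Z' Z) (a : smap Z A) f : span_ok a f ->
  span_ok (smap_comp a g) (smap_comp f (zmap 3 g)).
Proof.
case=> fE f0 f1; split=> [n u u' [e vy vx]|n u hu|n u hu]; [|exact: f0|exact: f1].
apply: fE; split=> //= m b hb; rewrite -!sfun_act; congr (g _ _); exact: vy.
Qed.

Section Extend.
Variables (hA : quasi_category A) (e : op 2 4).
Hypothesis e0 : (e ord0 <= 1)%N.
Hypothesis e1 : (1 < e ord_max)%N.
Variables (Z Z' : sset) (g : smap Z' Z) (g_inj : forall n, injective (g n)).
Variables (a : smap Z A) (f : smap (base 1 Z X) A) (f' : smap (base 3 Z' X) A).
Hypothesis f_ok : side_ok e a f.
Hypothesis f'_ok : span_ok (smap_comp a g) f'.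
Hypothesis ff' : smap_comp f' (emap Z' e) = smap_comp f (zmap 1 g).

Definition first_graph : graph (base 3 Z X) A :=
  image_graph E (emap Z first_end) (smap_comp a (smap_comp (sfst _ _) (ssnd _ _))).
Definition last_graph : graph (base 3 Z X) A :=
  image_graph E (emap Z last_end) (smap_comp d (smap_comp (ssnd _ _) (ssnd _ _))).

Definition given : graph (base 3 Z X) A :=
  graphU (graphU first_graph last_graph)
    (graphU (image_graph E (emap Z e) f) (image_graph E (zmap 3 g) f')).

Lemma first_graphP n (u : base 3 Z X n) x :
  first_graph u x <-> (forall i, (u.1 i <= 1)%N) /\ x = a n u.2.1.
Proof.
split.
- case=> w [[/= et vy vx] ->]; have hu i : (u.1 i <= 1)%N.
    by rewrite -et /= first_endE -ltnS ltn_ord.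
  split=> //; congr (a _ _); apply: vis_total vy => i.
  by rewrite et; apply/seesZ_le/hu.
- case=> hu ->; have [//|i|s es] := @factor_edge _ first_end u.1.
    by rewrite !first_endE.
    have := hu i; rewrite leq_eqVlt ltnS leqn0 => /orP[] /eqP h; [right|left];
      by apply: ord_inj; rewrite first_endE.
  exists (s, u.2); split=> //; case: u es {hu} => t yx /= ->;
      exact: (sc_refl (evis_congr _ _ _ _)).
Qed.

Lemma last_graphP n (u : base 3 Z X n) x :
  last_graph u x <-> (forall i, (1 < u.1 i)%N) /\ x = d n u.2.2.
Proof.
split.
- case=> w [[/= et vy vx] ->]; have hu i : (1 < u.1 i)%N by rewrite -et /= last_endE.
  split=> //; congr (d _ _); apply: vis_total vx => i.
  by rewrite et; apply/seesX_gt/hu.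
- case=> hu ->; have [//|i|s es] := @factor_edge _ last_end u.1.
    by rewrite !last_endE.
    have := hu i; have := ltn_ord (u.1 i) => lt gt;
        have h : u.1 i = 2 :> nat \/ u.1 i = 3 :> nat by lia.
    by case: h => h; [left|right]; apply: ord_inj; rewrite last_endE.
  exists (s, u.2); split=> //; case: u es {hu} => t yx /= ->;
      exact: (sc_refl (evis_congr _ _ _ _)).
Qed.

(** The four pieces agree where they overlap: side and span both restrict to [a] and [d] on the
    ends, and to each other by [ff']. Injectivity of [g] makes [f'] well defined on visible
    coordinates in [Z]. *)
Lemma given_pmap : pmap E given.
Proof.
have hE := @evis_congr 3 seesZ seesX Z X.
have e01 : (e ord0 < e ord_max)%N by lia.
have p1 : pmap E first_graph.
  apply: image_pmap => // n w w' [/= et vy _]; congr (a _ _); apply: vis_total vy => i.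
  by apply: seesZ_le; rewrite /= first_endE -ltnS ltn_ord.
have p2 : pmap E last_graph.
  apply: image_pmap => // n w w' [/= et _ vx]; congr (d _ _); apply: vis_total vx => i.
  by apply: seesX_gt; rewrite /= last_endE.
have p3 : pmap E (image_graph E (emap Z e) f).
  by apply: image_pmap => // n w w'; apply: (side_E f_ok).
have p4 : pmap E (image_graph E (zmap 3 g) f').
  apply: image_pmap => // n w w' [/= et vy vx]; apply: (span_E f'_ok); split=> // m b hb.
  by apply: (@g_inj _); rewrite !sfun_act; apply: vy.
apply: graphU_pmap; [apply: graphU_pmap|apply: graphU_pmap|] => //.
- by move=> n u x x' /first_graphP[h _] /last_graphP[h' _];
    have := leq_ltn_trans (h ord0) (h' ord0); rewrite ltnn.
- move=> n u x x' [w [ew ->]] [w' [ew' ->]]; pose w2 : base 1 Z' X n := (w.1, w'.2).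
  have <- : f n (zmap 1 g n w2) = f' n w'.
    have /(congr1 (fun k : smap _ A => k n w2)) /= <- := ff'; congr (f' n _).
    have [/= e1' _ _] := sc_trans hE ew (sc_sym hE ew').
    by case: w' {ew' w2} e1' => t' yx' /= <-.
  apply: (side_E f_ok); have [h1 h2 h3] := sc_trans hE ew (sc_sym hE ew').
  by split.
- move=> n u x x' h; suff [[hu ->]|[hu ->]] : ((forall i, (u.1 i <= 1)%N) /\ x = a n
    u.2.1) \/
      ((forall i, (1 < u.1 i)%N) /\ x = d n u.2.2).
  + case=> -[w [[/= et vy vx] ->]].
      rewrite (side_first f_ok) => [|i].
        congr (a _ _); apply/esym; apply: vis_total vy => i.
        by rewrite et; apply/seesZ_le/hu.
      have := hu i; rewrite -et /=; case: (eqVneq (w.1 i) ord0) => // ne.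
      have -> : w.1 i = ord_max by apply: ord_inj; have := ltn_ord (w.1 i); move: ne;
          rewrite -val_eqE /=; lia.
      by lia.
    rewrite (span_first f'_ok) => [|i]; last by have := hu i; rewrite -et.
    congr (a _ _); apply/esym; apply: vis_total vy => i.
    by rewrite et; apply/seesZ_le/hu.
  + case=> -[w [[/= et vy vx] ->]].
      rewrite (side_last f_ok) => [|i].
        congr (d _ _); apply/esym; apply: vis_total vx => i.
        by rewrite et; apply/seesX_gt/hu.
      have := hu i; rewrite -et /=; case: (eqVneq (w.1 i) ord_max) => // ne.
      have -> : w.1 i = ord0 by apply: ord_inj; have := ltn_ord (w.1 i); move: ne;
          rewrite -val_eqE /=; lia.
      by lia.
    rewrite (span_last f'_ok) => [|i]; last by have := hu i; rewrite -et.
    congr (d _ _); apply/esym; apply: vis_total vx => i.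
    by rewrite et; apply/seesX_gt/hu.
  by case: h => [/first_graphP|/last_graphP]; [left|right].
Qed.

Definition in_image n (y : Z n) := exists y', y = g n y'.

Lemma in_image_act m n (b : op m.+1 n.+1) (y : Z n) : in_image y -> in_image (act b y).
Proof. by case=> y' ->; exists (act b y'); rewrite sfun_act. Qed.

Definition given_shape n (t : std 3 n) :=
  [\/ forall i, (t i <= 1)%N, forall i, (1 < t i)%N | forall i, t i = e ord0 \/ t i = e
      ord_max].

Lemma given_dom n (u : base 3 Z X n) : dom given u ->
  given_shape u.1 \/ zclosed seesZ in_image u.
Proof.
case=> x [[/first_graphP[h _]|/last_graphP[h _]]|[[w [[/= et _ _] _]]|[w [[/= et vy _]
    _]]]].
- by left; constructor 1.
- by left; constructor 2.
- left; constructor 3 => i; rewrite -et /=.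
  by case: (ord2_cases (w.1 i)) => ->; [left|right].
- right; exists (g n w.2.1); split; first by exists w.2.1.
  by move=> m b hb; rewrite vy // => i; rewrite et.
Qed.

Lemma given_shape_dom n (u : base 3 Z X n) : given_shape u.1 -> dom given u.
Proof.
case=> h.
- by exists (a n u.2.1); left; left; apply/first_graphP.
- by exists (d n u.2.2); left; right; apply/last_graphP.
- have [|s es] := factor_edge _ h; first by lia.
  exists (f n (s, u.2)); right; left; exists (s, u.2); split=> //.
Qed.

Lemma zclosed_dom n (u : base 3 Z X n) : zclosed seesZ in_image u -> dom given u.
Proof.
case=> _ [[y' ->] vy]; exists (f' n (u.1, (y', u.2.2))); right; right.
exists (u.1, (y', u.2.2)); split=> //; split=> // m b hb.
by rewrite vy.
Qed.

Lemma total_span G : pmap E G -> subgraph given G ->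
  (forall n (u : base 3 Z X n), dom G u) ->
  exists F, [/\ span_ok a F, smap_comp F (emap Z e) = f & smap_comp F (zmap 3 g) = f'].
Proof.
move=> pG sG /(pmap_total pG)[F [FG FE]]; have hE := @evis_congr 3 seesZ seesX Z X.
exists F; split.
- split=> // n u hu; apply: (pm_fun pG) (FG _ _) _; apply: sG; left.
    by left; apply/first_graphP.
  by right; apply/last_graphP.
- apply: smap_ext => n w; apply: (pm_fun pG) (FG _ _) _; apply: sG; right; left.
  by exists w; split=> //; apply: (sc_refl hE).
- apply: smap_ext => n w; apply: (pm_fun pG) (FG _ _) _; apply: sG; right; right.
  by exists w; split=> //; apply: (sc_refl hE).
Qed.

Lemma fill_inner n (c : 'I_n.+2) (h : smap (horn c) A) : (0 < c < n.+1)%N ->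
  exists k : smap (std n.+1) A, smap_comp k (horn_incl c) = h.
Proof. by move=> hc; apply: hA. Qed.

(* A thin vertex over [Z] is filled in from its fat copy inserted below it,   *)
(* then one over [X] from its fat copy inserted above it.                     *)
Section Fat.
Hypothesis e0E : e ord0 = w0.
Hypothesis e1E : e ord_max = w3.

Let R1 n (t : std 3 n) := [/\ ~ has t w2, has t w1 & has t w3].
Let R2 n (t : std 3 n) := has t w2 /\ (has t w0 \/ has t w1).

Let R1_ext m n (s : std 3 m) (t : std 3 n) :
  (forall w, w <> w0 -> (exists i, s i = w) <-> (exists i, t i = w)) -> R1 s -> R1 t.
Proof.
by move=> h; rewrite /R1 (hasE h (w := w1)) // (hasE h (w := w2)) // (hasE h (w := w3)).
Qed.

Let R2_ext m n (s : std 3 m) (t : std 3 n) :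
  (forall w, w <> w3 -> (exists i, s i = w) <-> (exists i, t i = w)) -> R2 s -> R2 t.
Proof.
by move=> h; rewrite /R2 (hasE h (w := w1)) // (hasE h (w := w2)) // (hasE h (w := w0)).
Qed.

Let R1y : ref_cond w0 1 R1 seesZ 1.
Proof.
move=> _ /=; split=> // n t [_ [i hi] _]; exists i; rewrite hi; split=> // w /= h1 h2.
by rewrite /seesZ; lia.
Qed.
Let R1x : ref_cond w0 1 R1 seesX 2.
Proof.
move=> _ /=; split=> // [w|n t [_ _ [i hi]]]; first by rewrite /seesX; lia.
by exists i; rewrite hi; split=> // w /= h1 h2; rewrite /seesX; lia.
Qed.
Let R2y : ref_cond w3 3 R2 seesZ 2.
Proof.
move=> _ /=; split=> // [w|n t [_ h]]; first by rewrite /seesZ; lia.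
have [i hi] : exists i, (t i < 2)%N by case: h => -[i hi]; exists i; rewrite hi.
by exists i; split=> // w /= h1 h2; rewrite /seesZ; lia.
Qed.
Let R2x : ref_cond w3 3 R2 seesX 3.
Proof.
move=> _ /=; split=> // n t [[i hi] _]; exists i; rewrite hi; split=> // w /= h1 h2.
by rewrite /seesX; lia.
Qed.

(** The horn is outer only if [t] starts at type 1. The inserted vertex of type 0 then has the same
    coordinate in [Z] as the vertex after it, and over types 0 and 1 the map is [a] of that
    coordinate, so the first edge is degenerate. *)
Let fill1 G : pmap E G -> subgraph given G ->
  forall n (u : base 3 Z X n), R1 u.1 -> forall h : smap (horn (cut 1 u.1)) A,
  (forall m (b : horn (cut 1 u.1) m),
     G m (act (sval b) (insert seesZ seesX w0 (fun n => @cut 3 1 n)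
       (@ref_at 3 w0 1 1) (@ref_at 3 w0 1 2) u)) (h m b)) ->
  exists k : smap (std n.+1) A, smap_comp k (horn_incl (cut 1 u.1)) = h.
Proof.
move=> pG sG n [t [y x]] /= Rt h hG; set c := cut 1 t in h hG *.
have [n2 [i1 hi1] [i3 hi3]] := Rt.
have lt1 := cutE 1 t i1; rewrite hi1 /= in lt1.
case: (posnP c) => c0; last by apply: fill_inner; have := ltn_ord i1; move: lt1 c0;
    rewrite /c; lia.
have t0 : t ord0 = w1.
  have := cutE 1 t ord0; rewrite -/c c0 => h0.
  have := @op_le _ _ t ord0 i1 (leq0n _); rewrite hi1.
  by case: (type_cases (t ord0)) h0 => ->.
have ry := @stage_ref_ok 3 w0 1 R1 isT _ _ R1y.
pose s := ins_shape t c w0; pose q := ins_pull t c w0 seesZ (ref_at w0 1 1 t).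
have sc : s c = w0 by apply: stage_shape_pos.
have sf i : s (face _ c i) = t i by apply: stage_shape_face.
have qc : q c = ord0.
  rewrite /q (pull_pos ry) // /ref_at /= /first_above -/c c0 minn0.
  by apply: ord_inj; rewrite inordK.
have qf : q (face _ c ord0) = ord0 by apply: (pull_face ry Rt); rewrite t0.
have small (k : 'I_n.+2) : (k <= 1)%N -> k = c \/ k = face _ c ord0.
  move=> hk; case: (face_cases c k) => [->|[j ej]]; first by left.
  right; rewrite ej; congr (face _ c _); apply: ord_inj; move: hk.
  by rewrite ej faceE c0 /bump /=; lia.
apply: (special_horn_first hA (x0 := a 0 (act (op_vtx (ord0 : 'I_n.+1)) y))) => //.
  by apply: (@two_vertices _ t i1 i3); rewrite hi1 hi3.
move=> m b hb; move: (hG m b); set U : base 3 Z X m := (U in G m U _) => gU.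
have gU' : G m U (a m U.2.1).
  apply: sG; left; left; apply/first_graphP; split=> // i.
  change (s (sval b i) <= 1)%N.
  by case: (small _ (hb i)) => ->; rewrite ?sc // sf t0.
rewrite (pm_fun pG gU gU') -sfun_act act_comp /U /= act_comp.
congr (a _ (act _ y)); apply: op_ext => i /=; change (q (sval b i) = ord0).
by case: (small _ (hb i)) => ->.
Qed.

(** Dually, the horn is outer only if [t] ends at type 2; the last edge then goes to the copy of
    that vertex and is degenerate under [d]. *)
Let fill2 G : pmap E G -> subgraph given G ->
  forall n (u : base 3 Z X n), R2 u.1 -> forall h : smap (horn (cut 3 u.1)) A,
  (forall m (b : horn (cut 3 u.1) m),
     G m (act (sval b) (insert seesZ seesX w3 (fun n => @cut 3 3 n)
       (@ref_at 3 w3 3 2) (@ref_at 3 w3 3 3) u)) (h m b)) ->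
  exists k : smap (std n.+1) A, smap_comp k (horn_incl (cut 3 u.1)) = h.
Proof.
move=> pG sG n [t [y x]] /= Rt h hG; set c := cut 3 t in h hG *.
have [[i2 hi2] h01] := Rt.
have [i0 hi0] : exists i, (t i < 2)%N by case: h01 => -[i hi]; exists i; rewrite hi.
have lt2 := cutE 3 t i2; rewrite hi2 /= in lt2.
have lc := ltn_ord c.
have [cn|cn] := ltnP c n.+1.
  by apply: fill_inner; rewrite cn andbT; apply: leq_ltn_trans (_ : i2 < _)%N;
      rewrite ?lt2.
have cE : c = n.+1 :> nat by lia.
have tn : t ord_max = w2.
  have := cutE 3 t ord_max; rewrite -/c cE /= ltnSn => h0.
  have := @op_le _ _ t i2 ord_max (leq_ord i2); rewrite hi2.
  by case: (type_cases (t ord_max)) h0 => ->.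
have rx := @stage_ref_ok 3 w3 3 R2 isT _ _ R2x.
pose s := ins_shape t c w3; pose q := ins_pull t c w3 seesX (ref_at w3 3 3 t).
have sc : s c = w3 by apply: stage_shape_pos.
have sf i : s (face _ c i) = t i by apply: stage_shape_face.
have qc : q c = ord_max.
  rewrite /q (pull_pos rx) // /ref_at /= /last_below -/c cE.
  by apply: ord_inj; rewrite inordK.
have qf : q (face _ c ord_max) = ord_max by apply: (pull_face rx Rt); rewrite tn.
have big (k : 'I_n.+2) : (n <= k)%N -> k = c \/ k = face _ c ord_max.
  move=> hk; case: (face_cases c k) => [->|[j ej]]; first by left.
  right; rewrite ej; congr (face _ c _); apply: ord_inj; move: hk.
  by rewrite ej faceE cE /bump /=; have := ltn_ord j; lia.
apply: (special_horn_last hA (x0 := d 0 (act (op_vtx (ord_max : 'I_n.+1)) x))) => //.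
  by apply: (@two_vertices _ t i0 i2) => e'; move: hi0; rewrite e' hi2.
move=> m b hb; move: (hG m b); set U : base 3 Z X m := (U in G m U _) => gU.
have gU' : G m U (d m U.2.2).
  apply: sG; left; right; apply/last_graphP; split=> // i.
  change (1 < s (sval b i))%N.
  by case: (big _ (hb i)) => ->; rewrite ?sc // sf tn.
rewrite (pm_fun pG gU gU') -sfun_act act_comp /U /= act_comp.
congr (d _ (act _ x)); apply: op_ext => i /=; change (q (sval b i) = ord_max).
by case: (big _ (hb i)) => ->.
Qed.

Lemma extend_fat :
  exists F, [/\ span_ok a F, smap_comp F (emap Z e) = f & smap_comp F (zmap 3 g) = f'].
Proof.
have cases n (t : std 3 n) : ~ has t w2 -> ~ R1 t -> given_shape t.
  move=> n2 nR; have nt i := not_has (i := i) n2.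
  case: (EM (has t w1)) => [h1|n1].
    constructor 1 => i; case: (type_cases (t i)) (nt i) => e' //; rewrite ?e' // => _.
    by case: nR; split=> //; exists i.
  constructor 3 => i; rewrite e0E e1E; have := not_has (i := i) n1; have := nt i.
  by case: (type_cases (t i)) => ->; [left| | |right].
have hE := @evis_congr 3 seesZ seesX Z X.
have [t [_ [i1 hi1] [i3 hi3]]|n t m b u [n2 _ _] eu nR|n t [n2 [i1 hi1] [i3 hi3]] D|G1
    [pG1 sG1 RG1 bG1]] :=
  @stage_fill 3 seesZ seesX Z X A w0 1 R1 isT R1_ext 1 2 given_shape in_image given R1y
      R1x
    _ _ _ in_image_act given_pmap given_dom zclosed_dom given_shape_dom fill1.
- by move: hi1; rewrite (ord1 i1) -(ord1 i3) hi3.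
- apply: cases nR => -[i]; rewrite eu /=.
  case: (face_cases (cut 1 t) (b i)) => [->|[j ->]].
    by rewrite stage_shape_pos.
  by rewrite stage_shape_face // => e'; apply: n2; exists j.
- case: D => h; first by have := h i3; rewrite hi3.
    by have := h i1; rewrite hi1.
  by have := h i1; rewrite hi1 e0E e1E => -[].
have no2 n (u : base 3 Z X n) : ~ has u.1 w2 -> dom G1 u.
  move=> n2; case: (EM (R1 u.1)) => [/RG1//|/(cases _ _ n2)/given_shape_dom].
  exact: dom_sub.
(* All that lies outside [R2] is already defined: without type 2 by the previous stage, and with
   type 2 but neither 0 nor 1 by the end over [X]. *)
have [t [[i2 hi2] h01]|n t m b u Rt eu|n t Rt|n u|n u /zclosed_dom|n u nR|G pG sG n u
    Ru h|G2 [pG2 sG2 RG2 _]] :=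
  @stage_fill 3 seesZ seesX Z X A w3 3 R2 isT R2_ext 2 3 (fun n t => ~ R2 t) in_image
      G1 R2y R2x
    _ _ _ in_image_act pG1 _ _ _ _.
- case: h01 => -[i hi]; move: hi; by rewrite (ord1 i) -(ord1 i2) hi2.
- by [].
- by [].
- case/bG1 => [/given_dom[D|]|[m [t [b [[n2 _ _] eu]]]]];
    [left=> -[[i2 hi2] h01]|by right|].
    case: D => h; first by have := h i2; rewrite hi2.
      by case: h01 => -[i hi]; have := h i; rewrite hi.
    by have := h i2; rewrite hi2 e0E e1E => -[].
  left=> -[[i2]]; rewrite eu /=; case: (face_cases (cut 1 t) (b i2)) => [->|[j ->]].
    by rewrite stage_shape_pos.
  by rewrite stage_shape_face // => e'; case: n2; exists j.
- exact: dom_sub.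
- case: (EM (has u.1 w2)) => [h2|]; last exact: no2.
  apply: (dom_sub sG1); apply: given_shape_dom; constructor 2 => i.
  by case: (type_cases (u.1 i)) => e'; rewrite ?e' //; case: nR; split=> //;
      [left|right]; exists i.
- by apply: (fill2 pG) Ru h => k w x /sG1/sG.
apply: (total_span pG2) => [n u x /sG1/sG2//|n u].
case: (EM (R2 u.1)) => [/RG2//|nR]; apply: (dom_sub sG2).
case: (EM (has u.1 w2)) => [h2|]; last exact: no2.
apply: (dom_sub sG1); apply: given_shape_dom; constructor 2 => i.
by case: (type_cases (u.1 i)) => e'; rewrite ?e' //; case: nR; split=> //;
    [left|right]; exists i.
Qed.
End Fat.

Section Thin.
Hypothesis e0E : e ord0 = w1.
Hypothesis e1E : e ord_max = w2.

Let R1 n (t : std 3 n) := [/\ ~ has t w3, has t w0 & has t w2].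
Let R2 n (t : std 3 n) := has t w3 /\ (has t w0 \/ has t w1).

Let R1_ext m n (s : std 3 m) (t : std 3 n) :
  (forall w, w <> w1 -> (exists i, s i = w) <-> (exists i, t i = w)) -> R1 s -> R1 t.
Proof.
by move=> h; rewrite /R1 (hasE h (w := w0)) // (hasE h (w := w2)) // (hasE h (w := w3)).
Qed.

Let R2_ext m n (s : std 3 m) (t : std 3 n) :
  (forall w, w <> w2 -> (exists i, s i = w) <-> (exists i, t i = w)) -> R2 s -> R2 t.
Proof.
by move=> h; rewrite /R2 (hasE h (w := w1)) // (hasE h (w := w3)) // (hasE h (w := w0)).
Qed.

Let R1y : ref_cond w1 1 R1 seesZ 1.
Proof.
move=> _ /=; split=> // n t [_ [i hi] _]; exists i; rewrite hi; split=> // w /= h1 h2.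
by rewrite /seesZ; lia.
Qed.
Let R1x : ref_cond w1 1 R1 seesX 0.
Proof. by []. Qed.
Let R2y : ref_cond w2 3 R2 seesZ 0.
Proof. by []. Qed.
Let R2x : ref_cond w2 3 R2 seesX 3.
Proof.
move=> _ /=; split=> // n t [[i hi] _]; exists i; rewrite hi; split=> // w /= h1 h2.
by rewrite /seesX; lia.
Qed.

(** A fat vertex over [Z] is filled in from its thin copy inserted above it, then one over [X] from
    its thin copy inserted below it. Both regions demand a vertex on each side of the cut, so all
    horns are inner and no degenerate edge is required. *)
Lemma extend_thin :
  exists F, [/\ span_ok a F, smap_comp F (emap Z e) = f & smap_comp F (zmap 3 g) = f'].
Proof.
have cases n (t : std 3 n) : ~ has t w3 -> ~ R1 t -> given_shape t.
  move=> n3 nR; have nt i := not_has (i := i) n3.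
  case: (EM (has t w2)) => [h2|n2].
    constructor 3 => i; rewrite e0E e1E; case: (type_cases (t i)) (nt i) => e' //;
        rewrite ?e' // => _.
    - by case: nR; split=> //; exists i.
    - by left.
    - by right.
  constructor 1 => i; have := not_has (i := i) n2; have := nt i.
  by case: (type_cases (t i)) => ->.
have [t [_ [i0 hi0] [i2 hi2]]|n t m b u [n3 _ _] eu nR|n t [n3 [i0 hi0] [i2 hi2]] D|
    G pG sG n u Ru h _|G1 [pG1 sG1 RG1 bG1]] :=
  @stage_fill 3 seesZ seesX Z X A w1 1 R1 isT R1_ext 1 0 given_shape in_image given R1y
      R1x
    _ _ _ in_image_act given_pmap given_dom zclosed_dom given_shape_dom _.
- by move: hi0; rewrite (ord1 i0) -(ord1 i2) hi2.
- apply: cases nR => -[i]; rewrite eu /=.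
  case: (face_cases (cut 1 t) (b i)) => [->|[j ->]].
    by rewrite stage_shape_pos.
  by rewrite stage_shape_face // => e'; apply: n3; exists j.
- case: D => h; first by have := h i2; rewrite hi2.
    by have := h i0; rewrite hi0.
  by have := h i0; rewrite hi0 e0E e1E => -[].
- have [_ [i0 hi0] [i2 hi2]] := Ru.
  by apply/fill_inner/(@cut_inner _ _ _ _ i0 i2); rewrite ?hi0 ?hi2.
have no3 n (u : base 3 Z X n) : ~ has u.1 w3 -> dom G1 u.
  move=> n3; case: (EM (R1 u.1)) => [/RG1//|/(cases _ _ n3)/given_shape_dom].
  exact: dom_sub.
have [t [[i3 hi3] h01]|n t m b u Rt eu|n t Rt|n u|n u /zclosed_dom|n u nR|G pG sG n u
    Ru h _|G2 [pG2 sG2 RG2 _]] :=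
  @stage_fill 3 seesZ seesX Z X A w2 3 R2 isT R2_ext 0 3 (fun n t => ~ R2 t) in_image
      G1 R2y R2x
    _ _ _ in_image_act pG1 _ _ _ _.
- case: h01 => -[i hi]; move: hi; by rewrite (ord1 i) -(ord1 i3) hi3.
- by [].
- by [].
- case/bG1 => [/given_dom[D|]|[m [t [b [[n3 _ _] eu]]]]];
    [left=> -[[i3 hi3] h01]|by right|].
    case: D => h; first by have := h i3; rewrite hi3.
      by case: h01 => -[i hi]; have := h i; rewrite hi.
    by have := h i3; rewrite hi3 e0E e1E => -[].
  left=> -[[i3]]; rewrite eu /=; case: (face_cases (cut 1 t) (b i3)) => [->|[j ->]].
    by rewrite stage_shape_pos.
  by rewrite stage_shape_face // => e'; case: n3; exists j.
- exact: dom_sub.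
- case: (EM (has u.1 w3)) => [h3|]; last exact: no3.
  apply: (dom_sub sG1); apply: given_shape_dom; constructor 2 => i.
  by case: (type_cases (u.1 i)) => e'; rewrite ?e' //; case: nR; split=> //;
      [left|right]; exists i.
- have [[i3 hi3] h01] := Ru.
  by case: h01 => -[i hi]; apply/fill_inner/(@cut_inner _ _ _ _ i i3); rewrite ?hi ?hi3.
apply: (total_span pG2) => [n u x /sG1/sG2//|n u].
case: (EM (R2 u.1)) => [/RG2//|nR]; apply: (dom_sub sG2).
case: (EM (has u.1 w3)) => [h3|]; last exact: no3.
apply: (dom_sub sG1); apply: given_shape_dom; constructor 2 => i.
by case: (type_cases (u.1 i)) => e'; rewrite ?e' //; case: nR; split=> //;
    [left|right]; exists i.
Qed.
End Thin.
End Extend.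
End Spans.

(** * Maps to the slice *)

Lemma lo_in_homo m n (a : op m n) k : {homo (@lo_in m n a k) : i j / (i <= j)%N}.
Proof. by []. Qed.
Definition lo_incl m n (a : op m n) k : op (lo_size a k) m := mk_op (@lo_in_homo m n a k).

Lemma hi_in_homo m n (a : op m n) k : {homo (@hi_in m n a k) : i j / (i <= j)%N}.
Proof. by move=> i j le_ij; rewrite /= leq_add2l. Qed.
Definition hi_incl m n (a : op m n) k : op (hi_size a k) m := mk_op (@hi_in_homo m n a k).

Lemma aug_vis (Y : sset) k n (b : op k n.+1) (y y' : Y n) :
  (forall m (c : op m.+1 n.+1), (forall i, exists j, c i = b j) -> act c y = act c y') ->
  aug_act b (y : aug Y n.+1) = aug_act b (y' : aug Y n.+1).
Proof. by case: k b => // k b h; apply: h => i; exists i. Qed.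

Lemma aug_vis_inv (Y : sset) k n (b : op k n.+1) (y y' : Y n) :
  aug_act b (y : aug Y n.+1) = aug_act b (y' : aug Y n.+1) ->
  forall m (c : op m.+1 n.+1) (c' : op m.+1 k), c = op_comp b c' -> act c y = act c y'.
Proof.
move=> e m c c' ->; have h (z : Y n) : act (op_comp b c') z = aug_act c' (aug_act b (z
    : aug Y n.+1)).
  by rewrite aug_act_comp.
by rewrite !h e.
Qed.

Lemma JoinSimp_inj (Y X : sset) n k l (e e' : k + l = n.+1) (y y' : aug Y k) (x x' :
    aug X l) :
  @JoinSimp Y X n k l e y x = JoinSimp e' y' x' -> y = y' /\ x = x'.
Proof.
move=> h; pose P (w : join_simp Y X n) :=
  forall (ek : jk w = k) (el : jl w = l),
    ecast i (aug Y i) ek (jy w) = y /\ ecast i (aug X i) el (jx w) = x.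
have : P (JoinSimp e y x).
  by move=> /= ek el; rewrite (eq_axiomK ek) (eq_axiomK el).
by rewrite h => /(_ erefl erefl) /= [-> ->].
Qed.

Section Collapse.
Variables (Y X : sset).

(** The comparison from the fat join to Joyal's join: the first coordinate cuts the simplex in two,
    and each part keeps one coordinate. By [collapse_E] and [collapse_inj] its fibres are exactly
    the classes of the thin relation. *)
Definition collapse_fun n (u : base 1 Y X n) : join Y X n :=
  JoinSimp (lo_hi_size (u.1 : op _ _) 1)
    (aug_act (lo_incl u.1 1) (u.2.1 : aug Y n.+1))
    (aug_act (hi_incl u.1 1) (u.2.2 : aug X n.+1)).

Lemma collapse_subproof m n (a : op m.+1 n.+1) (u : base 1 Y X n) :
  collapse_fun (act a u) = act a (collapse_fun u).
Proof.
case: u => s [y x].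
have ek : lo_size (op_comp s a) 1 = lo_size a (lo_size s 1).
  by apply: eq_card => i; rewrite !inE -lo_sizeP.
have el : hi_size (op_comp s a) 1 = hi_size a (lo_size s 1).
  by apply: eq_card => i; rewrite !inE leqNgt (lo_sizeP s 1) -leqNgt.
apply: (@join_simp_ext Y X m (collapse_fun (act a ((s, (y, x)) : base 1 Y X n)))
    (join_act a (collapse_fun (s, (y, x)))) ek el).
  rewrite /= -[act a y]/(aug_act a (y : aug Y n.+1)) !aug_act_comp.
  congr aug_act; apply: op_ext => i; apply: val_inj => /=.
  by congr (val (a _)); apply: val_inj.
rewrite /= -[act a x]/(aug_act a (x : aug X n.+1)) !aug_act_comp.
congr aug_act; apply: op_ext => i; apply: val_inj => /=.
rewrite subnKC; last by rewrite leqNgt lo_sizeP -leqNgt leq_addr.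
by congr (val (a _)); apply: val_inj; rewrite /= ek.
Qed.
Definition collapse : smap (base 1 Y X) (join Y X) := SMap collapse_subproof.

Lemma seesZ_thin n (s : std 1 n) i : seesZ (thin (s i)) = (s i < 1)%N.
Proof. by rewrite /seesZ thinE; have := ltn_ord (s i); lia. Qed.
Lemma seesX_thin n (s : std 1 n) i : seesX (thin (s i)) = (0 < s i)%N.
Proof. by rewrite /seesX thinE; have := ltn_ord (s i); lia. Qed.

Let Eth n (u u' : base 1 Y X n) :=
  evis seesZ seesX (emap X Y thin n u) (emap X Y thin n u').

Lemma collapse_E n (u u' : base 1 Y X n) : Eth u u' -> collapse n u = collapse n u'.
Proof.
case: u u' => s [y x] [s' [y' x']] [/= es vy vx].
have {es} e : s = s'.
  apply: op_val_ext => i; have := congr1 (fun f : op _ _ => nat_of_ord (f i)) es.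
  by rewrite /= !thinE => -[].
subst s'; congr JoinSimp => /=; apply: aug_vis => m c hc.
  by apply: vy => i; have [j ->] := hc i; rewrite seesZ_thin (lo_sizeP s 1) /=.
apply: vx => i; have [j ->] := hc i; rewrite seesX_thin ltnNge -ltnS (lo_sizeP s 1) /=.
by rewrite -leqNgt leq_addr.
Qed.

Lemma lo_size_inj n (s s' : std 1 n) : lo_size s 1 = lo_size s' 1 -> s = s'.
Proof.
move=> e; apply: op_val_ext => i.
have : (s i < 1)%N = (s' i < 1)%N by rewrite !lo_sizeP e.
by have := ltn_ord (s i); have := ltn_ord (s' i); lia.
Qed.

Lemma collapse_inj n (u u' : base 1 Y X n) : collapse n u = collapse n u' -> Eth u u'.
Proof.
case: u u' => s [y x] [s' [y' x']] h.
have e : s = s' by apply: lo_size_inj; apply: (congr1 (@jk Y X n) h).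
subst s'; have [hy hx] := JoinSimp_inj h; split=> //= m c hc.
  have hlo i : (c i < lo_size s 1)%N.
    by have := hc i; rewrite -[op_comp thin s (c i)]/(thin (s (c i))) seesZ_thin
        -lo_sizeP.
  have hm : {homo (fun i => Ordinal (hlo i)) : i j / (i <= j)%N} by move=> i j le;
      exact: (op_le c le).
  by apply: (aug_vis_inv hy (c' := mk_op hm)); apply: op_ext => i; apply: val_inj.
have hhi i : (lo_size s 1 <= c i)%N.
  have := hc i; rewrite -[op_comp thin s (c i)]/(thin (s (c i))) seesX_thin.
  by rewrite ltnNge -ltnS (lo_sizeP s 1) -leqNgt.
have hlt i : (c i - lo_size s 1 < hi_size s 1)%N.
  by have := hhi i; have := ltn_ord (c i); have := lo_hi_size s 1; lia.
have hm : {homo (fun i => Ordinal (hlt i)) : i j / (i <= j)%N}.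
  by move=> i j /(op_le c) le; apply: leq_sub2r.
apply: (aug_vis_inv hx (c' := mk_op hm)); apply: op_ext => i; apply: val_inj => /=.
by rewrite subnKC.
Qed.

Lemma collapse_first n (u : base 1 Y X n) : (forall i, u.1 i = ord0) ->
  collapse n u = join_inl Y X n u.2.1.
Proof.
case: u => s [y x] /= h.
have ek : lo_size s 1 = n.+1.
  by rewrite /lo_size -[RHS]card_ord; apply: eq_card => i; rewrite !inE h.
have el : hi_size s 1 = 0 by apply/eqP;
    rewrite -(eqn_add2l (lo_size s 1)) lo_hi_size ek addn0.
apply: (@join_simp_ext Y X n (collapse_fun ((s, (y, x)) : base 1 Y X n)) (join_inl_fun
    X y) ek el).
  change (aug_act (lo_incl s 1) (y : aug Y n.+1) = aug_act (op_cast ek) (y : aug Y n.+1)).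
  by congr aug_act; apply: op_ext => i; apply: val_inj.
rewrite /=; move: (hi_incl s 1) (op_cast el); rewrite el => b c.
by case: (aug_act b _); case: (aug_act c _).
Qed.

Lemma collapse_last n (u : base 1 Y X n) : (forall i, u.1 i = ord_max) ->
  collapse n u = join_inr Y X n u.2.2.
Proof.
case: u => s [y x] /= h.
have ek : lo_size s 1 = 0 by rewrite /lo_size eq_card0 // => i; rewrite !inE h.
have el : hi_size s 1 = n.+1 by rewrite -[RHS](lo_hi_size s 1) ek.
apply: (@join_simp_ext Y X n (collapse_fun ((s, (y, x)) : base 1 Y X n)) (join_inr_fun
    Y x) ek el).
  rewrite /=; move: (lo_incl s 1) (op_cast ek); rewrite ek => b c.
  by case: (aug_act b _); case: (aug_act c _).
change (aug_act (hi_incl s 1) (x : aug X n.+1) = aug_act (op_cast el) (x : aug X n.+1)).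
by congr aug_act; apply: op_ext => i; apply: val_inj; rewrite /= ek.
Qed.

(** The ends are listed separately since [collapse] misses simplices of [Y] when [X] is empty, and
    conversely. In the mixed case degeneracies extend each component to the full dimension. *)
Lemma join_cases n (w : join Y X n) :
  [\/ exists u, w = collapse n u, exists y, w = join_inl Y X n y |
      exists x, w = join_inr Y X n x].
Proof.
case: w => [[|k] [|l] e y x] //.
- constructor 3; have e' : l = n by have := e; rewrite add0n => -[].
  subst l.
  by exists x; case: y; congr JoinSimp; apply: Prop_irrelevance.
- constructor 2; have e' : k = n by have := e; rewrite addn0 => -[].
  subst k.
  by exists y; case: x; congr JoinSimp; apply: Prop_irrelevance.
constructor 1.
pose s : std 1 n := clamp n.+1 1 (fun i => (k < i)%N).
have sE i : s i = (k < i)%N :> nat by apply: clampE => [j|]; lia.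
pose rk : op n.+1 k.+1 := clamp n.+1 k (minn k).
have rkE i : rk i = minn k i :> nat by apply: clampE => [j|]; lia.
pose rl : op n.+1 l.+1 := clamp n.+1 l (fun i => i - k.+1)%N.
have rlE i : rl i = (i - k.+1)%N :> nat.
  by apply: clampE => [j|]; have := ltn_ord i; lia.
have ek : lo_size s 1 = k.+1.
  rewrite -cut_val; apply: cut_unique => [|i]; first by lia.
  by rewrite sE; case: (ltnP k i) => h; lia.
have el : hi_size s 1 = l.+1 by apply/eqP; rewrite -(eqn_add2l k.+1) -{1}ek lo_hi_size e.
exists (s, (act rk y, act rl x)); apply/esym.
apply: (@join_simp_ext Y X n (collapse_fun ((s, (act rk y, act rl x)) : base 1 Y X n))
    (JoinSimp e y x) ek el).
  change (aug_act (lo_incl s 1) (aug_act rk (y : aug Y k.+1)) = aug_act (op_cast ek) (y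
      : aug Y k.+1)).
  rewrite aug_act_comp; congr aug_act; apply: op_val_ext => i /=.
  by rewrite [LHS]rkE /=; have := ltn_ord i; rewrite [X in (_ < X)%N]ek; lia.
change (aug_act (hi_incl s 1) (aug_act rl (x : aug X l.+1)) = aug_act (op_cast el) (x :
    aug X l.+1)).
rewrite aug_act_comp; congr aug_act; apply: op_val_ext => i /=.
by rewrite [LHS]rlE /= ek addKn.
Qed.
End Collapse.

Lemma collapse_map Y Y' X X' (g : smap Y Y') (h : smap X X') n (u : base 1 Y X n) :
  join_map g h n (collapse Y X n u) = collapse Y' X' n (u.1, (g n u.2.1, h n u.2.2)).
Proof.
congr JoinSimp; first exact: (@aug_map_act Y Y' g _ n.+1).
exact: (@aug_map_act X X' h _ n.+1).
Qed.

Section SliceMaps.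
Variables (A X : sset) (d : smap X A).

Lemma slice_act_eval m n (a : op m.+1 n.+1) (c : slice d n) k (w : join (std m) X k) :
  sval (act a c) k w = sval c k (join_map (std_map a) (smap_id X) k w).
Proof. by []. Qed.

Section ThinPart.
Variables (Z : sset) (u : smap Z (slice d)).

(** The adjoint map out of the join, read off at the universal simplex of [std n]; [slice_eval]
    recovers all other values by naturality. *)
Definition thin_fun n (w : base 1 Z X n) : A n :=
  sval (u n w.2.1) n (collapse (std n) X n (w.1, (op_id n.+1, w.2.2))).

Lemma slice_eval n (z : Z n) m (v : base 1 (std n) X m) :
  sval (u n z) m (collapse _ _ m v) = thin_fun (v.1, (act (v.2.1 : op _ _) z, v.2.2)).
Proof.
case: v => s [y x]; rewrite /thin_fun /= sfun_act slice_act_eval collapse_map /=.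
by have -> : op_comp y (op_id m.+1) = y by apply: op_ext.
Qed.

Lemma thin_subproof m n (a : op m.+1 n.+1) (w : base 1 Z X n) :
  thin_fun (act a w) = act a (thin_fun w).
Proof.
case: w => s [z x]; rewrite {2}/thin_fun -sfun_act -(sfun_act (collapse (std n) X))
    slice_eval /=.
by have -> : op_comp (op_id n.+1) a = a by apply: op_ext.
Qed.
Definition thin_part : smap (base 1 Z X) A := SMap thin_subproof.

Lemma slice_first n (z : Z n) m (y : std n m) :
  sval (u n z) m (join_inl (std n) X m y) = slice_proj d m (u m (act (y : op _ _) z)).
Proof.
rewrite sfun_act /= /slice_proj_fun slice_act_eval; congr (sfun _ _).
by congr JoinSimp; apply: op_ext.
Qed.

Lemma slice_last n (c : slice d n) m (x : X m) :
  sval c m (join_inr (std n) X m x) = d m x.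
Proof. by rewrite -[in RHS](svalP c). Qed.

Lemma thin_part_ok : side_ok d thin (smap_comp (slice_proj d) u) thin_part.
Proof.
have first n (w : base 1 Z X n) : (forall i, w.1 i = ord0) ->
    thin_part n w = smap_comp (slice_proj d) u n w.2.1.
  by move=> h; rewrite /= /thin_fun collapse_first // slice_first act_id.
have last n (w : base 1 Z X n) : (forall i, w.1 i = ord_max) -> thin_part n w = d n w.2.2.
  by move=> h; rewrite /= /thin_fun collapse_last // slice_last.
split=> // n [s [z x]] [s' [z' x']] e.
have es : s = s'.
  case: e => /= es _ _; apply: op_val_ext => i.
  have := congr1 (fun f : op _ _ => nat_of_ord (f i)) es.
  by rewrite /= !thinE => -[].
subst s'; have [h|nh] := EM (exists i, s i = ord0); last first.
  have s1 i : s i = ord_max by case: (ord2_cases (s i)) => // e'; case: nh; exists i.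
  rewrite !last //; case: e => /= _ _ vx; congr (d _ _); apply: vis_total vx => i.
  by rewrite [X in seesX X]/(thin (s i)) seesX_thin s1.
(* [r] retracts onto the vertices over [Z], so [act r z] retains just the visible part of [z]. The
   value of the map depends only on it ([key]). *)
pose r : op n.+1 n.+1 := clamp n.+1 n (minn (lo_size s 1).-1).
have [i0 hi0] := h.
have lo0 : (0 < lo_size s 1)%N.
  by apply: leq_ltn_trans (leq0n i0) _; rewrite -lo_sizeP hi0.
have rE i : r i = minn (lo_size s 1).-1 i :> nat.
  by apply: clampE => [j|]; have := ltn_ord i; lia.
have rs i : s (r i) = ord0.
  have : (s (r i) < 1)%N by rewrite lo_sizeP rE; lia.
  by case: (s (r i)) => -[|//] ? _; apply: ord_inj.
have ez : act r z = act r z'.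
  by case: e => /= _ vy _; apply: vy => i;
      rewrite [X in seesZ X]/(thin (s (r i))) seesZ_thin rs.
have key z0 x0 : thin_fun (s, (z0, x0)) = sval (u n (act r z0)) n (collapse (std n) X n
    (s, (op_id n.+1, x0))).
  rewrite sfun_act slice_act_eval collapse_map /thin_fun; congr (sfun _ _).
  apply: collapse_E; split=> //= m b hb.
  apply: op_val_ext => i /=; rewrite [RHS]rE.
  have := hb i; rewrite [X in seesZ X]/(thin (s (b i))) seesZ_thin lo_sizeP => lt.
  by apply/esym/minn_idPr; rewrite -ltnS prednK.
rewrite [LHS]key [RHS]key ez; congr (sfun _ _); apply: collapse_E.
by case: e => /= _ _ vx; split.
Qed.
End ThinPart.

Lemma slice_map_ext Z (u u' : smap Z (slice d)) :
  smap_comp (slice_proj d) u = smap_comp (slice_proj d) u' -> thin_part u = thin_part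
      u' -> u = u'.
Proof.
move=> ep et; apply: smap_ext => n z.
suff e : sval (u n z) = sval (u' n z).
  by case: (u n z) (u' n z) e => c hc [c' hc'] /= e; apply: eq_exist.
apply: smap_ext => m w; case: (join_cases w) => -[v ->].
- rewrite !slice_eval; exact: (congr1 (fun k : smap (base 1 Z X) A => k m _) et).
- rewrite !slice_first; exact: (congr1 (fun k : smap Z A => k m _) ep).
- by rewrite !slice_last.
Qed.

Lemma thin_part_comp Z Z' (u : smap Z (slice d)) (g : smap Z' Z) :
  thin_part (smap_comp u g) = smap_comp (thin_part u) (zmap X 1 g).
Proof. exact: smap_ext. Qed.

Section Realize.
Variables (Z : sset) (a : smap Z A) (f : smap (base 1 Z X) A).
Hypothesis f_ok : side_ok d thin a f.

(** The map out of the join given by [f], with [a] and [d] added on the ends that [collapse] may not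
    reach. It is single-valued because [f] is constant on the fibres of [collapse]. *)
Let jgraph n (z : Z n) : graph (join (std n) X) A := fun m w x =>
  [\/ exists v, w = collapse _ _ m v /\ x = f m (v.1, (act (v.2.1 : op _ _) z, v.2.2)),
      exists y, w = join_inl _ _ m y /\ x = a m (act (y : op _ _) z) |
      exists y, w = join_inr _ _ m y /\ x = d m y].

Let collapse_inl Y n (v : base 1 Y X n) y : collapse Y X n v = join_inl Y X n y ->
  (forall i, v.1 i = ord0) /\ v.2.1 = y.
Proof.
move=> e; have h i : v.1 i = ord0.
  have : (v.1 i < 1)%N by rewrite lo_sizeP (congr1 (@jk Y X n) e : lo_size v.1 1 = n.+1).
  by case: (v.1 i) => -[|//] ? _; apply: ord_inj.
split=> //; move: e; rewrite collapse_first // => e.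
by case: (JoinSimp_inj e).
Qed.

Let collapse_inr Y n (v : base 1 Y X n) x : collapse Y X n v = join_inr Y X n x ->
  (forall i, v.1 i = ord_max) /\ v.2.2 = x.
Proof.
move=> e; have h i : v.1 i = ord_max.
  have : (v.1 i < 1)%N = false by rewrite lo_sizeP (congr1 (@jk Y X n) e : lo_size v.1
      1 = 0).
  by case: (ord2_cases (v.1 i)) => ->.
split=> //; move: e; rewrite collapse_last // => e.
by case: (JoinSimp_inj e).
Qed.

Let jgraph_pmap n (z : Z n) : pmap (fun m => @eq (join (std n) X m)) (jgraph z).
Proof.
have c12 m (v : base 1 (std n) X m) y : collapse _ _ m v = join_inl _ _ m y ->
    f m (v.1, (act (v.2.1 : op _ _) z, v.2.2)) = a m (act (y : op _ _) z).
  by move=> /collapse_inl[h <-]; apply: (side_first f_ok).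
have c13 m (v : base 1 (std n) X m) y : collapse _ _ m v = join_inr _ _ m y ->
    f m (v.1, (act (v.2.1 : op _ _) z, v.2.2)) = d m y.
  by move=> /collapse_inr[h <-]; apply: (side_last f_ok).
have c23 m y x : join_inl (std n) X m y = join_inr (std n) X m x -> False.
  by move=> /(congr1 (@jk _ _ _)).
split.
- move=> m w x x' [[v [ev ->]]|[v [ev ->]]|[v [ev ->]]] [[v' [ev' ->]]|[v' [ev'
    ->]]|[v' [ev' ->]]];
    rewrite ev in ev'.
  + apply: (side_E f_ok); have [/= es vy vx] := collapse_inj ev'; split=> //= k b hb.
    by rewrite !act_comp; congr (act _ z); apply: vy.
  + exact: c12.
  + exact: c13.
  + by apply/esym/c12/esym.
  + by case: (JoinSimp_inj ev') => ->.
  + by case: (c23 _ _ _ ev').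
  + by apply/esym/c13/esym.
  + by case: (c23 _ _ _ (esym ev')).
  + by case: (JoinSimp_inj ev') => _ ->.
- move=> m k b w x [[v [-> ->]]|[v [-> ->]]|[v [-> ->]]].
  + by constructor 1; exists (act b v); rewrite -!sfun_act /= act_comp.
  + by constructor 2; exists (act b v); rewrite -!sfun_act /= act_comp.
  + by constructor 3; exists (act b v); rewrite !sfun_act.
- by move=> m w _ x <-.
Qed.

Lemma realize_slice : exists u : smap Z (slice d),
  smap_comp (slice_proj d) u = a /\ thin_part u = f.
Proof.
have tot n (z : Z n) m (w : join (std n) X m) : dom (jgraph z) w.
  case: (join_cases w) => -[v ->].
  - by exists (f m (v.1, (act (v.2.1 : op _ _) z, v.2.2))); constructor 1; exists v.
  - by exists (a m (act (v : op _ _) z)); constructor 2; exists v.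
  - by exists (d m v); constructor 3; exists v.
have ex n (z : Z n) : {k : smap (join (std n) X) A | forall m w, jgraph z w (k m w)}.
  by apply: boolp.cid; have [k [hk _]] := pmap_total (jgraph_pmap z) (@tot n z); exists k.
have hd n (z : Z n) : smap_comp (sval (ex n z)) (join_inr (std n) X) = d.
  apply: smap_ext => m x; apply: (pm_fun (jgraph_pmap z)) (svalP (ex n z) _ _) _.
  by constructor 3; exists x.
have nat m n (b : op m.+1 n.+1) (z : Z n) :
    exist _ (sval (ex m (act b z))) (hd m (act b z)) =
    act b (exist _ (sval (ex n z)) (hd n z) : slice d n).
  apply: eq_exist; apply: smap_ext => k w /=.
  apply: (pm_fun (jgraph_pmap z)) _ (svalP (ex n z) _ _).
  case: (svalP (ex m (act b z)) k w) => -[v [-> ->]].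
  - constructor 1; exists (v.1, (op_comp b v.2.1, v.2.2)); rewrite act_comp; split=> //.
    exact: collapse_map.
  - by constructor 2; exists (op_comp b v); rewrite act_comp.
  - by constructor 3; exists v.
exists (@SMap Z (slice d) (fun n z => exist _ (sval (ex n z)) (hd n z)) nat); split.
- apply: smap_ext => n z /=; apply: (pm_fun (jgraph_pmap z)) (svalP (ex n z) _ _) _.
  by constructor 2; exists (op_id _); rewrite act_id.
- apply: smap_ext => n [s [z x]]; apply: (pm_fun (jgraph_pmap z)) (svalP (ex n z) _ _) _.
  by constructor 1; exists (s, (op_id _, x)); rewrite act_id.
Qed.
End Realize.
End SliceMaps.

(** * Maps to the comma *)

Lemma op_idl m n (a : op m n) : op_comp (op_id n) a = a.
Proof. exact: op_ext. Qed.
Lemma op_idr m n (a : op m n) : op_comp a (op_id m) = a.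
Proof. exact: op_ext. Qed.
Lemma op_compA k l m n (a : op k l) (b : op l m) (c : op m n) :
  op_comp (op_comp c b) a = op_comp c (op_comp b a).
Proof. exact: op_ext. Qed.

Lemma sees_fat (i : 'I_2) : seesZ (fat i) /\ seesX (fat i).
Proof. by rewrite /seesZ /seesX fatE; case: (ord2_cases i) => ->. Qed.

Section CommaMaps.
Variables (A X : sset) (d : smap X A).

Definition comma_square n (c : comma d n) : smap (sprod (std n) (std 1)) (ihom X A) :=
  (sval c).1.

Section FatPart.
Variables (Z : sset) (v : smap Z (comma d)).

Definition fat_fun n (w : base 1 Z X n) : A n :=
  comma_square (v n w.2.1) n (op_id n.+1, w.1) n (op_id n.+1, w.2.2).

(** Naturality reduces every value of the square attached to [z] to a value at an identity operator,
    so the square is determined by the fat part. *)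
Lemma comma_eval n (z : Z n) m (b : std n m) (s : std 1 m) k (c : std m k) (x : X k) :
  comma_square (v n z) m (b, s) k (c, x) =
  fat_fun (op_comp s c, (act (op_comp b c : op _ _) z, x)).
Proof.
rewrite /fat_fun /= sfun_act /comma_square /= !op_idr.
have := congr1 (fun F : ihom X A k => F k (op_id k.+1, x))
  (sfun_act (sval (v n z)).1 (c : op k.+1 m.+1) (b, s)).
by rewrite /= op_idr => ->.
Qed.

Lemma fat_subproof m n (b : op m.+1 n.+1) (w : base 1 Z X n) :
  fat_fun (act b w) = act b (fat_fun w).
Proof.
case: w => s [z x]; rewrite {2}/fat_fun -sfun_act comma_eval /=.
by rewrite !op_idl.
Qed.
Definition fat_part : smap (base 1 Z X) A := SMap fat_subproof.

Lemma fat_part_ok : side_ok d fat (smap_comp (comma_proj d) v) fat_part.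
Proof.
split.
- move=> n [s [z x]] [s' [z' x']] [/= es vy vx].
  have {es} e : s = s'.
    apply: op_val_ext => i; have := congr1 (fun f : op _ _ => nat_of_ord (f i)) es.
    by rewrite /= !fatE; lia.
  subst s'; congr (fat_fun (_, (_, _))).
    by apply: vis_total vy => i; apply: (sees_fat (s i)).1.
  by apply: vis_total vx => i; apply: (sees_fat (s i)).2.
- move=> n [s [z x]] /= h; rewrite /fat_fun /comma_square /=.
  case: (v n z) => -[W [t0 a]] /= /(congr1 snd) /= e.
  have -> : s = act (op_const n.+1) (op_vtx (ord0 : 'I_2) : std 1 0).
    by apply: op_ext => i; rewrite h.
  have := congr1 (fun F : ihom X A n => F n (op_id n.+1, x)) e.
  by rewrite /= act_id.
- move=> n [s [z x]] /= h; rewrite /fat_fun /comma_square /=.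
  case: (v n z) => -[W [t0 a]] /= /(congr1 fst) /= e.
  have -> : s = act (op_const n.+1) (op_vtx (ord_max : 'I_2) : std 1 0).
    by apply: op_ext => i; rewrite h.
  exact: (congr1 (fun F : ihom X A n => F n (op_id n.+1, x)) e).
Qed.
End FatPart.

Lemma comma_map_ext Z (v v' : smap Z (comma d)) :
  smap_comp (comma_proj d) v = smap_comp (comma_proj d) v' -> fat_part v = fat_part v'
      -> v = v'.
Proof.
move=> ep ef; apply: smap_ext => n z.
have ew : comma_square (v n z) = comma_square (v' n z).
  apply: smap_ext => m [b s]; apply: smap_ext => k [c x]; rewrite !comma_eval.
  exact: (congr1 (fun K : smap (base 1 Z X) A => K k _) ef).
have ea := congr1 (fun K : smap Z A => K n z) ep.
move: ew ea; rewrite /comma_square /=.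
case: (v n z) (v' n z) => -[W [t0 a]] h [[W' [t0' a']] h'] /= ew ea.
apply: eq_exist; rewrite ew ea; congr (_, (_, _)).
by apply: op_ext => i; rewrite [LHS]ord1 [RHS]ord1.
Qed.

Lemma fat_part_comp Z Z' (v : smap Z (comma d)) (g : smap Z' Z) :
  fat_part (smap_comp v g) = smap_comp (fat_part v) (zmap X 1 g).
Proof. exact: smap_ext. Qed.

Section Realize.
Variables (Z : sset) (a : smap Z A) (f : smap (base 1 Z X) A).
Hypothesis f_ok : side_ok d fat a f.

Lemma square1_subproof n (z : Z n) m (p : sprod (std n) (std 1) m) k l
    (t : op k.+1 l.+1) (q : sprod (std m) X l) :
  f k (op_comp p.2 (act t q).1, (act (op_comp p.1 (act t q).1 : op _ _) z, (act t q).2)) =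
  act t (f l (op_comp p.2 q.1, (act (op_comp p.1 q.1 : op _ _) z, q.2))).
Proof. by rewrite -sfun_act /= act_comp !op_compA. Qed.
Definition square1 n (z : Z n) m (p : sprod (std n) (std 1) m) : ihom X A m :=
  @SMap (sprod (std m) X) A
    (fun k q => f k (op_comp p.2 q.1, (act (op_comp p.1 q.1 : op _ _) z, q.2)))
    (square1_subproof z p).

Lemma square_subproof n (z : Z n) l m (t : op l.+1 m.+1) (p : sprod (std n) (std 1) m) :
  square1 z (act t p) = act t (square1 z p).
Proof. by apply: smap_ext => k [c x] /=; rewrite !op_compA. Qed.
Definition square n (z : Z n) : smap (sprod (std n) (std 1)) (ihom X A) :=
  SMap (square_subproof z).

Lemma square_pb n (z : Z n) :
  (arrow_cod (ihom X A) n (square z), arrow_dom (ihom X A) n (square z)) =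
  (diag_vertex d n (op_const n.+1), const_diag A X n (a n z)).
Proof.
congr pair; apply: smap_ext => k [c x] /=.
- rewrite (side_last f_ok) //= => i; exact: op_ext.
- rewrite (side_first f_ok) //= sfun_act; congr (act _ _); exact: op_ext.
Qed.

Definition comma_of n (z : Z n) : comma d n :=
  exist _ (square z, ((op_const n.+1 : std 0 n), a n z)) (square_pb z).

Lemma comma_of_subproof m n (b : op m.+1 n.+1) (z : Z n) :
  comma_of (act b z) = act b (comma_of z).
Proof.
apply: eq_exist; congr (_, (_, _)).
- apply: smap_ext => k [c s]; apply: smap_ext => l [e x] /=.
  by rewrite act_comp !op_compA.
- exact: op_ext.
- exact: sfun_act.
Qed.

Lemma realize_comma : exists v : smap Z (comma d),
  smap_comp (comma_proj d) v = a /\ fat_part v = f.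
Proof.
exists (SMap comma_of_subproof); split; first exact: smap_ext.
apply: smap_ext => n [s [z x]] /=.
by rewrite /fat_fun /= !op_idr act_id.
Qed.
End Realize.
End CommaMaps.

(** * The slice is a quasi-category *)

Section SliceFill.
Variables (A X : sset) (d : smap X A) (hA : quasi_category A).
Variables (N : nat) (k : 'I_N.+1) (kN : (0 < k < N)%N).
Variable h : smap (horn k) (slice d).

(* A pair of a simplex of [std N] and a cut is encoded by a simplex of        *)
(* [std N.+1], whose last vertex stands for the cone part.                    *)
Let L := base N.+1 (std 0) X.
Let sees (w : 'I_N.+2) := w == ord_max.
Let E := @evis N.+1 pred0 sees (std 0) X.
Let hE : scongr E := evis_congr _ _ _ _.

Lemma cone_shape_homo n (s : std 1 n) (y : std N n) :
  {homo (fun i => if s i == ord0 then widen_ord (leqnSn N.+1) (y i) else ord_max) : i j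
      / (i <= j)%N}.
Proof.
move=> i j le_ij; case: eqP => si; case: eqP => sj //=.
- exact: (op_le y).
- exact: ltnW.
- by case: si; apply: ord_inj; have := op_le s le_ij; rewrite sj leqn0 => /eqP.
Qed.
Definition cone_shape n (s : std 1 n) (y : std N n) : std N.+1 n := mk_op
    (cone_shape_homo s y).

Lemma cone_map_subproof m n (b : op m.+1 n.+1) (u : base 1 (std N) X n) :
  ((cone_shape (act b u).1 (act b u).2.1, (op_const m.+1, (act b u).2.2)) : L m) =
  act b ((cone_shape u.1 u.2.1, (op_const n.+1, u.2.2)) : L n).
Proof.
congr (_, (_, _)); apply: op_ext => // i.
Qed.
Definition cone_map : smap (base 1 (std N) X) L :=
  @SMap (base 1 (std N) X) L
    (fun n u => (cone_shape u.1 u.2.1, (op_const n.+1, u.2.2))) cone_map_subproof.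

Let Eth n (u u' : base 1 (std N) X n) :=
  evis seesZ seesX (emap X (std N) thin n u) (emap X (std N) thin n u').

Lemma cone_shapeE n (s : std 1 n) (y : std N n) i :
  cone_shape s y i = (if (s i < 1)%N then y i : nat else N.+1) :> nat.
Proof.
rewrite /=; case: (ord2_cases (s i)) => ->; by [].
Qed.

Lemma cone_map_E n (u u' : base 1 (std N) X n) :
  E (cone_map n u) (cone_map n u') <-> Eth u u'.
Proof.
case: u u' => s [y x] [s' [y' x']]; split=> -[/= es vy vx].
  have ev i : cone_shape s y i = cone_shape s' y' i :> nat by rewrite es.
  have {}es : s = s'.
    apply: op_val_ext => i; have := ev i; rewrite !cone_shapeE.
    have := ltn_ord (y i); have := ltn_ord (y' i).
    by case: (ord2_cases (s i)) (ord2_cases (s' i)) => -> [] -> //=; lia.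
  subst s'; split=> //= m b hb.
    apply: op_val_ext => i; have := ev (b i); rewrite !cone_shapeE.
    have := hb i; rewrite [X in seesZ X]/(thin (s (b i))) seesZ_thin.
    by rewrite !/(op_comp _ _ _) /= => ->.
  apply: vx => i; rewrite /sees -val_eqE /= -[X in X == _]/(nat_of_ord (cone_shape s y
      (b i))).
  rewrite cone_shapeE; have := hb i; rewrite [X in seesX X]/(thin (s (b i))) seesX_thin.
  by rewrite ltnNge -ltnS; case: (s (b i) < 1)%N.
have {}es : s = s'.
  apply: op_val_ext => i; have := congr1 (fun f : op _ _ => nat_of_ord (f i)) es.
  by rewrite /= !thinE => -[].
subst s'; split=> //=.
  apply: op_val_ext => i; rewrite !cone_shapeE; case: ifP => // si.
  have hb : forall l, seesZ (op_comp thin s (op_vtx i l)) by move=> l;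
      rewrite [X in seesZ X]/(thin (s i)) seesZ_thin.
  exact: (congr1 (fun f : op 1 N.+1 => nat_of_ord (f ord0)) (vy 0 (op_vtx i) hb)).
move=> m b hb; apply: vx => i; rewrite [X in seesX X]/(thin (s (b i))) seesX_thin.
have := hb i; rewrite /sees -val_eqE /= -[X in X == _]/(nat_of_ord (cone_shape s y (b
    i))).
rewrite cone_shapeE; case: (ltnP (s (b i)) 1) => // _ /eqP e.
by have := ltn_ord (y (b i)); rewrite e ltnn.
Qed.

Variables (a : smap (std N) A).
Hypothesis ha : smap_comp a (horn_incl k) = smap_comp (slice_proj d) h.

Let widen : op N.+1 N.+2 := clamp N.+1 N.+1 id.
Let widenE i : widen i = i :> nat.
Proof. by apply: clampE => [j|]; have := ltn_ord i; lia. Qed.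

Lemma base_incl_subproof m n (b : op m.+1 n.+1) (u : sprod (std N) X n) :
  ((op_comp widen (act b u).1, (op_const m.+1, (act b u).2)) : L m) =
  act b ((op_comp widen u.1, (op_const n.+1, u.2)) : L n).
Proof. by congr (_, (_, _)); apply: op_ext. Qed.
Definition base_incl : smap (sprod (std N) X) L :=
  @SMap (sprod (std N) X) L (fun n u => (op_comp widen u.1, (op_const n.+1, u.2)))
      base_incl_subproof.

Let th := thin_part h.
Let th_ok : side_ok d thin (smap_comp (slice_proj d) h) th := thin_part_ok h.

Let G0 : graph L A := graphU
  (image_graph E (smap_comp cone_map (zmap X 1 (horn_incl k))) th)
  (image_graph E base_incl (smap_comp a (sfst _ _))).

Let pG0 : pmap E G0.
Proof.
apply: graphU_pmap.
- apply: image_pmap => // n w w' /cone_map_E [/= es vy vx]; apply: (side_E th_ok);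
    split=> //= m b hb.
  by apply: eq_exist; apply: vy.
- apply: image_pmap => // n [y x] [y' x'] [/= es _ _]; congr (a _ _).
  apply: op_val_ext => i; have := congr1 (fun f : op _ _ => nat_of_ord (f i)) es.
  by rewrite /= !widenE.
move=> n u x x' [w [ew ->]] [w' [ew' ->]].
have [/= es _ _] := sc_trans hE ew (sc_sym hE ew').
have ev i : cone_shape w.1 (sval w.2.1) i = widen (w'.1 i) :> nat by rewrite es.
have w0 i : w.1 i = ord0.
  have := ev i; rewrite cone_shapeE widenE; have := ltn_ord (w'.1 i).
  by case: (ord2_cases (w.1 i)) => -> //=; lia.
change (th n w = a n w'.1); rewrite (side_first th_ok) //.
have /(congr1 (fun f : smap (horn k) A => f n w.2.1)) /= <- := ha; congr (a _ _).
by apply: op_val_ext => i; have := ev i; rewrite cone_shapeE widenE w0.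
Qed.

(** The simplices outside the given part: all vertices are hit except possibly [k]. They are matched
    by inserting [k] in front of those already present. *)
Let R n (t : std N.+1 n) := (forall j : 'I_N.+2, j <> k :> nat -> exists i, t i = j).
Let v : 'I_N.+2 := widen_ord (leqnSn N.+1) k.

(** A default coordinate for simplices lying wholly in the cone part, where [std N] is invisible; it
    is in the horn because it misses the vertex [N]. *)
Let horn_const n : {y : std N n | in_horn k y}.
Proof.
exists (op_comp (op_vtx ord0) (op_const n.+1)); exists ord_max; split.
  by move/(congr1 (@nat_of_ord _)) => /=; lia.
by move=> i /(congr1 (@nat_of_ord _)) /=; lia.
Defined.

Let dom_cone n (u : L n) (s : std 1 n) (y : horn k n) :
  (forall i, u.1 i = cone_shape s (sval y) i) -> dom G0 u.
Proof.
case: u => t [p x] /= e; exists (th n (s, (y, x))); left; exists (s, (y, x)); split=> //.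
have -> : t = cone_shape s (sval y) by apply: op_ext.
have -> : p = op_const n.+1 by apply: op_ext => i; rewrite [LHS]ord1 [RHS]ord1.
exact: (sc_refl hE).
Qed.

Let dom_base n (u : L n) : (forall i, (u.1 i < N.+1)%N) -> dom G0 u.
Proof.
case: u => t [p x] /= lt;
    pose y : std N n := @mk_op n.+1 N.+1 (fun i => Ordinal (lt i)) (fun i j le => op_le
    t le).
exists (a n y); right; exists (y, x); split=> //.
have -> : t = op_comp widen y by apply: op_val_ext => i /=; rewrite widenE.
have -> : p = op_const n.+1 by apply: op_ext => i; rewrite [LHS]ord1 [RHS]ord1.
exact: (sc_refl hE).
Qed.

Let dom_G0 n (u : L n) : ~ R u.1 -> dom G0 u.
Proof.
case: u => t [p x] /= nR.
have [j [jk hj]] : exists j : 'I_N.+2, j <> k :> nat /\ forall i, t i <> j.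
  apply: contrapT => no; apply: nR => j jk; apply: contrapT => ne; apply: no.
  by exists j; split=> // i e; apply: ne; exists i.
case: (eqVneq (j : nat) N.+1) => [jN|jN].
  apply: dom_base => i; have := ltn_ord (t i); have : t i <> j :> nat by move/ord_inj;
      apply: hj.
  by rewrite /= jN; lia.
pose s : std 1 n := clamp n.+1 1 (fun i => lo_size t N.+1 <= i)%N.
have sE i : s i = (lo_size t N.+1 <= i)%N :> nat by apply: clampE => [l|]; lia.
have sl i : (s i < 1)%N = (t i < N.+1)%N by rewrite [(t i < _)%N]lo_sizeP sE;
    case: (leqP (lo_size t N.+1) i).
case: (posnP (lo_size t N.+1)) => [l0|lo0].
  apply: (dom_cone (s := s) (y := horn_const n)) => i; apply: ord_inj.
  rewrite cone_shapeE sE l0 /=; have := lo_sizeP t N.+1 i; rewrite l0 ltn0.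
  by have := ltn_ord (t i); lia.
pose r : op n.+1 n.+1 := clamp n.+1 n (minn (lo_size t N.+1).-1).
have rE i : r i = minn (lo_size t N.+1).-1 i :> nat.
  by apply: clampE => [l|]; have := ltn_ord i; lia.
have lt i : (t (r i) < N.+1)%N by rewrite lo_sizeP rE; lia.
pose y : std N n := @mk_op n.+1 N.+1 (fun i => Ordinal (lt i)) (fun i j le => op_le t
    (op_le r le)).
have hy : in_horn k y.
  have ltj : (j < N.+1)%N by have := ltn_ord j; lia.
  exists (Ordinal ltj); split; first by move=> e; apply: jk; rewrite -e.
  by move=> i /(congr1 (@nat_of_ord _)) /= /ord_inj; apply: hj.
apply: (dom_cone (s := s) (y := exist _ y hy)) => i; apply: ord_inj.
rewrite cone_shapeE sl /=; case: ifP => [ti|].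
  have er : r i = i by apply: ord_inj; rewrite rE; move: ti; rewrite lo_sizeP; lia.
  by rewrite er.
by have := ltn_ord (t i); lia.
Qed.

Let dom_notR n (u : L n) : dom G0 u -> ~ R u.1.
Proof.
case=> x [[w [[/= es _ _] _]]|[w [[/= es _ _] _]]] Ru.
  have [j [jk hj]] := svalP w.2.1.
  have [|i hi] := Ru (widen_ord (leqnSn N.+1) j); first by move=> e; apply: jk;
      apply: ord_inj.
  have := congr1 (fun f : op _ _ => nat_of_ord (f i)) es; rewrite hi cone_shapeE /=.
  case: ifP => _ e; first by apply: (hj i); apply: ord_inj.
  by have := ltn_ord j; rewrite -e ltnn.
have [|i hi] := Ru ord_max; first by have := ltn_ord k => /=; lia.
have := congr1 (fun f : op _ _ => nat_of_ord (f i)) es; rewrite hi /= widenE => e.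
by have := ltn_ord (w.1 i); rewrite e ltnn.
Qed.

(** The join of the horn with [X], together with [std N], is extended to the join of [std N] with
    [X] by one stage of insertions of the vertex [k]. *)
Lemma fill_thin : exists f : smap (base 1 (std N) X) A,
  side_ok d thin a f /\ smap_comp f (zmap X 1 (horn_incl k)) = th.
Proof.
have vk : (k.-1 <= v <= k)%N by rewrite /v /=; lia.
have R_ext m n (s : std N.+1 m) (t : std N.+1 n) :
    (forall w, w <> v -> (exists i, s i = w) <-> (exists i, t i = w)) -> R s -> R t.
  by move=> e Rs j jk; apply/e; [move=> e'; apply: jk; rewrite e'|apply: Rs].
have [|||||||||||G [pG sG RG _]] := @stage_fill N.+1 pred0 sees (std 0) X A v k R vk
    R_ext 0 0
    (fun n t => ~ R t) (fun _ _ => False) G0.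
- by [].
- by rewrite /ref_cond /sees -val_eqE /=; have := ltn_ord k; lia.
- move=> t Rt.
  have [|i hi] := Rt ord_max; first by have := ltn_ord k => /=; lia.
  have [|l hl] := Rt ord0; first by rewrite /=; lia.
  by move: hi; rewrite (ord1 i) -(ord1 l) hl.
- by [].
- by move=> n t Rt; apply.
- by [].
- exact: pG0.
- by move=> n u /dom_notR; left.
- by move=> n u [y []].
- by move=> n u; apply: dom_G0.
(* The vertices 0 and [N] are both hit and lie on different sides of the cut at [k], so the horn is
   inner. *)
- move=> G _ _ n u Ru g _; apply: fill_inner => //.
  have [|i0 hi0] := Ru ord0; first by rewrite /=; lia.
  have [|iN hiN] := Ru (widen_ord (leqnSn N.+1) ord_max); first by rewrite /=; lia.
  by apply: (@cut_inner _ _ _ _ i0 iN); rewrite ?hi0 ?hiN /=; lia.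
have tot n (u : L n) : dom G u.
  by case: (EM (R u.1)) => [/RG//|/dom_G0]; apply: dom_sub.
have [F [FG FE]] := pmap_total pG tot.
have F1 n (w : base 1 (horn k) X n) : F n (cone_map n (zmap X 1 (horn_incl k) n w)) =
    th n w.
  apply: (pm_fun pG) (FG _ _) _; apply: sG; left; exists w; split=> //.
exists (smap_comp F cone_map); split; last by apply: smap_ext => n w; apply: F1.
split.
- by move=> n u u' e; apply: FE; apply/cone_map_E.
- move=> n [s [y x]] /= hs; apply: (pm_fun pG) (FG _ _) _; apply: sG; right.
  exists (y, x); split=> //.
  suff -> : base_incl n (y, x) = cone_map n (s, (y, x)) by exact: (sc_refl hE).
  congr (_, _); apply: op_val_ext => i.
  by rewrite /= widenE -[RHS]/(nat_of_ord (cone_shape s y i)) cone_shapeE hs.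
- move=> n [s [y x]] /= hs.
  (* Over the cone end the coordinate in [std N] is invisible and may be replaced by one in the
     horn, where [th] is known. *)
  have -> : cone_shape s y = cone_shape s (sval (horn_const n)).
    by apply: op_val_ext => i; rewrite !cone_shapeE hs.
  by rewrite [LHS](F1 n (s, (horn_const n, x))) (side_last th_ok).
Qed.
End SliceFill.

(** The projection of the horn is filled in [A] first; filling in the slice is then an extension
    problem on joins. *)
Theorem quasi_category_slice (A X : sset) (d : smap X A) :
  quasi_category A -> quasi_category (slice d).
Proof.
move=> hA N k kN h; have [a ha] := hA N k kN (smap_comp (slice_proj d) h).
have [f [f_ok fh]] := fill_thin hA kN ha.
have [u [pu tu]] := realize_slice f_ok.
exists u; apply: slice_map_ext; first by rewrite -ha -pu; apply: smap_ext.
by rewrite thin_part_comp tu.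
Qed.

(** * Homotopies *)

Section IndiscHomotopy.
Variables (A B : sset) (H : smap (sprod indisc A) B).

Lemma word_subproof n (w : 'I_n.+1 -> bool) k l (t : op k.+1 l.+1) (p : sprod (std n) A
    l) :
  H k (w \o (act t p).1, (act t p).2) = act t (H l (w \o p.1, p.2)).
Proof. by rewrite -sfun_act. Qed.
Definition word n (w : 'I_n.+1 -> bool) : ihom A B n :=
  @SMap (sprod (std n) A) B (fun k p => H k (w \o p.1, p.2)) (word_subproof w).

Lemma word_act m n (b : op m.+1 n.+1) (w : 'I_n.+1 -> bool) : act b (word w) = word (w
    \o b).
Proof. exact: smap_ext. Qed.

Lemma word_eq n (w w' : 'I_n.+1 -> bool) : w =1 w' -> word w = word w'.
Proof. by move=> e; congr word; apply/funext. Qed.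

Let x (c : bool) : ihom A B 0 := word (fun _ => c).

Let w01 (c : bool) (i : 'I_2) := (i == ord0) (+) c.

Lemma word_src c : act (op_vtx (ord0 : 'I_2)) (word (w01 c)) = x (~~ c).
Proof. by rewrite word_act; apply: word_eq. Qed.
Lemma word_tgt c : act (op_vtx (ord_max : 'I_2)) (word (w01 c)) = x c.
Proof. by rewrite word_act; apply: word_eq. Qed.
Let e c : edge (x (~~ c)) (x c) := Edge (word_src c) (word_tgt c).

Lemma word_const_src c : act (op_vtx (ord0 : 'I_2)) (word (fun _ : 'I_2 => c)) = x c.
Proof. by rewrite word_act. Qed.
Lemma word_const_tgt c : act (op_vtx (ord_max : 'I_2)) (word (fun _ : 'I_2 => c)) = x c.
Proof. by rewrite word_act. Qed.
Let k c : edge (x c) (x c) := Edge (word_const_src c) (word_const_tgt c).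

(** The 2-simplex of [indisc] visiting [c], the other object, and [c] again has a degenerate middle
    face, so the two edges compose to the identity. *)
Lemma word_round c (e1 : edge (x c) (x (~~ c))) (e2 : edge (x (~~ c)) (x c)) :
  edge_simp e1 = word (w01 (~~ c)) -> edge_simp e2 = word (w01 c) ->
  path_eq (path_cons e1 (path_cons e2 (path_nil (x c)))) (path_nil (x c)).
Proof.
move=> h1 h2.
apply: path_eq_trans (_ : path_eq _ (path_cons (k c) (path_nil _))) _; last first.
  by apply: path_eq_degen; exact: esym (word_act _ _).
apply: (@path_eq_tri _ _ _ _ _ (word (fun i : 'I_3 => (i == 1 :> nat) (+) c))).
- rewrite h1 /face01 word_act; apply: word_eq => i /=.
  by case: (ord2_cases i) => ->; rewrite /w01 /= inordK //; case: c {e1 e2 h1 h2}.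
- rewrite h2 /face12 word_act; apply: word_eq => i /=.
  by case: (ord2_cases i) => ->; rewrite /w01 /= inordK //; case: c {e1 e2 h1 h2}.
- rewrite /face02 word_act; apply: word_eq => i /=.
  by case: (ord2_cases i) => ->; rewrite /= inordK.
Qed.

Lemma iso2_homotopy (f g : smap A B) :
  (forall n z, H n (fun _ => false, z) = f n z) -> (forall n z, H n (fun _ => true, z)
      = g n z) ->
  iso2 f g.
Proof.
move=> hf hg; rewrite /iso2.
have -> : cell1 f = x false by apply: smap_ext => n [c z] /=; rewrite -hf.
have -> : cell1 g = x true by apply: smap_ext => n [c z] /=; rewrite -hg.
exists (path_cons (e true : edge (x false) (x true)) (path_nil _)).
exists (path_cons (e false : edge (x true) (x false)) (path_nil _)).
split; first exact: (@word_round false).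
exact: (@word_round true).
Qed.
End IndiscHomotopy.

Lemma ssum_act_id (X Y : sset) n (p : X n + Y n) :
  match p with inl x => inl (act (op_id n.+1) x) | inr y => inr (act (op_id n.+1) y)
      end = p.
Proof. by case: p => x; rewrite act_id. Qed.
Lemma ssum_act_comp (X Y : sset) k m n (a : op k.+1 m.+1) (b : op m.+1 n.+1) (p : X n +
    Y n) :
  match match p with inl x => inl (act b x) | inr y => inr (act b y) end with
  | inl x => inl (act a x) | inr y => inr (act a y) end =
  match p with inl x => inl (act (op_comp b a) x) | inr y => inr (act (op_comp b a) y) end
  :> X k + Y k.
Proof. by case: p => x; rewrite act_comp. Qed.
Definition ssum (X Y : sset) : sset :=
  @SSet (fun n => X n + Y n)%type
    (fun m n a p => match p with inl x => inl (act a x) | inr y => inr (act a y) end)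
    (@ssum_act_id X Y) (@ssum_act_comp X Y).

Lemma ends_subproof S m n (a : op m.+1 n.+1) (p : ssum S S n) :
  (match act a p with inl s => (fun _ => false, s) | inr s => (fun _ => true, s) end :
      sprod indisc S m) =
  act a (match p with inl s => (fun _ => false, s) | inr s => (fun _ => true, s) end :
      sprod indisc S n).
Proof. by case: p. Qed.
Definition ends S : smap (ssum S S) (sprod indisc S) :=
  @SMap (ssum S S) (sprod indisc S)
    (fun n p => match p with inl s => (fun _ => false, s) | inr s => (fun _ => true, s)
        end)
    (@ends_subproof S).

Lemma ends_inj S n : injective (ends S n).
Proof.
move=> [s|s] [t|t] /= e.
- by congr inl; exact: (congr1 snd e).
- by have := congr1 (fun w : 'I_n.+1 -> bool => w ord0) (congr1 fst e).
- by have := congr1 (fun w : 'I_n.+1 -> bool => w ord0) (congr1 fst e).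
- by congr inr; exact: (congr1 snd e).
Qed.

Section Copair.
Variables (S X A : sset) (f f' : smap (base 3 S X) A).

Lemma copair_subproof m n (b : op m.+1 n.+1) (u : base 3 (ssum S S) X n) :
  match (act b u).2.1 with
  | inl s => f m ((act b u).1, (s, (act b u).2.2))
  | inr s => f' m ((act b u).1, (s, (act b u).2.2))
  end = act b (match u.2.1 with
  | inl s => f n (u.1, (s, u.2.2))
  | inr s => f' n (u.1, (s, u.2.2))
  end).
Proof. by case: u => t [[s|s] x]; rewrite -sfun_act. Qed.
Definition copair : smap (base 3 (ssum S S) X) A :=
  @SMap (base 3 (ssum S S) X) A (fun n u => match u.2.1 with
  | inl s => f n (u.1, (s, u.2.2))
  | inr s => f' n (u.1, (s, u.2.2))
  end) copair_subproof.
End Copair.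

Section Homotopies.
Variables (A X : sset) (d : smap X A) (S : sset) (a : smap S A).

Lemma copair_ok (f f' : smap (base 3 S X) A) : span_ok d a f -> span_ok d a f' ->
  span_ok d (smap_comp (smap_comp a (ssnd indisc S)) (ends S)) (copair f f').
Proof.
move=> [fE f0 f1] [f'E f'0 f'1]; split.
- move=> n [t [p x]] [t' [p' x']] [/= et vy vx]; subst t'.
  (* A vertex that sees the coordinate in the sum reveals its summand, so both simplices lie in the
     same one; otherwise everything is over [X] and both spans equal [d]. *)
  have [h|nh] := EM (exists i, seesZ (t i)).
    have [i hi] := h.
    have hv (l : 'I_1) : seesZ (t (op_vtx i l)) by [].
    case: p p' vy => s [s'|s'] vy; try by have := vy 0 (op_vtx i) hv.
      apply: fE; split=> //= m b hb; have := vy m b hb => /= e.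
      by case: e.
    apply: f'E; split=> //= m b hb; have := vy m b hb => /= e.
    by case: e.
  have t2 i : (1 < t i)%N.
    rewrite ltnNge; apply/negP => /seesZ_le hi; apply: nh; by exists i.
  have -> : (match p with inl s => f n (t, (s, x)) | inr s => f' n (t, (s, x)) end) = d
      n x.
    by case: p {vy} => s; [apply: f1|apply: f'1].
  have -> : (match p' with inl s => f n (t, (s, x')) | inr s => f' n (t, (s, x')) end)
      = d n x'.
    by case: p' {vy} => s; [apply: f1|apply: f'1].
  by congr (d n _); apply: vis_total vx => i; apply: seesX_gt.
- by move=> n [t [[s|s] x]] /= h; [apply: f0|apply: f'0].
- by move=> n [t [[s|s] x]] /= h; [apply: f1|apply: f'1].
Qed.

Definition incl_const (c : bool) : smap S (sprod indisc S) :=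
  @SMap S (sprod indisc S) (fun n s => (fun _ => c, s)) (fun _ _ _ _ => erefl).

Hypothesis hA : quasi_category A.

(** The two spans, placed at the ends of the product with [indisc], share the fat part [v], which
    extends constantly along [indisc]. By [extend_fat] the spans extend too, and the thin part of
    the extension is a homotopy from [u] to [u']. *)
Lemma iso2_of_fat (v : smap S (comma d)) (u u' : smap S (slice d)) f f' :
  smap_comp (comma_proj d) v = a -> smap_comp (slice_proj d) u = a ->
  smap_comp (slice_proj d) u' = a -> span_ok d a f -> span_ok d a f' ->
  smap_comp f (emap X S fat) = fat_part v -> smap_comp f' (emap X S fat) = fat_part v ->
  smap_comp f (emap X S thin) = thin_part u -> smap_comp f' (emap X S thin) = thin_part
      u' ->
  iso2 u u'.
Proof.
move=> va ua ua' f_ok f'_ok ff ff' ft ft'.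
pose g := smap_comp v (ssnd indisc S).
have ea : smap_comp (comma_proj d) g = smap_comp a (ssnd indisc S) by rewrite -va;
    apply: smap_ext.
have g_ok := fat_part_ok g; rewrite ea in g_ok.
have cE : smap_comp (copair f f') (emap X (ssum S S) fat) = smap_comp (fat_part g)
    (zmap X 1 (ends S)).
  apply: smap_ext => n [t [[s|s] x]].
    exact: (congr1 (fun k : smap (base 1 S X) A => k n (t, (s, x))) ff).
  exact: (congr1 (fun k : smap (base 1 S X) A => k n (t, (s, x))) ff').
have [||||F [F_ok Ff Fe]] := extend_fat hA _ _ (@ends_inj S) g_ok (copair_ok f_ok
    f'_ok) cE.
- by rewrite fatE.
- by rewrite fatE.
- by apply: ord_inj; rewrite fatE.
- by apply: ord_inj; rewrite fatE.
have t0 : (thin ord0 <= 1)%N by rewrite thinE.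
have t1 : (1 < thin ord_max)%N by rewrite thinE.
have [w [wa wt]] := realize_slice (span_side t0 t1 F_ok).
apply: (iso2_homotopy (H := w)) => n s.
  suff -> : u = smap_comp w (incl_const false) by [].
  apply: slice_map_ext.
    by rewrite ua; apply: smap_ext => k z;
        rewrite -[RHS]/((smap_comp (slice_proj d) w) k (fun _ => false, z)) wa.
  rewrite thin_part_comp wt -ft; apply: smap_ext => k [t [z x]].
  exact: (congr1 (fun K : smap (base 3 (ssum S S) X) A => K k (op_comp thin t, (inl z,
      x))) (esym Fe)).
suff -> : u' = smap_comp w (incl_const true) by [].
apply: slice_map_ext.
  by rewrite ua'; apply: smap_ext => k z;
      rewrite -[RHS]/((smap_comp (slice_proj d) w) k (fun _ => true, z)) wa.
rewrite thin_part_comp wt -ft'; apply: smap_ext => k [t [z x]].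
exact: (congr1 (fun K : smap (base 3 (ssum S S) X) A => K k (op_comp thin t, (inr z,
    x))) (esym Fe)).
Qed.

Lemma iso2_of_thin (u : smap S (slice d)) (v v' : smap S (comma d)) f f' :
  smap_comp (slice_proj d) u = a -> smap_comp (comma_proj d) v = a ->
  smap_comp (comma_proj d) v' = a -> span_ok d a f -> span_ok d a f' ->
  smap_comp f (emap X S thin) = thin_part u -> smap_comp f' (emap X S thin) = thin_part
      u ->
  smap_comp f (emap X S fat) = fat_part v -> smap_comp f' (emap X S fat) = fat_part v' ->
  iso2 v v'.
Proof.
move=> ua va va' f_ok f'_ok ff ff' ft ft'.
pose g := smap_comp u (ssnd indisc S).
have ea : smap_comp (slice_proj d) g = smap_comp a (ssnd indisc S) by rewrite -ua;
    apply: smap_ext.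
have g_ok := thin_part_ok g; rewrite ea in g_ok.
have cE : smap_comp (copair f f') (emap X (ssum S S) thin) = smap_comp (thin_part g)
    (zmap X 1 (ends S)).
  apply: smap_ext => n [t [[s|s] x]].
    exact: (congr1 (fun k : smap (base 1 S X) A => k n (t, (s, x))) ff).
  exact: (congr1 (fun k : smap (base 1 S X) A => k n (t, (s, x))) ff').
have t0 : (thin ord0 <= 1)%N by rewrite thinE.
have t1 : (1 < thin ord_max)%N by rewrite thinE.
have [||F [F_ok Ff Fe]] := extend_thin hA t0 t1 (@ends_inj S) g_ok (copair_ok f_ok
    f'_ok) cE.
- by apply: ord_inj; rewrite thinE.
- by apply: ord_inj; rewrite thinE.
have f0 : (fat ord0 <= 1)%N by rewrite fatE.
have f1 : (1 < fat ord_max)%N by rewrite fatE.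
have [w [wa wt]] := realize_comma (span_side f0 f1 F_ok).
apply: (iso2_homotopy (H := w)) => n s.
  suff -> : v = smap_comp w (incl_const false) by [].
  apply: comma_map_ext.
    by rewrite va; apply: smap_ext => k z;
        rewrite -[RHS]/((smap_comp (comma_proj d) w) k (fun _ => false, z)) wa.
  rewrite fat_part_comp wt -ft; apply: smap_ext => k [t [z x]].
  exact: (congr1 (fun K : smap (base 3 (ssum S S) X) A => K k (op_comp fat t, (inl z,
      x))) (esym Fe)).
suff -> : v' = smap_comp w (incl_const true) by [].
apply: comma_map_ext.
  by rewrite va'; apply: smap_ext => k z;
      rewrite -[RHS]/((smap_comp (comma_proj d) w) k (fun _ => true, z)) wa.
rewrite fat_part_comp wt -ft'; apply: smap_ext => k [t [z x]].
exact: (congr1 (fun K : smap (base 3 (ssum S S) X) A => K k (op_comp fat t, (inr z,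
    x))) (esym Fe)).
Qed.
End Homotopies.

(** * The comparison maps and the equivalence *)

Definition sempty : sset :=
  @SSet (fun _ => Empty_set) (fun _ _ _ x => x) (fun _ _ => erefl) (fun _ _ _ _ _ _ =>
      erefl).

Definition from_empty (Y : sset) : smap sempty Y :=
  @SMap sempty Y (fun _ x => match x with end) (fun _ _ _ x => match x with end).

Lemma smap_comp_id X Y (f : smap X Y) : smap_comp f (smap_id X) = f.
Proof. exact: smap_ext. Qed.
Lemma smap_id_comp X Y (f : smap X Y) : smap_comp (smap_id Y) f = f.
Proof. exact: smap_ext. Qed.
Lemma smap_compA W X Y Z (h : smap Y Z) (g : smap X Y) (f : smap W X) :
  smap_comp h (smap_comp g f) = smap_comp (smap_comp h g) f.
Proof. exact: smap_ext. Qed.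

Section Main.
Variables (A X : sset) (d : smap X A) (hA : quasi_category A).

Definition from_base_empty : smap (base 3 sempty X) A :=
  @SMap (base 3 sempty X) A (fun _ u => match u.2.1 with end) (fun _ _ _ u => match
      u.2.1 with end).

Lemma from_base_empty_ok a : span_ok d a from_base_empty.
Proof. by split=> n [t [[]]]. Qed.

Let thin0 : (thin ord0 <= 1)%N. Proof. by rewrite thinE. Qed.
Let thin1 : (1 < thin ord_max)%N. Proof. by rewrite thinE. Qed.
Let thin0E : thin ord0 = w1. Proof. by apply: ord_inj; rewrite thinE. Qed.
Let thin1E : thin ord_max = w2. Proof. by apply: ord_inj; rewrite thinE. Qed.
Let fat0 : (fat ord0 <= 1)%N. Proof. by rewrite fatE. Qed.
Let fat1 : (1 < fat ord_max)%N. Proof. by rewrite fatE. Qed.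
Let fat0E : fat ord0 = w0. Proof. by apply: ord_inj; rewrite fatE. Qed.
Let fat1E : fat ord_max = w3. Proof. by apply: ord_inj; rewrite fatE. Qed.

(** With nothing prescribed on the empty simplicial set, the identity of the slice, taken as a thin
    part, extends to a span; the fat part of that span is the comparison map. *)
Lemma slice_span : exists (p : smap (base 3 (slice d) X) A) (f : smap (slice d) (comma
    d)),
  [/\ span_ok d (slice_proj d) p, smap_comp p (emap X _ thin) = thin_part (smap_id
      (slice d)),
      smap_comp p (emap X _ fat) = fat_part f & smap_comp (comma_proj d) f = slice_proj
          d].
Proof.
have i_ok := thin_part_ok (smap_id (slice d)); rewrite smap_comp_id in i_ok.
have [||p [p_ok pt _]] := extend_thin hA thin0 thin1 (g := from_empty _) _ i_ok
    (from_base_empty_ok _) _ thin0E thin1E.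
- by move=> n [].
- by apply: smap_ext => n [t [[]]].
have [f [fa ff]] := realize_comma (span_side fat0 fat1 p_ok).
by exists p, f; split=> //; rewrite ?fa.
Qed.

Lemma comma_span : exists (p : smap (base 3 (comma d) X) A) (g : smap (comma d) (slice
    d)),
  [/\ span_ok d (comma_proj d) p, smap_comp p (emap X _ fat) = fat_part (smap_id (comma
      d)),
      smap_comp p (emap X _ thin) = thin_part g & smap_comp (slice_proj d) g =
          comma_proj d].
Proof.
have i_ok := fat_part_ok (smap_id (comma d)); rewrite smap_comp_id in i_ok.
have [||p [p_ok pf _]] := extend_fat hA fat0 fat1 (g := from_empty _) _ i_ok
    (from_base_empty_ok _) _ fat0E fat1E.
- by move=> n [].
- by apply: smap_ext => n [t [[]]].
have [g [ga gf]] := realize_slice (span_side thin0 thin1 p_ok).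
by exists p, g; split=> //; rewrite ?ga.
Qed.

(* A horn in the comma is transported to the slice along a span, filled       *)
(* there, and transported back.                                               *)
Lemma quasi_category_comma : quasi_category (comma d).
Proof.
move=> N k kN h; have [p [g [p_ok pf pt ga]]] := comma_span.
have [u uh] := quasi_category_slice (d := d) hA kN (smap_comp g h).
have ea : smap_comp (smap_comp (slice_proj d) u) (horn_incl k) = smap_comp (comma_proj
    d) h.
  by rewrite -ga -!smap_compA uh.
have inj n : injective (horn_incl k n) by move=> [b hb] [b' hb'] /= e; apply: eq_exist.
have p_ok' := span_zmap h p_ok; rewrite -ea in p_ok'.
have [|q [q_ok qt qh]] := extend_thin hA thin0 thin1 inj (thin_part_ok u) p_ok' _
    thin0E thin1E.
  rewrite -thin_part_comp uh thin_part_comp -pt.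
  exact: smap_ext.
have [v [va vf]] := realize_comma (span_side fat0 fat1 q_ok).
exists v; apply: comma_map_ext.
  by rewrite -ea -va smap_compA.
rewrite fat_part_comp vf -[h in RHS]smap_id_comp fat_part_comp -pf.
apply: smap_ext => n [t [z x]].
exact: (congr1 (fun K : smap (base 3 (horn k) X) A => K n (op_comp fat t, (z, x))) qh).
Qed.
End Main.

Theorem lemma5p2p7 (A X : sset) (d : smap X A) (hA : quasi_category A) :
  exists f : smap (slice d) (comma d),
    qcat_equivalence f /\ smap_comp (comma_proj d) f = slice_proj d.
Proof.
have [p [f [p_ok pt pf fa]]] := slice_span d hA.
have [q [g [q_ok qf qt ga]]] := comma_span d hA.
exists f; split=> //; split.
- exact: quasi_category_slice.
- exact: quasi_category_comma.
have pg_ok := span_zmap g p_ok; have qf_ok := span_zmap f q_ok.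
have fg : smap_comp (slice_proj d) (smap_comp g f) = slice_proj d.
  by rewrite smap_compA ga.
have gf : smap_comp (comma_proj d) (smap_comp f g) = comma_proj d.
  by rewrite smap_compA fa.
rewrite ga in pg_ok; rewrite fa in qf_ok.
exists g; split.
(* Both spans have fat part [f]: the span of the comma pulled back along [f] has thin part [g] after
   [f], and the span of the slice has the identity. *)
- apply: (@iso2_of_fat A X d _ (slice_proj d) hA f (smap_comp g f) (smap_id _)
    (smap_comp q (zmap X 3 f)) p) => //.
  + exact: smap_comp_id.
  + have -> : fat_part f = smap_comp (fat_part (smap_id _)) (zmap X 1 f).
      by rewrite -fat_part_comp smap_id_comp.
    by rewrite -qf; apply: smap_ext.
  + by rewrite thin_part_comp -qt; apply: smap_ext.
- apply: (@iso2_of_thin A X d _ (comma_proj d) hA g (smap_comp f g) (smap_id _)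
    (smap_comp p (zmap X 3 g)) q) => //.
  + exact: smap_comp_id.
  + have -> : thin_part g = smap_comp (thin_part (smap_id _)) (zmap X 1 g).
      by rewrite -thin_part_comp smap_id_comp.
    by rewrite -pt; apply: smap_ext.
  + by rewrite fat_part_comp -pf; apply: smap_ext.
Qed.
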